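(* Suppose that $b>0$ and $\psi\in C([-1,0];\mathbb{R})$. Let $X$ be the unique continuous adapted process satisfying (the case $a=0$) $$dX(t)=\frac{b}{1+t}\int_{-1}^t X(s)\,ds\,dt+\sigma\,dB(t),\quad t\ge 0;\qquad X(t)=\psi(t),\quad t\in[-1,0].$$ Then: (a) There exists an $\mathcal{F}^B(\infty)$-measurable normal random variable $C$ such that $$\lim_{t\to\infty}\frac{X(t)}{t^{-1/4}e^{2\sqrt{bt}}}=C,\quad\text{a.s.}$$ (b) $C$ is given by $$C=\frac{1}{b^{1/4}\sqrt\pi}\Big(\psi(0)\sqrt b\,K_1(2\sqrt b)+b\int_{-1}^0\psi(s)\,ds\;K_0(2\sqrt b)\Big)+\frac{\sigma b^{1/4}}{\sqrt\pi}\int_0^\infty\sqrt{s+1}\,K_1\big(2\sqrt{b(s+1)}\big)\,dB(s).$$ (c) The mean and variance of $C$ are $$\mathbb{E}[C]=\frac{1}{\sqrt\pi}\Big(\psi(0)b^{1/4}K_1(2\sqrt b)+b^{3/4}\int_{-1}^0\psi(s)\,ds\;K_0(2\sqrt b)\Big),$$ $$\mathrm{Var}[C]=\frac{\sigma^2b^{1/2}}{\pi}\int_0^\infty(s+1)\,K_1^2\big(2\sqrt{b(s+1)}\big)\,ds>0.$$ (d) The mean and variance of $X$ satisfy $$\lim_{t\to\infty}\frac{\mathbb{E}[X(t)]}{t^{-1/4}e^{2\sqrt{bt}}}=\mathbb{E}[C],\qquad\lim_{t\to\infty}\frac{\mathrm{Var}[X(t)]}{t^{-1/2}e^{4\sq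rt{bt}}}=\mathrm{Var}[C].$$
   Context: $\sigma>0$, $\psi$ is deterministic, and $B$ is a standard one-dimensional Brownian motion on a complete probability space with a filtration satisfying the usual conditions, to which $B$ is adapted. $\mathcal{F}^B(\infty)$ is the (completed) $\sigma$-algebra generated by $\{B(s):s\ge0\}$. ''a.s.'' means almost surely. $K_0$ and $K_1$ are the modified Bessel functions of the second kind of orders $0$ and $1$. *)

(* Defs.v *)
From HB Require Import structures.
From mathcomp Require Export all_boot all_order all_algebra.
From mathcomp Require Export all_classical all_reals all_analysis.

Set Implicit Arguments.
Unset Strict Implicit.
Unset Printing Implicit Defensive.

Export Order.TTheory GRing.Theory Num.Theory.
Export numFieldNormedType.Exports.

Local Open Scope classical_set_scope.
Local Open Scope ring_scope.

Definition cosh {R : realType} (u : R) : R := (expR u + expR (- u)) / 2.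

(* Modified Bessel function of the second kind of order nu at x > 0, through
   K_nu(x) = \int_0^oo e^(- x cosh u) cosh (nu u) du  (DLMF 10.32.9).
   The integrand is nonnegative and integrable for every x > 0. *)
Definition besselK {R : realType} (nu x : R) : R :=
  \int[lebesgue_measure]_(u in `[0, +oo[) (expR (- x * cosh u) * cosh (nu * u)).

Section processes.
Context {d : measure_display} {T : measurableType d} {R : realType}.
Variable P : probability T R.

(* Processes and filtrations are indexed by R; only the times stated in each
   definition matter. *)
Implicit Types (F : R -> set (set T)) (B : R -> T -> R) (Y J : T -> R).

Definition measurable_wrt (G : set (set T)) Y :=
  forall U : set R, measurable U -> G (Y @^-1` U).

Record usual_filtration F : Prop := UsualFiltration {
  filtration_sigma : forall t : R, 0 <= t -> sigma_algebra setT (F t);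
  filtration_sub : forall t : R, 0 <= t -> F t `<=` measurable;
  filtration_mono : forall s t : R, 0 <= s -> s <= t -> F s `<=` F t;
  filtration_right_cont : forall t : R, 0 <= t ->
    F t = \bigcap_(s in [set s | t < s]) F s;
  filtration_complete : forall (t : R) N, 0 <= t -> P.-negligible N -> F t N
}.

Definition adapted F B := forall t : R, 0 <= t -> measurable_wrt (F t) (B t).

Definition events_of (I : set R) B : set (set T) :=
  [set A | exists2 s, I s &
     exists2 U : set R, measurable U & A = B s @^-1` U].

(* Standard Brownian motion: the increment over [s, t] is independent of the
   past (B u)_(0 <= u <= s) and has law N(0, t - s). In [normal_prob m sd], sd
   is the standard deviation, and [normal_prob m 0] is not a Dirac mass, hence
   s < t. *)
Record brownian_motion B : Prop := BrownianMotion {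
  brownian_measurable : forall t : R, 0 <= t -> measurable_fun setT (B t);
  brownian_start : {ae P, forall w, B 0 w = 0};
  brownian_continuous :
    {ae P, forall w, {within `[0, +oo[, continuous (fun t => B t w)}};
  brownian_normal : forall (s t : R) (U : set R), 0 <= s -> s < t -> measurable U ->
    P ((fun w => (B t w - B s w)%R) @^-1` U) = normal_prob 0 (Num.sqrt (t - s)) U;
  brownian_indep : forall (s t : R) (A : set T) (U : set R),
    0 <= s -> s < t -> <<s events_of `[0, s] B >> A -> measurable U ->
    P (A `&` (fun w => (B t w - B s w)%R) @^-1` U) =
    (P A * P ((fun w => (B t w - B s w)%R) @^-1` U))%E
}.

(* The completed sigma-algebra generated by (B t)_(t >= 0). *)
Definition brownian_sigma_algebra B : set (set T) :=
  <<s events_of `[0, +oo[ B `|` [set N | P.-negligible N] >>.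

(* The case sd = 0 is excluded: see [brownian_motion]. *)
Definition normal_rv Y := exists m sd : R, 0 < sd /\
  forall U : set R, measurable U -> P (Y @^-1` U) = normal_prob m sd U.

(* A list of triples (c, (s, t)) encodes the step function
   \sum c \1_(s, t], whose integral against B is \sum c (B t - B s). *)
Definition step_fun (l : seq (R * (R * R))) (u : R) : R :=
  \sum_(x <- l) x.1 * \1_(`]x.2.1, x.2.2]) u.

Definition step_integral B (l : seq (R * (R * R))) (w : T) : R :=
  \sum_(x <- l) x.1 * (B x.2.2 w - B x.2.1 w).

(* J is (a version of) the stochastic integral \int_0^oo f dB of the
   deterministic f in L^2(0, oo): the L^2(P) limit of the integrals of step
   functions that converge to f in L^2(0, oo). *)
Definition stochastic_integral B (f : R -> R) J :=
  measurable_fun setT J /\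
  exists l : nat -> seq (R * (R * R)),
    [/\ forall n x, x \in l n -> 0 <= x.2.1 <= x.2.2,
        (\int[lebesgue_measure]_(u in `[0%R, +oo[)
           ((step_fun (l n) u - f u) ^+ 2)%:E)%E @[n --> \oo] --> 0%E &
        (\int[P]_w ((step_integral B (l n) w - J w) ^+ 2)%:E)%E
           @[n --> \oo] --> 0%E].

(* X is a continuous adapted solution of
     dX(t) = b / (1 + t) (\int_(-1)^t X(s) ds) dt + sigma dB(t),  t >= 0,
   with X = psi on [-1, 0], the equation being read in integrated form. *)
Record solution F B (b sigma : R) (psi : R -> R) (X : R -> T -> R) : Prop :=
  Solution {
  solution_adapted : adapted F X;
  solution_continuous :
    {ae P, forall w, {within `[-1, +oo[, continuous (fun t => X t w)}};
  solution_init : {ae P, forall w, forall t : R, -1 <= t <= 0 -> X t w = psi t};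
  solution_eq : {ae P, forall w, forall t : R, 0 <= t ->
    X t w = X 0 w
      + \int[lebesgue_measure]_(s in `[0, t])
          (b / (1 + s) * \int[lebesgue_measure]_(u in `[-1, s]) X u w)
      + sigma * (B t w - B 0 w)}
}.

End processes.

(* Main.v *)
From HB Require Import structures.
Require Import Defs.
From mathcomp Require Import all_boot all_order all_algebra.
From mathcomp Require Import all_classical all_reals all_analysis.
From mathcomp Require Import measurable_realfun.
From mathcomp Require Import ring lra.

Import Order.TTheory GRing.Theory Num.Theory.
Import numFieldNormedType.Exports.

Set Implicit Arguments.
Unset Strict Implicit.
Unset Printing Implicit Defensive.

Local Open Scope classical_set_scope.
Local Open Scope ring_scope.

(** Write [I t] for the integral of a path of [X] over [[-1, t]]. Without noise
    the equation reads [I'' = b / (1 + t) * I]. Its solution that decays at infinity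
    is [kap t = sqrt (t + 1) * K_1 (2 sqrt (b (t + 1)))], with derivative [- eta t]
    for [eta t = sqrt b * K_0 (2 sqrt (b (t + 1)))]. These two facts and all the
    estimates on Bessel functions come from the integral representation: one
    integration by parts gives (x K_1)' = - x K_0 ([bM_parts]), and the elementary
    function K_(1/2) lies between K_0 and K_1, whose quotient tends to 1. Hence
    [kap t] times the rate [t ^ (- 1/4) * exp (2 sqrt (b t))] tends to
    [sqrt pi / (2 b ^ (1/4))] ([kap_asymptotic]).

    Testing the equation against [kap] removes the drift ([wronskian]):
    [X t * kap t + I t * eta t] equals [X 0 * kap 0 + I 0 * eta 0] plus [sigma]
    times the Wiener integral of [kap] over [[0, t]], read pathwise through
    integration by parts. Brownian paths grow at most quadratically
    ([brownian_growth], from Ottaviani's inequality and the Borel-Cantelli lemma)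
    while [kap] and [eta] decay faster than any power, so this quantity converges
    for almost every path. L'Hopital's rule for [I / kap], whose derivative is the
    convergent quantity divided by [kap ^ 2], shows that its two terms have the same
    limit ([kernel_limit]). So [kap t * X t] converges to half the limit, and the
    asymptotics of [kap] give [C] as a constant plus a multiple of the Wiener
    integral [noise] of [kap] over the half line.

    The law of [C] is obtained from Riemann sums: by independence of the increments
    they are Gaussian ([gaussian_grid_sum], [gaussian_add]), their variances
    converge, and pathwise they converge to the integrated by parts Wiener integral.
    [gaussian_limit] turns this into the law of the limit and convergence in mean
    square, which also exhibits [noise] as a stochastic integral.

    For the moments of [X t], testing instead against the solution [bsol t] of the
    homogeneous equation with value 1 and slope 0 at [t] yields [X t] itself as an
    explicit mean plus [sigma] times the Wiener integral of [bsol t]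
    ([path_solution]). Thus [X t] is Gaussian for every [t], and the limits of its
    mean and variance are limits of deterministic expressions in [kap], [eta] and
    the second solution [kap * Qf] ([cvg_mean], [cvg_variance]). *)

(** * Calculus on the real line *)

Section calculus.
Context {R : realType}.
Implicit Types (f g : R -> R) (x df dg : R).

Lemma deriv_eq f x df df' : is_derive x 1 f df -> df = df' -> is_derive x 1 f df'.
Proof. by move=> ? <-. Qed.

Lemma deriv_cst (a : R) x : is_derive x 1 (fun=> a) 0.
Proof. exact: is_derive_cst. Qed.

Lemma deriv_id x : is_derive x 1 (fun y : R => y) 1.
Proof. exact: is_derive_id. Qed.

Lemma derivD f g x df dg : is_derive x 1 f df -> is_derive x 1 g dg ->
  is_derive x 1 (fun y => f y + g y) (df + dg).
Proof. by move=> ? ?; exact: is_deriveD. Qed.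

Lemma derivN f x df : is_derive x 1 f df -> is_derive x 1 (fun y => - f y) (- df).
Proof. by move=> ?; exact: is_deriveN. Qed.

Lemma derivB f g x df dg : is_derive x 1 f df -> is_derive x 1 g dg ->
  is_derive x 1 (fun y => f y - g y) (df - dg).
Proof. by move=> ? ?; exact: is_deriveB. Qed.

Lemma derivM f g x df dg : is_derive x 1 f df -> is_derive x 1 g dg ->
  is_derive x 1 (fun y => f y * g y) (df * g x + f x * dg).
Proof.
move=> hf hg; have -> : df * g x + f x * dg = f x *: dg + g x *: df.
  by rewrite addrC /GRing.scale/= [g x * _]mulrC.
exact: is_deriveM.
Qed.

Lemma derivZ (a : R) f x df : is_derive x 1 f df ->
  is_derive x 1 (fun y => a * f y) (a * df).
Proof.
move=> h; have := derivM (deriv_cst a x) h.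
by rewrite mul0r add0r.
Qed.

Lemma deriv_comp f g x df dg : is_derive x 1 g dg -> is_derive (g x) 1 f df ->
  is_derive x 1 (fun y => f (g y)) (df * dg).
Proof. by move=> ? ?; exact: is_derive1_comp. Qed.

Lemma deriv_exp f x df : is_derive x 1 f df ->
  is_derive x 1 (fun y => expR (f y)) (expR (f x) * df).
Proof. by move=> h; exact: (deriv_comp h (is_derive_expR _)). Qed.

Lemma derivV f x df : is_derive x 1 f df -> f x != 0 ->
  is_derive x 1 (fun y => (f y)^-1) (- df / (f x) ^+ 2).
Proof.
move=> h fx; have -> : - df / (f x) ^+ 2 = - f x ^- 2 *: df.
  by rewrite /GRing.scale/= mulrC mulNr mulrN.
exact: is_deriveV.
Qed.

Lemma deriv_cont f x df : is_derive x 1 f df -> {for x, continuous f}.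
Proof.
by move=> h; apply/differentiable_continuous/derivable1_diffP; exact: ex_derive.
Qed.

Lemma deriv_derivable f x df : is_derive x 1 f df -> derivable f x 1.
Proof. by move=> h; exact: ex_derive. Qed.

Lemma deriv_derive1 f x df : is_derive x 1 f df -> (f^`())%classic x = df.
Proof. by move=> h; rewrite derive1E; exact: derive_val. Qed.

End calculus.

Section integrable_real.
Context d (T : measurableType d) (R : realType) (mu : {measure set T -> \bar R}).
Variables (D : set T) (f g : T -> R).
Hypotheses (mD : measurable D) (fi : mu.-integrable D (EFin \o f))
  (gi : mu.-integrable D (EFin \o g)).

Lemma integrable_addr : mu.-integrable D (EFin \o (fun u => f u + g u)).
Proof. exact: (@integrableD _ _ _ mu D mD (EFin \o f) (EFin \o g)). Qed.

Lemma integrable_subr : mu.-integrable D (EFin \o (fun u => f u - g u)).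
Proof. exact: (@integrableB _ _ _ mu D mD (EFin \o f) (EFin \o g)). Qed.

Lemma integrable_scaler (a : R) : mu.-integrable D (EFin \o (fun u => a * f u)).
Proof. exact: (@integrableZl _ _ _ mu D mD a (EFin \o f)). Qed.

End integrable_real.

Section integrals.
Context {R : realType}.
Notation mu := (@lebesgue_measure R).
Implicit Types (f F : R -> R) (a b t u : R).

Lemma cont_within f (A : set R) : (forall u, A u -> {for u, continuous f}) ->
  {within A, continuous f}.
Proof.
by move=> cf; apply: continuous_in_subspaceT => u /set_mem; exact: cf.
Qed.

Lemma cont_integrable f a b : {within `[a, b], continuous f} ->
  mu.-integrable `[a, b] (EFin \o f).
Proof. by move=> cf; apply: continuous_compact_integrable => //; exact: segment_compact. Qed.

Lemma FTC2 f F a b : a <= b ->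
  (forall u, a <= u <= b -> is_derive u 1 F (f u)) ->
  (forall u, a <= u <= b -> {for u, continuous f}) ->
  \int[mu]_(u in `[a, b]) f u = F b - F a.
Proof.
rewrite le_eqVlt => /predU1P[<- dF cf|ab dF cf].
  by rewrite set_itv1 Rintegral_set1 subrr.
rewrite /Rintegral (@continuous_FTC2 _ f F)//.
- by apply: cont_within => u; rewrite /= in_itv/=; exact: cf.
- split.
  + move=> u; rewrite in_itv/= => /andP[au ub].
    by apply: deriv_derivable (dF _ _); rewrite !ltW.
  + apply: cvg_at_right_filter; apply: deriv_cont (dF _ _).
    by rewrite lexx ltW.
  + apply: cvg_at_left_filter; apply: deriv_cont (dF _ _).
    by rewrite lexx ltW.
- move=> u; rewrite in_itv/= => /andP[au ub].
  by apply: deriv_derive1 (dF _ _); rewrite !ltW.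
Qed.

(** Dominated convergence along an arbitrary sequence of times tending to
    infinity. *)
Lemma cvg_Rintegral_itv0y f : mu.-integrable `[0, +oo[ (EFin \o f) ->
  (\int[mu]_(u in `[0, t]) f u) @[t --> +oo] --> \int[mu]_(u in `[0, +oo[) f u.
Proof.
move=> fi; apply/cvg_pinftyP => t ty.
have /integrableP[mf _] := fi.
apply: fine_cvg; rewrite fineK; last exact: integrable_fin_num.
rewrite (_ : (fun n => _) = (fun n => \int[mu]_(u in `[0%R, +oo[)
    ((EFin \o f) \_ `[0%R, t n]) u)%E); last first.
  apply/funext => n; rewrite -integral_mkcondr; congr (integral _ _ _).
  apply/seteqP; split => u /=; rewrite !in_itv/=.
    by move=> /andP[-> ->].
  by move=> [/andP[-> _] ->].
apply: (@dominated_cvg _ _ _ mu `[0%R, +oo[ _ _ _ (abse \o (EFin \o f))) => //.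
- move=> n; apply/measurable_restrict => //.
  by apply: measurable_funS mf => // u [].
- move=> u; rewrite /= in_itv/= andbT => u0.
  apply: cvg_near_cst; near=> n; rewrite patchE ifT// inE/= in_itv/= u0/=.
  by near: n; exact: (cvgryPge _).1 ty _.
- exact: integrable_abse.
- by move=> n u _; rewrite patchE; case: ifPn => //= _; rewrite normr0 lee_fin.
Unshelve. all: by end_near. Qed.

Lemma FTC2y f F (l : R) :
  (forall u, 0 <= u -> is_derive u 1 F (f u)) ->
  (forall u, 0 <= u -> {for u, continuous f}) ->
  mu.-integrable `[0, +oo[ (EFin \o f) -> F u @[u --> +oo] --> l ->
  \int[mu]_(u in `[0, +oo[) f u = l - F 0.
Proof.
move=> dF cf fi Fl; have h := cvg_Rintegral_itv0y fi.
apply: (cvg_unique (@norm_hausdorff _ R^o) h).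
apply: (@cvg_trans _ ((F t - F 0) @[t --> +oo])); last first.
  by apply: cvgB Fl _; exact: cvg_cst.
apply: near_eq_cvg; near=> t; apply/esym/FTC2 => //.
- by move=> u /andP[u0 _]; exact: dF.
- by move=> u /andP[u0 _]; exact: cf.
Unshelve. all: by end_near. Qed.

Lemma cvg_expdecay (D r : R) : 0 < r -> D * expR (- r * u) @[u --> +oo] --> (0 : R).
Proof.
move=> r0; rewrite -[X in _ --> X](mulr0 D); apply: cvgM; first exact: cvg_cst.
have h : u * r @[u --> +oo] --> +oo by apply: gt0_cvgMly => //; exact: cvg_id.
have := cvg_comp _ _ h (@cvgr_expR R).
by under eq_cvg do rewrite /= -mulrN mulrC.
Qed.

Lemma squeeze_near0 (f g : R -> R) (F : set_system R) : Filter F ->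
  (\forall u \near F, `|f u| <= g u) -> g u @[u --> F] --> (0 : R) ->
  f u @[u --> F] --> (0 : R).
Proof.
move=> FF fg g0; apply/norm_cvg0P.
apply: squeeze_cvgr (cvg_cst 0) g0.
by apply: filterS fg => u ->; rewrite normr_ge0.
Qed.

Lemma Rintegral_itv_split f a b c : a <= b -> b <= c ->
  mu.-integrable `[a, c] (EFin \o f) ->
  \int[mu]_(u in `[a, c]) f u =
  \int[mu]_(u in `[a, b]) f u + \int[mu]_(u in `[b, c]) f u.
Proof.
move=> ab bc fi; have := @Rintegral_itvB _ f (BLeft a) (BRight c) b fi.
rewrite !bnd_simp => /(_ ab bc) /eqP; rewrite subr_eq => /eqP ->.
rewrite addrC Rintegral_itv_obnd_cbnd//.
by apply: integrableS fi => //; apply: subset_itvr; rewrite bnd_simp.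
Qed.

Lemma deriv_Rintegral f a t : a < t -> (forall u, a <= u -> {for u, continuous f}) ->
  is_derive t 1 (fun t => \int[mu]_(u in `[a, t]) f u) (f t).
Proof.
move=> at1 cf.
have fi : mu.-integrable `[a, t + 1] (EFin \o f).
  apply: cont_integrable; apply: cont_within => u; rewrite /= in_itv/= => /andP[au _].
  exact: cf.
have tt : t < t + 1 by rewrite ltrDl.
have [d e] := continuous_FTC1_closed tt fi at1 (cf _ (ltW at1)).
by apply: DeriveDef; [exact: d|rewrite -derive1E].
Qed.

End integrals.

(** * Modified Bessel functions of orders zero and one *)

Section bessel.
Context {R : realType}.
Notation mu := (@lebesgue_measure R).
Implicit Types (u x z : R) (j : nat).

Definition sinh u : R := (expR u - expR (- u)) / 2.

Lemma deriv_cosh u : is_derive u 1 (@cosh R) (sinh u).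
Proof.
have h : is_derive u 1 (fun y : R => expR (- y)) (expR (- u) * -1).
  exact: deriv_exp (derivN (deriv_id u)).
have := derivZ 2^-1 (derivD (deriv_exp (deriv_id u)) h).
rewrite mulr1 mulrN1 [_^-1 * _]mulrC -/(sinh u) => hh.
suff -> : @cosh R = (fun y => 2^-1 * (expR y + expR (- y))) by [].
by apply/funext => y; rewrite /cosh mulrC.
Qed.

Lemma deriv_sinh u : is_derive u 1 sinh (cosh u).
Proof.
have h : is_derive u 1 (fun y : R => expR (- y)) (expR (- u) * -1).
  exact: deriv_exp (derivN (deriv_id u)).
have := derivZ 2^-1 (derivB (deriv_exp (deriv_id u)) h).
rewrite mulr1 mulrN1 opprK [_^-1 * _]mulrC -/(cosh u) => hh.
suff -> : sinh = (fun y => 2^-1 * (expR y - expR (- y))) by [].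
by apply/funext => y; rewrite /sinh mulrC.
Qed.

Lemma cosh_ge u : (1 + u) / 2 <= cosh u.
Proof.
rewrite /cosh ler_pM2r ?invr_gt0// -[leLHS]addr0.
by rewrite lerD ?expR_ge1Dx ?expR_ge0.
Qed.

Lemma cosh_ge1 u : 1 <= cosh u.
Proof.
have := expR_ge1Dx u; have := expR_ge1Dx (- u); rewrite /cosh => h1 h2; lra.
Qed.

Lemma cosh_gt0 u : 0 < cosh u.
Proof. exact: lt_le_trans (cosh_ge1 u). Qed.

Lemma sinh_ge0 u : 0 <= u -> 0 <= sinh u.
Proof.
move=> u0; rewrite /sinh divr_ge0// subr_ge0 ler_expR; lra.
Qed.

Lemma sinh_cosh u : sinh u ^+ 2 = cosh u ^+ 2 - 1.
Proof.
have e : expR u * expR (- u) = 1 by rewrite -expRD subrr expR0.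
rewrite /sinh /cosh; nra.
Qed.

Lemma continuous_cosh : continuous (@cosh R).
Proof. by move=> u; exact: deriv_cont (deriv_cosh u). Qed.

(** By comparison with the exponential density. *)
Lemma expdecay_integrable (f : R -> R) (D r : R) : 0 < r ->
  continuous f -> (forall u, 0 <= u -> `|f u| <= D * expR (- r * u)) ->
  mu.-integrable `[0, +oo[ (EFin \o f).
Proof.
move=> r0 cf fD.
have D0 : 0 <= D.
  by have := fD 0 (lexx _); rewrite mulr0 expR0 mulr1; exact: le_trans.
have i1 : mu.-integrable `[0, +oo[ (EFin \o exponential_pdf r).
  by apply: integrableS (integrable_exponential_pdf r0).
have i2 : mu.-integrable `[0, +oo[
    (fun u => (D / r)%:E * (exponential_pdf r u)%:E)%E by exact: integrableZl.
apply: le_integrable i2 => //.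
  by apply/measurable_EFinP/measurable_funTS; exact: continuous_measurable_fun.
move=> u; rewrite /= in_itv/= andbT => u0.
rewrite lee_fin exponential_pdfE//.
rewrite (le_trans (fD _ u0))// ler_normr; apply/orP; left.
by rewrite mulrA divfK ?gt_eqF.
Qed.

(** Differentiating [expR (- x * cosh u)] in [x] brings down powers of [cosh u],
    so the integrals [bM j] of [coshM j] contain K_0 ([j = 0]), K_1 ([j = 1])
    and, up to sign, all their derivatives. *)
Definition coshM j x u : R := expR (- x * cosh u) * cosh u ^+ j.

Lemma continuous_coshM j x : continuous (coshM j x).
Proof.
move=> u; apply: cvgM.
  apply: (@continuous_comp _ _ _ (fun u => - x * cosh u) expR).
    by apply: cvgM; [exact: cvg_cst|exact: continuous_cosh].
  exact: continuous_expR.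
apply: (@continuous_comp _ _ _ (@cosh R) (fun y => y ^+ j)).
  exact: continuous_cosh.
exact: exprn_continuous.
Qed.

Lemma coshM_ge0 j x u : 0 <= coshM j x u.
Proof. by rewrite mulr_ge0 ?expR_ge0 ?exprn_ge0// ltW// cosh_gt0. Qed.

Lemma expR_ge_sqr (y : R) : 0 <= y -> y ^+ 2 / 4 <= expR y.
Proof.
move=> y0; have -> : expR y = expR (y / 2) ^+ 2.
  by rewrite expr2 -expRD -splitr.
have := expR_ge1Dx (y / 2) => h; nra.
Qed.

(** Half of the exponential absorbs the powers of [cosh u] by [expR_ge_sqr], the
    other half decays exponentially in [u] by [cosh_ge]. *)
Lemma coshM_le j x u : 0 < x -> (j <= 2)%N -> 0 <= u ->
  coshM j x u <= 16 / x ^+ 2 * expR (- (x / 4) * u).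
Proof.
move=> x0 j2 u0; rewrite /coshM.
have c1 := cosh_ge1 u.
have h1 : cosh u ^+ j <= cosh u ^+ 2 by rewrite ler_weXn2l.
have h2 : cosh u ^+ 2 <= 16 / x ^+ 2 * expR (x * cosh u / 2).
  have y0 : 0 <= x * cosh u / 2 by rewrite divr_ge0 ?mulr_ge0 ?(ltW x0) ?(le_trans _ c1).
  have h := expR_ge_sqr y0.
  have x2 : 0 < x ^+ 2 by rewrite exprn_gt0.
  rewrite mulrAC ler_pdivlMr//; move: h.
  have -> : (x * cosh u / 2) ^+ 2 / 4 = (cosh u ^+ 2 * x ^+ 2) / 16 by field.
  by rewrite ler_pdivrMr// [16 * _]mulrC.
apply: (@le_trans _ _ (expR (- x * cosh u) *
    (16 / x ^+ 2 * expR (x * cosh u / 2)))).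
  by rewrite ler_wpM2l ?expR_ge0// (le_trans h1).
rewrite mulrCA ler_wpM2l ?divr_ge0 ?sqr_ge0//.
rewrite -expRD ler_expR.
have := cosh_ge u; nra.
Qed.

Lemma integrable_coshM j x : 0 < x -> (j <= 2)%N ->
  mu.-integrable `[0, +oo[ (EFin \o coshM j x).
Proof.
move=> x0 j2; apply: (@expdecay_integrable _ (16 / x ^+ 2) (x / 4)).
- by rewrite divr_gt0.
- exact: continuous_coshM.
- by move=> u u0; rewrite ger0_norm ?coshM_ge0//; exact: coshM_le.
Qed.

Definition bM j x : R := \int[mu]_(u in `[0, +oo[) coshM j x u.

Lemma bM_ge0 j x : 0 <= bM j x.
Proof. by apply: Rintegral_ge0 => u _; exact: coshM_ge0. Qed.

Lemma besselK0E x : besselK 0 x = bM 0 x.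
Proof.
apply: eq_Rintegral => u _; rewrite mul0r /coshM expr0.
by rewrite /(cosh 0) oppr0 expR0 -[1 + 1](natrD R 1 1) divff.
Qed.

Lemma besselK1E x : besselK 1 x = bM 1 x.
Proof. by apply: eq_Rintegral => u _; rewrite mul1r /coshM expr1. Qed.

End bessel.

Section bessel_diff.
Context {R : realType}.
Notation mu := (@lebesgue_measure R).
Implicit Types (u x z : R) (j : nat).

Lemma deriv_coshM j u x : is_derive x 1 (fun x => coshM j x u) (- coshM j.+1 x u).
Proof.
have h : is_derive x 1 (fun y : R => - y * cosh u) (- cosh u).
  have := derivM (derivN (deriv_id x)) (deriv_cst (cosh u) x).
  by rewrite mulr0 addr0 mulN1r.
have := derivM (deriv_exp h) (deriv_cst (cosh u ^+ j) x).
rewrite mulr0 addr0 => hh.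
have -> : - coshM j.+1 x u = expR (- x * cosh u) * - cosh u * cosh u ^+ j.
  by rewrite /coshM exprS; ring.
exact: hh.
Qed.

Lemma coshM_mono j x y u : x <= y -> coshM j y u <= coshM j x u.
Proof.
move=> xy; rewrite ler_wpM2r ?exprn_ge0 ?(ltW (cosh_gt0 u))// ler_expR.
by rewrite !mulNr lerN2 ler_wpM2r// ltW// cosh_gt0.
Qed.

(** Differentiation under the integral sign, dominated near [x] by the integrand
    at [x / 2]. *)
Lemma deriv_bM j x : 0 < x -> (j <= 1)%N -> is_derive x 1 (bM j) (- bM j.+1 x).
Proof.
move=> x0 j1.
have x20 : 0 < x / 2 by rewrite divr_gt0.
have xI : `]x / 2, x * 2[%classic x by rewrite /= in_itv/=; apply/andP; split; lra.
have mI : measurable (`[0, +oo[%classic : set (measurableTypeR R)) by [].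
have fi (y : R) : `]x / 2, x * 2[%classic y -> mu.-integrable `[0, +oo[ (EFin \o coshM j y).
  rewrite /= in_itv/= => /andP[xy _]; apply: integrable_coshM; last exact: leq_trans j1 _.
  exact: lt_trans xy.
have df (y : R) (u : R) : `]x / 2, x * 2[%classic y -> `[0, +oo[%classic u ->
    derivable (coshM j ^~ u) y 1.
  by move=> _ _; exact: deriv_derivable (deriv_coshM j u y).
have G0 u : 0 <= coshM j.+1 (x / 2) u by exact: coshM_ge0.
have Gi : mu.-integrable `[0, +oo[ (EFin \o coshM j.+1 (x / 2)).
  exact: integrable_coshM.
have pE (y u : R) : partial1of2 (coshM j) y u = - coshM j.+1 y u.
  exact: deriv_derive1 (deriv_coshM j u y).
have Gub (y u : R) : `]x / 2, x * 2[%classic y -> `[0, +oo[%classic u ->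
    `|partial1of2 (coshM j) y u| <= coshM j.+1 (x / 2) u.
  rewrite /= in_itv/= => /andP[/ltW xy _] _; rewrite pE normrN ger0_norm ?coshM_ge0//.
  exact: coshM_mono.
have d := derivable_under_integral mI xI fi df G0 Gi Gub.
have e := differentiation_under_integral mI xI fi df G0 Gi Gub.
apply: DeriveDef; first exact: d.
rewrite -derive1E e -mulN1r /bM -RintegralZl//; last exact: integrable_coshM.
by apply: eq_Rintegral => u _; rewrite mulN1r pE.
Qed.

(** Integration by parts of [sinh u * (sinh u * expR (- x * cosh u))]. As K_1' is
    [- bM 2], this is the classical identity (x K_1)' = - x K_0. *)
Lemma bM_parts x : 0 < x -> x * (bM 2 x - bM 0 x) = bM 1 x.
Proof.
move=> x0.
have i j : (j <= 2)%N -> mu.-integrable `[0, +oo[ (EFin \o coshM j x).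
  by move=> j2; exact: integrable_coshM.
pose F u := sinh u * coshM 0 x u.
pose f u := coshM 1 x u - x * (coshM 2 x u - coshM 0 x u).
have dF u : is_derive u 1 F (f u).
  have h : is_derive u 1 (fun u => coshM 0 x u) (expR (- x * cosh u) * (- x * sinh u)).
    have -> : (fun u => coshM 0 x u) = (fun u => expR (- x * cosh u)).
      by apply/funext => v; rewrite /coshM expr0 mulr1.
    exact: deriv_exp (derivZ _ (deriv_cosh u)).
  have := derivM (deriv_sinh u) h.
  suff -> : cosh u * coshM 0 x u + sinh u * (expR (- x * cosh u) * (- x * sinh u))
     = f u by [].
  rewrite /f /coshM !expr1 !expr0 !mulr1.
  have -> : sinh u * (expR (- x * cosh u) * (- x * sinh u)) =
    - x * expR (- x * cosh u) * sinh u ^+ 2 by ring.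
  by rewrite sinh_cosh; ring.
have cf u : {for u, continuous f}.
  apply: cvgB; first exact: continuous_coshM.
  apply: cvgM; first exact: cvg_cst.
  by apply: cvgB; exact: continuous_coshM.
have fi2 : mu.-integrable `[0, +oo[ (EFin \o (fun u => x * (coshM 2 x u - coshM 0 x u))).
  by apply: integrable_scaler => //; apply: integrable_subr => //; exact: i.
have fi : mu.-integrable `[0, +oo[ (EFin \o f).
  by apply: integrable_subr => //; exact: i.
have Fl : F u @[u --> +oo] --> (0 : R).
  have h0 := @cvg_expdecay R (16 / x ^+ 2) (x / 4).
  apply: squeeze_near0 (h0 _); last by rewrite divr_gt0.
  near=> u; have u0 : 0 <= u by [].
  rewrite (ger0_norm (mulr_ge0 (sinh_ge0 u0) (coshM_ge0 0 x u))).
  apply: le_trans (@coshM_le _ 1 x u x0 isT u0).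
  rewrite /F /coshM expr0 expr1 mulr1 mulrC ler_wpM2l ?expR_ge0//.
  by rewrite /sinh /cosh ler_pM2r ?invr_gt0// lerD2l ge0_cp ?expR_ge0.
have := FTC2y (fun u _ => dF u) (fun u _ => cf u) fi Fl.
rewrite /F {1}/sinh oppr0 subrr !mul0r subrr.
rewrite /f RintegralB//; last exact: i.
rewrite RintegralZl//; last by apply: integrable_subr => //; exact: i.
rewrite RintegralB//; [|exact: i..].
by move/eqP; rewrite subr_eq0 => /eqP.
Unshelve. all: by end_near. Qed.

End bessel_diff.

Section bessel_bounds.
Context {R : realType}.
Notation mu := (@lebesgue_measure R).
Implicit Types (u x z : R) (j : nat).

Lemma le_bM i j x y : 0 < x -> (i <= 2)%N -> (j <= 2)%N -> 0 < y ->
  (forall u, 0 <= u -> coshM i x u <= coshM j y u) -> bM i x <= bM j y.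
Proof.
move=> x0 i2 j2 y0 h; apply: le_Rintegral; first by [].
- exact: integrable_coshM.
- exact: integrable_coshM.
by move=> u; rewrite /= in_itv/= andbT; exact: h.
Qed.

Lemma le_bM01 x : 0 < x -> bM 0 x <= bM 1 x.
Proof.
move=> x0; apply: le_bM => // u u0.
by rewrite /coshM ler_wpM2l ?expR_ge0// expr0 expr1 cosh_ge1.
Qed.

(** [bM_parts] evaluates the integral of [(cosh u ^ 2 - 1) expR (- x cosh u)], and
    [cosh u - 1 <= (cosh u ^ 2 - 1) / 2]. With [le_bM01] this gives that K_1 / K_0
    tends to 1. *)
Lemma bM1_sub_bM0 x : 0 < x -> bM 1 x - bM 0 x <= bM 1 x / (2 * x).
Proof.
move=> x0; rewrite -[X in _ <= X / _]bM_parts//.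
have -> : x * (bM 2 x - bM 0 x) / (2 * x) = 2^-1 * (bM 2 x - bM 0 x).
  by field; rewrite gt_eqF.
have i j : (j <= 2)%N -> mu.-integrable `[0, +oo[ (EFin \o coshM j x).
  by move=> j2; exact: integrable_coshM.
rewrite -!RintegralB//; [|exact: i..].
rewrite -RintegralZl//; last by apply: integrable_subr => //; exact: i.
apply: le_Rintegral; first by [].
- by apply: integrable_subr => //; exact: i.
- by apply: integrable_scaler => //; apply: integrable_subr => //; exact: i.
- move=> u _; rewrite /coshM expr0 expr1 mulr1.
  have := cosh_ge1 u; have := expR_ge0 (- x * cosh u).
  move: (expR (- x * cosh u)) => e e0; move: (cosh u) => c c1.
  have -> : e * c - e = e * (c - 1) by ring.
  have -> : 2^-1 * (e * c ^+ 2 - e) = e * ((c ^+ 2 - 1) / 2) by ring.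
  by rewrite ler_wpM2l//; nra.
Qed.

(** Pointwise, since [cosh u >= 1]. *)
Lemma bM_decay j x z : 0 < x -> (j <= 2)%N -> x <= z ->
  bM j z <= expR (- (z - x)) * bM j x.
Proof.
move=> x0 j2 xz; have z0 : 0 < z by exact: lt_le_trans xz.
have i := integrable_coshM x0 j2.
rewrite /bM -RintegralZl//; apply: le_Rintegral; first by [].
- exact: integrable_coshM.
- exact: integrable_scaler.
move=> u _; rewrite /coshM mulrA ler_wpM2r ?exprn_ge0 ?(ltW (cosh_gt0 u))//.
rewrite -expRD ler_expR; have := cosh_ge1 u; nra.
Qed.

Lemma sqr_cosh_half u : cosh u = 1 + 2 * sinh (u / 2) ^+ 2.
Proof.
rewrite sinh_cosh /cosh.
have e : expR (u / 2) * expR (- (u / 2)) = 1 by rewrite -expRD subrr expR0.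
have -> : expR u = expR (u / 2) ^+ 2 by rewrite expr2 -expRD -splitr.
have -> : expR (- u) = expR (- (u / 2)) ^+ 2.
  by rewrite expr2 -expRD -opprD -splitr.
nra.
Qed.

(** The Bessel function of order one half is elementary:
    [cosh u = 1 + 2 sinh (u / 2) ^ 2] turns the integral into a Gaussian one. *)
Lemma bessel_half x : 0 < x ->
  mu.-integrable `[0, +oo[ (EFin \o (fun u => expR (- x * cosh u) * cosh (u / 2))) /\
  \int[mu]_(u in `[0, +oo[) (expR (- x * cosh u) * cosh (u / 2)) =
    Num.sqrt pi / Num.sqrt (2 * x) * expR (- x).
Proof.
move=> x0; set f := fun u : R => _.
have [s [<- s0 s2]] : exists s : R, [/\ s = Num.sqrt (2 * x), 0 < s & s ^+ 2 = 2 * x].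
  exists (Num.sqrt (2 * x)); split=> //; first by rewrite sqrtr_gt0 mulr_gt0.
  by rewrite sqr_sqrtr// ltW// mulr_gt0.
have cf u : {for u, continuous f}.
  apply: cvgM.
    apply: (@continuous_comp _ _ _ (fun u => - x * cosh u) expR).
      by apply: cvgM; [exact: cvg_cst|exact: continuous_cosh].
    exact: continuous_expR.
  apply: (@continuous_comp _ _ _ (fun u : R => u / 2) (@cosh R)).
    by apply: cvgM; [exact: cvg_id|exact: cvg_cst].
  exact: continuous_cosh.
have fle u : f u <= coshM 1 x u.
  rewrite /f /coshM expr1 ler_wpM2l ?expR_ge0// (sqr_cosh_half u) sinh_cosh.
  have := cosh_ge1 (u / 2); nra.
have fi : mu.-integrable `[0, +oo[ (EFin \o f).
  apply: le_integrable (@integrable_coshM _ 1 x x0 isT) => //.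
    by apply/measurable_EFinP/measurable_funTS; exact: continuous_measurable_fun.
  move=> u _; rewrite lee_fin !ger0_norm ?coshM_ge0//.
  by rewrite mulr_ge0 ?expR_ge0// ltW// cosh_gt0.
split=> //.
pose Phi (y : R) := \int[mu]_(v in `[-1, y]) gauss_fun v.
have Phi_split y : 0 <= y -> Phi y - Phi 0 = \int[mu]_(v in `[0, y]) gauss_fun v.
  move=> y0; rewrite /Phi (@Rintegral_itv_split _ _ (-1) 0 y)//; last first.
    by apply: cont_integrable; apply: cont_within => ? _; exact: continuous_gauss_fun.
  by rewrite addrAC subrr add0r.
have gi : mu.-integrable `[0, +oo[ (EFin \o gauss_fun).
  by apply: integrableS integrableT_gauss.
have Phil : Phi y @[y --> +oo] --> Num.sqrt pi / 2 + Phi 0.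
  have := cvg_Rintegral_itv0y gi.
  rewrite {2}/Rintegral integral0y_gauss/= => h.
  have h2 : (\int[mu]_(u in `[0, t]) gauss_fun u + Phi 0) @[t --> +oo] --> Num.sqrt pi / 2 + Phi 0.
    by apply: cvgD h _; exact: cvg_cst.
  apply: cvg_trans h2; apply: near_eq_cvg; near=> y.
  by rewrite -Phi_split// subrK.
pose F u := expR (- x) * (2 / s) * Phi (s * sinh (u / 2)).
have dh u : is_derive u 1 (fun u : R => s * sinh (u / 2)) (s * (cosh (u / 2) / 2)).
  have h : is_derive u 1 (fun u : R => u / 2) 2^-1.
    by have := derivM (deriv_id u) (deriv_cst 2^-1 u); rewrite mul1r mulr0 addr0.
  exact: (derivZ s (deriv_comp h (deriv_sinh (u / 2)))).
have dF u : 0 <= u -> is_derive u 1 F (f u).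
  move=> u0; have y1 : -1 < s * sinh (u / 2).
    by rewrite (lt_le_trans (ltrN10 R))// mulr_ge0 ?sinh_ge0 ?divr_ge0// ltW.
  have dPhi := deriv_Rintegral y1 (fun v _ => @continuous_gauss_fun R v).
  have := derivZ (expR (- x) * (2 / s)) (deriv_comp (dh u) dPhi).
  suff -> : expR (- x) * (2 / s) * (gauss_fun (s * sinh (u / 2)) * (s * (cosh (u / 2) / 2)))
    = f u by [].
  rewrite /f (sqr_cosh_half u) /gauss_fun exprMn s2.
  have -> : - x * (1 + 2 * sinh (u / 2) ^+ 2) = - x + - (2 * x * sinh (u / 2) ^+ 2) by ring.
  by rewrite expRD; field; rewrite gt_eqF.
have Fl : F u @[u --> +oo] --> expR (- x) * (2 / s) * (Num.sqrt pi / 2 + Phi 0).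
  apply: cvgM; first exact: cvg_cst.
  apply: (@cvg_comp _ _ _ (fun u => s * sinh (u / 2)) Phi); last exact: Phil.
  apply: (@ger_cvgy _ _ _ _ (fun u => s * (u / 4)) _).
  - near=> v; have v0 : 0 <= v by [].
    rewrite (ler_wpM2l (ltW s0))//.
    have := expR_ge1Dx (v / 2); have : expR (- (v / 2)) <= 1.
      by rewrite -expR0 ler_expR oppr_le0 divr_ge0.
    by rewrite /sinh; lra.
  - have -> : (fun u => s * (u / 4)) = (fun u => u * (s / 4)).
      by apply/funext => v; ring.
    by apply: gt0_cvgMly; [rewrite divr_gt0|exact: cvg_id].
have := FTC2y dF (fun u _ => cf u) fi Fl.
rewrite /F mul0r {1}/sinh oppr0 subrr mul0r mulr0 => ->.
by rewrite -mulrBr addrK; field; rewrite gt_eqF.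
Unshelve. all: by end_near. Qed.

Lemma bM0_le_half x : 0 < x ->
  bM 0 x <= Num.sqrt pi / Num.sqrt (2 * x) * expR (- x).
Proof.
move=> x0; have [hi <-] := bessel_half x0.
apply: le_Rintegral; [by []|exact: integrable_coshM|exact: hi|].
by move=> u _; rewrite /coshM expr0 ler_wpM2l ?expR_ge0 ?cosh_ge1.
Qed.

Lemma half_le_bM1 x : 0 < x ->
  Num.sqrt pi / Num.sqrt (2 * x) * expR (- x) <= bM 1 x.
Proof.
move=> x0; have [hi <-] := bessel_half x0.
apply: le_Rintegral; [by []|exact: hi|exact: integrable_coshM|].
move=> u _; rewrite /coshM expr1 ler_wpM2l ?expR_ge0//.
rewrite (sqr_cosh_half u) sinh_cosh; have := cosh_ge1 (u / 2); nra.
Qed.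

Lemma bM1_gt0 x : 0 < x -> 0 < bM 1 x.
Proof.
move=> x0; apply: lt_le_trans (half_le_bM1 x0).
by rewrite mulr_gt0 ?expR_gt0// divr_gt0 ?sqrtr_gt0 ?pi_gt0// mulr_gt0.
Qed.

(** [bM1_sub_bM0] bounds K_0 below by a positive multiple of K_1 at [x + 1], and
    K_0 is nonincreasing. *)
Lemma bM0_gt0 x : 0 < x -> 0 < bM 0 x.
Proof.
move=> x0; have y0 : 0 < x + 1 by rewrite addr_gt0.
have b1 := bM1_gt0 y0.
have h1 : 0 < bM 0 (x + 1).
  have := bM1_sub_bM0 y0.
  have : bM 1 (x + 1) / (2 * (x + 1)) < bM 1 (x + 1).
    by rewrite gtr_pMr// invf_lt1; lra.
  lra.
have := @bM_decay 0 x (x + 1) x0 isT; rewrite lerDl ler01 => /(_ isT) h2.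
have := lt_le_trans h1 h2; rewrite pmulr_rgt0 ?expR_gt0//.
Qed.

End bessel_bounds.

(** * The recessive solution of the homogeneous equation *)

Lemma ge1_sqrt_le (R : realType) (x : R) : 1 <= x -> Num.sqrt x <= x.
Proof.
move=> x1; have x0 : 0 <= x by rewrite (le_trans _ x1).
rewrite -{2}[x]ger0_norm// -sqrtr_sqr ler_wsqrtr//.
by rewrite expr2 ler_peMr.
Qed.

(** With [I] the integral of the solution, the equation without noise is
    [I'' = b / (1 + t) * I]. Its solution that decays at infinity is [kap], and
    [eta] is [- kap']. *)
HB.lock Definition kap {R : realType} (b t : R) : R :=
  Num.sqrt (t + 1) * besselK 1 (2 * Num.sqrt (b * (t + 1))).

HB.lock Definition eta {R : realType} (b t : R) : R :=
  Num.sqrt b * besselK 0 (2 * Num.sqrt (b * (t + 1))).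

(** The squared ratio of K_1 and K_0 at [2 sqrt (b (1 + t))], see [rhoE], in the
    form in which it appears when [1 / (kap * eta)] is differentiated. *)
HB.lock Definition rho {R : realType} (b t : R) : R :=
  b * kap b t ^+ 2 / ((1 + t) * eta b t ^+ 2).

Section kernel.
Context {R : realType}.
Notation mu := (@lebesgue_measure R).
Variable b : R.
Hypothesis b0 : 0 < b.
Implicit Types (t u x : R).

Notation kap := (kap b).
Notation eta := (eta b).
Notation rho := (rho b).

Let z t : R := 2 * Num.sqrt (b * (t + 1)).
Let sb : R := Num.sqrt b.

Let sb0 : 0 < sb. Proof. by rewrite sqrtr_gt0. Qed.
Let sb2 : sb ^+ 2 = b. Proof. by rewrite sqr_sqrtr// ltW. Qed.

Let z_gt0 t : -1 < t -> 0 < z t.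
Proof. by move=> t1; rewrite mulr_gt0// sqrtr_gt0 mulr_gt0//; lra. Qed.

Let zE t : z t = 2 * sb * Num.sqrt (t + 1).
Proof. by rewrite /z sqrtrM ?(ltW b0)// mulrA. Qed.

Let z_sqr t : -1 < t -> z t ^+ 2 = 4 * b * (t + 1).
Proof.
move=> t1; rewrite /z exprMn sqr_sqrtr; last by rewrite mulr_ge0 ?(ltW b0)//; lra.
by ring.
Qed.

Let deriv_z t : -1 < t -> is_derive t 1 z (2 * b / z t).
Proof.
move=> t1; have bt : 0 < b * (t + 1) by rewrite mulr_gt0//; lra.
have h : is_derive t 1 (fun t : R => b * (t + 1)) b.
  by have := derivZ b (derivD (deriv_id t) (deriv_cst 1 t)); rewrite addr0 mulr1.
have := derivZ 2 (deriv_comp h (is_derive1_sqrt bt)).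
suff -> : 2 * ((2 * Num.sqrt (b * (t + 1)))^-1 * b) = 2 * b / z t by [].
by rewrite /z; field; rewrite gt_eqF// sqrtr_gt0.
Qed.

Lemma kapE t : kap t = z t * bM 1 (z t) / (2 * sb).
Proof.
rewrite kap.unlock besselK1E -/(z t) {2}zE; field.
by rewrite gt_eqF.
Qed.

Lemma etaE t : eta t = sb * bM 0 (z t).
Proof. by rewrite eta.unlock besselK0E. Qed.

Lemma kap_gt0 t : -1 < t -> 0 < kap t.
Proof.
move=> /z_gt0 z0; rewrite kapE; apply: divr_gt0; last exact: mulr_gt0.
by apply: mulr_gt0 => //; exact: bM1_gt0.
Qed.

Lemma eta_gt0 t : -1 < t -> 0 < eta t.
Proof. by move=> /z_gt0 z0; rewrite etaE; apply: mulr_gt0 => //; exact: bM0_gt0. Qed.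

(** [kap] is a multiple of x K_1(x) at [x = 2 sqrt (b (t + 1))], whose derivative
    in [x] is - x K_0(x) by [bM_parts]. *)
Lemma deriv_kap t : -1 < t -> is_derive t 1 kap (- eta t).
Proof.
move=> t1; have z0 := z_gt0 t1; have dz := deriv_z t1.
have dK := deriv_comp dz (@deriv_bM R 1 (z t) z0 isT).
have -> : kap = (fun y => z y * bM 1 (z y) / (2 * sb)) by apply/funext => y; rewrite kapE.
apply: (deriv_eq (derivM (derivM dz dK) (deriv_cst (2 * sb)^-1 t))).
rewrite etaE -(bM_parts z0) -sb2; field.
by rewrite !gt_eqF.
Qed.

Lemma deriv_eta t : -1 < t -> is_derive t 1 eta (- (b / (1 + t) * kap t)).
Proof.
move=> t1; have z0 := z_gt0 t1; have dz := deriv_z t1.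
have dK := deriv_comp dz (@deriv_bM R 0 (z t) z0 isT).
have := derivZ sb dK.
suff -> : sb * (- bM 1 (z t) * (2 * b / z t)) = - (b / (1 + t) * kap t).
  have -> : eta = (fun y => sb * bM 0 (z y)) by apply/funext => y; rewrite etaE.
  by [].
rewrite kapE.
have -> : 1 + t = z t ^+ 2 / (4 * b) by rewrite z_sqr//; field; rewrite gt_eqF.
move: (bM 1 (z t)) (z t) z0 => K w w0; rewrite -sb2; field.
by rewrite !gt_eqF.
Qed.

Lemma rhoE t : -1 < t -> rho t = (bM 1 (z t) / bM 0 (z t)) ^+ 2.
Proof.
move=> t1; have z0 := z_gt0 t1; have k0 := bM0_gt0 z0.
rewrite rho.unlock kapE etaE.
have -> : 1 + t = z t ^+ 2 / (4 * b) by rewrite z_sqr//; field; rewrite gt_eqF.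
move: (bM 1 (z t)) => K; move: (bM 0 (z t)) k0 => L L0; move: (z t) z0 => w w0.
rewrite -sb2; field.
by rewrite !gt_eqF.
Qed.

Lemma rho_ge1 t : -1 < t -> 1 <= rho t.
Proof.
move=> t1; have z0 := z_gt0 t1; have k0 := bM0_gt0 z0.
have r1 : 1 <= bM 1 (z t) / bM 0 (z t) by rewrite ler_pdivlMr// mul1r le_bM01.
by rewrite rhoE//; exact: exprn_ege1.
Qed.

Lemma cvg_z : z t @[t --> +oo] --> +oo.
Proof.
apply: (@ger_cvgy _ _ _ _ (fun t => Num.sqrt t * (2 * sb))).
  near=> t; have t0 : 0 <= t by [].
  by rewrite zE mulrC ler_wpM2l ?mulr_ge0 ?(ltW sb0)// ler_wsqrtr// lerDl.
apply: gt0_cvgMly; first by rewrite mulr_gt0.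
apply/cvgryPge => A; near=> t.
have A2 : A ^+ 2 <= t by [].
by rewrite (le_trans (ler_norm A))// -sqrtr_sqr ler_wsqrtr.
Unshelve. all: by end_near. Qed.

Lemma cvg_bM_ratio : bM 1 x / bM 0 x @[x --> +oo] --> (1 : R).
Proof.
have h : 1 + (2 * x - 1)^-1 @[x --> +oo] --> (1 : R).
  rewrite -[X in _ --> X]addr0; apply: cvgD; first exact: cvg_cst.
  apply/gtr0_cvgV0.
    by near=> x; have : 1 < x by []; lra.
  apply: (@ger_cvgy _ _ _ _ id); last exact: cvg_id.
  by near=> x; have : 1 < x by []; lra.
apply: squeeze_cvgr (cvg_cst (1 : R)) h; near=> x.
have x1 : 1 < x by [].
have x0 : 0 < x by rewrite (lt_trans ltr01).
have k0 := bM0_gt0 x0; have k1 := bM1_gt0 x0.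
rewrite ler_pdivlMr// mul1r le_bM01//= ler_pdivrMr//.
have := bM1_sub_bM0 x0.
have -> : 1 + (2 * x - 1)^-1 = 2 * x / (2 * x - 1) by field; apply/eqP; lra.
rewrite mulrAC ler_pdivlMr; last by lra.
by rewrite ler_pdivlMr; [nra|lra].
Unshelve. all: by end_near. Qed.

Lemma cvg_rho : rho t @[t --> +oo] --> (1 : R).
Proof.
have h : (bM 1 (z t) / bM 0 (z t)) ^+ 2 @[t --> +oo] --> (1 : R).
  rewrite -[X in _ --> X](expr1n R 2).
  apply: (@cvg_comp _ _ _ (fun t => bM 1 (z t) / bM 0 (z t)) (fun y => y ^+ 2)).
    exact: (cvg_comp _ _ cvg_z cvg_bM_ratio).
  exact: exprn_continuous.
apply: cvg_trans h; apply: near_eq_cvg; near=> t.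
by rewrite rhoE// (@lt_le_trans _ _ 0)// ltrN10.
Unshelve. all: by end_near. Qed.

Lemma expRN_le (n : nat) x : 0 < x -> expR (- x) <= n.+1`!%:R / x ^+ n.+1.
Proof.
move=> x0; rewrite expRN -[leRHS]invf_div lef_pV2 ?posrE ?expR_gt0//.
  by apply: le_trans (expR_ge1Dxn n (ltW x0)); rewrite lerDr.
by rewrite divr_gt0// ?exprn_gt0// ltr0n fact_gt0.
Qed.

(** K_0 and K_1 decay exponentially in the square root of [t]. The fourth power
    leaves an integrable bound even after multiplication by a path growing
    like [t ^ 2]. *)
Lemma kernel_decay : exists2 D, 0 < D &
  forall t, 0 <= t -> kap t <= D / (1 + t) ^+ 4 /\ eta t <= D / (1 + t) ^+ 4.
Proof.
have z00 : 0 < z 0 by apply: z_gt0; rewrite ltrN10.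
have k1 := bM1_gt0 z00; have k0 := bM0_gt0 z00.
(* [z t ^ 10] is a multiple of [(1 + t) ^ 5], and the factor [sqrt (t + 1)] of
   [kap] costs at most one power. *)
have [N [N0 hN]] : exists N : R, 0 < N /\ forall x : R, 0 < x -> expR (- x) <= N / x ^+ 10.
  exists (10`!%:R); split; first by rewrite ltr0n fact_gt0.
  exact: (@expRN_le 9).
have zz t : 0 <= t -> z 0 <= z t.
  by move=> t0; rewrite /z ler_wpM2l// ler_wsqrtr// ler_wpM2l ?(ltW b0)// lerD2r.
have [M [M0 E]] : exists M : R, 0 < M /\
    forall t, 0 <= t -> expR (- (z t - z 0)) <= M / (1 + t) ^+ 5.
  exists (expR (z 0) * (N / (4 * b) ^+ 5)); split.
    by rewrite mulr_gt0 ?expR_gt0// divr_gt0// exprn_gt0// mulr_gt0.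
  move=> t t0; have t1 : -1 < t by rewrite (lt_le_trans _ t0)// ltrN10.
  rewrite opprB expRD -!mulrA ler_wpM2l ?expR_ge0// (le_trans (hN _ (z_gt0 t1)))//.
  rewrite -[10%N]/(2 * 5)%N exprM z_sqr// [t + 1]addrC [X in N / X]exprMn invfM.
  exact: lexx.
have M1 : 0 < M * bM 1 (z 0) by apply: mulr_gt0.
have M2 : 0 < sb * M * bM 0 (z 0) by apply: mulr_gt0 => //; apply: mulr_gt0.
exists (M * bM 1 (z 0) + sb * M * bM 0 (z 0)).
  exact: addr_gt0.
move=> t t0; have p0 : 0 < 1 + t by lra.
have d j : (j <= 2)%N -> bM j (z t) <= M / (1 + t) ^+ 5 * bM j (z 0).
  move=> j2; apply: le_trans (bM_decay z00 j2 (zz _ t0)) _.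
  by rewrite ler_wpM2r ?bM_ge0// E.
have -> : (1 + t) ^- 4 = (1 + t) * (1 + t) ^- 5 :> R by field; rewrite gt_eqF.
have i5 : 0 < (1 + t) ^- 5 by rewrite invr_gt0 exprn_gt0.
have h1 := d 1%N isT; have h0 := d 0%N isT; split.
  rewrite kap.unlock besselK1E -/(z t) [t + 1]addrC.
  have s1 : Num.sqrt (1 + t) <= 1 + t.
    by apply: ge1_sqrt_le; rewrite lerDl.
  apply: (@le_trans _ _ ((1 + t) * (M / (1 + t) ^+ 5 * bM 1 (z 0)))).
    by rewrite ler_pM ?sqrtr_ge0 ?bM_ge0.
  rewrite [leRHS]mulrCA ler_wpM2l ?(ltW p0)//.
  by rewrite mulrAC ler_wpM2r ?(ltW i5)// lerDl ltW.
rewrite etaE; apply: (@le_trans _ _ (sb * (M / (1 + t) ^+ 5 * bM 0 (z 0)))).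
  by rewrite ler_wpM2l ?(ltW sb0).
have -> : sb * (M / (1 + t) ^+ 5 * bM 0 (z 0)) = sb * M * bM 0 (z 0) / (1 + t) ^+ 5.
  by ring.
rewrite mulrA ler_wpM2r ?(ltW i5)//.
apply: (@le_trans _ _ (M * bM 1 (z 0) + sb * M * bM 0 (z 0))).
  by rewrite lerDr ltW.
by rewrite ler_peMr ?lerDl// ltW// addr_gt0.
Qed.

Lemma powR4_sqrt (a : R) : 0 <= a -> a `^ 4^-1 = Num.sqrt (Num.sqrt a).
Proof.
move=> a0; rewrite -!powR12_sqrt ?powR_ge0// -powRrM; congr (_ `^ _).
by field.
Qed.

Let cvg_half_ratio :
  bM 1 x / (Num.sqrt pi / Num.sqrt (2 * x) * expR (- x)) @[x --> +oo] --> (1 : R).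
Proof.
apply: squeeze_cvgr (cvg_cst (1 : R)) cvg_bM_ratio; near=> x.
have x0 : 0 < x by [].
have h0 : 0 < Num.sqrt pi / Num.sqrt (2 * x) * expR (- x).
  by rewrite mulr_gt0 ?expR_gt0// divr_gt0 ?sqrtr_gt0 ?pi_gt0// mulr_gt0.
rewrite ler_pdivlMr// mul1r half_le_bM1//=.
by rewrite ler_pM2l ?bM1_gt0// lef_pV2 ?posrE ?bM0_gt0 ?bM0_le_half.
Unshelve. all: by end_near. Qed.

(** K_1 lies between the elementary K_(1/2) and K_(1/2) times K_1 / K_0, and
    K_1 / K_0 tends to 1. It remains to compare [sqrt (t + 1)] with [sqrt t] in the
    exponential and in the prefactor. *)
Lemma kap_asymptotic :
  kap t * (t `^ (- 4^-1) * expR (2 * Num.sqrt (b * t))) @[t --> +oo] -->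
    Num.sqrt pi / (2 * b `^ 4^-1).
Proof.
pose q t := Num.sqrt (Num.sqrt (1 + t^-1)).
pose r t := bM 1 (z t) / (Num.sqrt pi / Num.sqrt (2 * z t) * expR (- z t)).
pose e t := expR (2 * Num.sqrt (b * t) - z t).
have q1 : q t @[t --> +oo] --> (1 : R).
  have h : 1 + t^-1 @[t --> +oo] --> (1 : R).
    rewrite -[X in _ --> X]addr0; apply: cvgD; first exact: cvg_cst.
    by apply/gtr0_cvgV0; [near=> t|exact: cvg_id].
  rewrite -[X in _ --> X]sqrtr1 -[X in Num.sqrt X]sqrtr1.
  apply: (@cvg_comp _ _ _ (fun t => Num.sqrt (1 + t^-1)) Num.sqrt); last exact: sqrt_continuous.
  by apply: (@cvg_comp _ _ _ (fun t => 1 + t^-1) Num.sqrt); [exact: h|exact: sqrt_continuous].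
have r1 : r t @[t --> +oo] --> (1 : R) by exact: (cvg_comp _ _ cvg_z cvg_half_ratio).
have e1 : e t @[t --> +oo] --> (1 : R).
  rewrite -[X in _ --> X]expR0; apply: (@cvg_comp _ _ _ _ expR); last exact: continuous_expR.
  have h : (2 * b) * (z t)^-1 @[t --> +oo] --> (0 : R).
    rewrite -[X in _ --> X](mulr0 (2 * b)); apply: cvgM; first exact: cvg_cst.
    apply/gtr0_cvgV0; last exact: cvg_z.
    by near=> t; apply: z_gt0; rewrite (@lt_le_trans _ _ 0) ?ltrN10.
  have h2 : 2 * ((2 * b) * (z t)^-1) @[t --> +oo] --> (0 : R).
    by rewrite -[X in _ --> X](mulr0 2); apply: cvgM => //; exact: cvg_cst.
  apply: squeeze_near0 h2; near=> t.
  have t0 : 0 <= t by [].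
  have z0 : 0 < z t by apply: z_gt0; rewrite (@lt_le_trans _ _ 0) ?ltrN10.
  have s0 := sqrtr_ge0 (b * t); have bt : 0 <= b * t by rewrite mulr_ge0 ?ltW.
  have h3 : (z t - 2 * Num.sqrt (b * t)) * (z t + 2 * Num.sqrt (b * t)) = 4 * b.
    have := z_sqr (lt_le_trans (ltrN10 R) t0); have := sqr_sqrtr bt.
    by move: (z t) (Num.sqrt _) => w v; nra.
  have h4 : 2 * Num.sqrt (b * t) <= z t.
    by rewrite /z ler_wpM2l// ler_wsqrtr// ler_wpM2l ?(ltW b0)// lerDl.
  rewrite distrC ger0_norm ?subr_ge0//.
  have -> : 2 * (2 * b / z t) = 4 * b / z t by ring.
  rewrite ler_pdivlMr// -h3 ler_wpM2l ?subr_ge0//.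
  by rewrite lerDl mulr_ge0.
have main : Num.sqrt pi / (2 * b `^ 4^-1) * (q t * e t * r t) @[t --> +oo] -->
    Num.sqrt pi / (2 * b `^ 4^-1).
  rewrite -[X in _ --> X]mulr1; apply: cvgM; first exact: cvg_cst.
  rewrite -[X in _ --> X]mulr1; apply: cvgM; last exact: r1.
  by rewrite -[X in _ --> X]mulr1; apply: cvgM.
apply: cvg_trans main; apply: near_eq_cvg; near=> t.
have t0 : 0 < t by [].
have tp : 0 < t + 1 by rewrite addr_gt0.
have z0 : 0 < z t by apply: z_gt0; rewrite (@lt_trans _ _ 0) ?ltrN10.
rewrite powRN !powR4_sqrt ?(ltW t0) ?(ltW b0)// /q /r /e kap.unlock besselK1E -/(z t).
have -> : 1 + t^-1 = (t + 1) / t by field; rewrite gt_eqF.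
have -> : Num.sqrt (Num.sqrt ((t + 1) / t)) =
    Num.sqrt (Num.sqrt (t + 1)) / Num.sqrt (Num.sqrt t).
  by rewrite (sqrtrM t^-1 (ltW tp)) sqrtrM ?sqrtr_ge0// !sqrtrV ?sqrtr_ge0 ?(ltW t0).
have e2 : Num.sqrt (2 * z t) =
    2 * (Num.sqrt (Num.sqrt b) * Num.sqrt (Num.sqrt (t + 1))).
  have -> : 2 * z t = 2 ^+ 2 * Num.sqrt (b * (t + 1)) by rewrite /z; ring.
  rewrite sqrtrM ?sqr_ge0// sqrtr_sqr ger0_norm//.
  by rewrite !sqrtrM ?sqrtr_ge0 ?(ltW b0).
rewrite e2.
have pi0 : 0 < Num.sqrt pi :> R by rewrite sqrtr_gt0 pi_gt0.
have b40 : 0 < Num.sqrt (Num.sqrt b) by rewrite !sqrtr_gt0.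
have t40 : 0 < Num.sqrt (Num.sqrt t) by rewrite !sqrtr_gt0.
have s40 : 0 < Num.sqrt (Num.sqrt (t + 1)) by rewrite !sqrtr_gt0.
have s4 : Num.sqrt (Num.sqrt (t + 1)) ^+ 2 = Num.sqrt (t + 1).
  by rewrite sqr_sqrtr ?sqrtr_ge0.
move: s40 s4; set s := Num.sqrt (Num.sqrt (t + 1)) => s40 <-.
rewrite expRD; have := expR_gt0 (- z t).
move: (expR (- z t)) => E E0; field.
by rewrite !gt_eqF.
Unshelve. all: by end_near. Qed.

End kernel.

(** * Perturbed paths and their growth *)

Section real_analysis.
Context {R : realType}.
Notation mu := (@lebesgue_measure R).
Implicit Types (f g F G : R -> R) (a b s t u x : R).

Lemma deriv_mono f F s t : s <= t ->
  (forall u, s <= u <= t -> is_derive u 1 F (f u)) ->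
  (forall u, s <= u <= t -> 0 <= f u) -> F s <= F t.
Proof.
rewrite le_eqVlt => /predU1P[-> //|st] dF f0.
have [||c] := @MVT _ F f s t st.
- by move=> c; rewrite in_itv/= => /andP[sc ct]; apply: dF; rewrite !ltW.
- apply: cont_within => u; rewrite /= in_itv/= => h; exact: deriv_cont (dF _ h).
rewrite in_itv/= => /andP[sc ct] e.
by rewrite -subr_ge0 e mulr_ge0 ?f0 ?subr_ge0 ?ltW//= ltW.
Qed.

(** Cauchy's mean value theorem from a fixed base point, whose contribution is
    killed by the diverging denominator. *)
Lemma lhopital_infty f F g G (L : R) :
  (forall t, 0 <= t -> is_derive t 1 F (f t)) ->
  (forall t, 0 <= t -> is_derive t 1 G (g t)) ->
  (forall t, 0 <= t -> 0 < g t) ->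
  G t @[t --> +oo] --> +oo -> f t / g t @[t --> +oo] --> L ->
  F t / G t @[t --> +oo] --> L.
Proof.
move=> dF dG g0 Gy fgL; apply/cvgrPdist_le => e e0.
have e20 : 0 < e / 2 by rewrite divr_gt0.
have /cvgrPdist_le/(_ _ e20)[A [_ hA]] := fgL.
pose a : R := Num.max A 0 + 1.
have a0 : 0 <= a by rewrite addr_ge0// le_max lexx orbT.
have Aa u : a <= u -> `|L - f u / g u| <= e / 2.
  move=> au; apply: hA; apply: lt_le_trans au.
  by rewrite /a ltr_pwDr// le_max lexx.
pose M : R := `|F a| + (`|L| + e / 2) * `|G a|.
have M0 : 0 <= M by rewrite addr_ge0// mulr_ge0// addr_ge0// ltW.
near=> t.
have at1 : a < t by near: t; apply: nbhs_pinfty_gt; rewrite num_real.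
have Gt : M / (e / 2) + `|G a| + 1 <= G t.
  by near: t; exact: (cvgryPge _).1 Gy _.
have Ga : `|G a| < G t.
  by apply: lt_le_trans Gt; rewrite ltr_pwDr// lerDr divr_ge0// ltW.
have G0 : 0 < G t by rewrite (le_lt_trans _ Ga).
have pos u : a <= u -> 0 <= u by exact: le_trans.
have [|||||c] := @cauchy_MVT _ F f G g a t at1.
- by apply: cont_within => u; rewrite /= in_itv/= => /andP[/pos u0 _]; exact: deriv_cont (dF _ u0).
- by apply: cont_within => u; rewrite /= in_itv/= => /andP[/pos u0 _]; exact: deriv_cont (dG _ u0).
- by move=> u; rewrite in_itv/= => /andP[/ltW/pos u0 _]; exact: dF.
- by move=> u; rewrite in_itv/= => /andP[/ltW/pos u0 _]; exact: dG.
- by move=> u; rewrite in_itv/= => /andP[/ltW/pos u0 _]; rewrite gt_eqF// g0.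
rewrite in_itv/= => /andP[/ltW/Aa hc _] er.
have Gat : G t - G a != 0.
  by rewrite subr_eq0 gt_eqF// (le_lt_trans (ler_norm _) Ga).
set r := f c / g c in er hc.
have Ft : F t = F a + r * (G t - G a) by rewrite er divfK// addrC subrK.
have rL : `|r| <= `|L| + e / 2.
  have -> : r = L - (L - r) by ring.
  by rewrite (le_trans (ler_normB _ _))// lerD2l.
have -> : L - F t / G t = (L - r) - (F a - r * G a) / G t.
  by rewrite Ft; field; rewrite (gt_eqF G0).
rewrite (le_trans (ler_normB _ _))//.
have -> : e = e / 2 + e / 2 by rewrite -splitr.
rewrite lerD// normrM normfV (gtr0_norm G0) ler_pdivrMr//.
apply: (@le_trans _ _ M).
  rewrite (le_trans (ler_normB _ _))// lerD// normrM ler_wpM2r//.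
have : M / (e / 2) <= G t.
  by apply: le_trans Gt; rewrite -addrA lerDl addr_ge0.
by rewrite ler_pdivrMr// mulrC.
Unshelve. all: by end_near. Qed.

(** Clamping extends a path on a half line continuously to the whole line. *)
Lemma continuous_clamp f a : {within `[a, +oo[, continuous f} ->
  continuous (fun t => f (Num.max a t)).
Proof.
move=> /subspace_continuousP cf t.
have am : `[a, +oo[%classic (Num.max a t) by rewrite /= in_itv/= le_max lexx.
apply: (@cvg_comp _ _ _ (fun t => Num.max a t) f _ (within `[a, +oo[ (nbhs (Num.max a t)))); last exact: cf.
move=> S /= wS.
have hm : (Num.max a u) @[u --> t] --> Num.max a t.
  by apply: continuous_max; [exact: cst_continuous|move=> ?; exact: cvg_id].
have := hm _ wS; apply: (@filterS _ (nbhs t)) => u /=; apply.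
by rewrite /= in_itv/= le_max lexx.
Qed.

End real_analysis.

Section path.
Context {R : realType}.
Notation mu := (@lebesgue_measure R).
Variables (b sigma : R) (x beta : R -> R).
Hypotheses (b0 : 0 < b)
  (cx : {within `[-1, +oo[, continuous x})
  (cbeta : {within `[0, +oo[, continuous beta})
  (beta0 : beta 0 = 0)
  (eqx : forall t, 0 <= t -> x t = x 0
     + \int[mu]_(s in `[0, t]) (b / (1 + s) * \int[mu]_(u in `[-1, s]) x u)
     + sigma * beta t).
Implicit Types (s t u v : R).

Let I t := \int[mu]_(u in `[-1, t]) x u.

Lemma deriv_path_integral t : -1 < t -> is_derive t 1 I (x t).
Proof.
move=> t1; pose y u := x (Num.max (-1) u).
have cy : continuous y by exact: continuous_clamp.
have yx u : -1 <= u -> y u = x u by move=> u1; rewrite /y max_r.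
have -> : I = (fun t => \int[mu]_(u in `[-1, t]) y u).
  apply/funext => v; apply: eq_Rintegral => u; rewrite inE/= in_itv/= => /andP[u1 _].
  by rewrite yx.
rewrite -(yx _ (ltW t1)); apply: deriv_Rintegral => // u _; exact: cy.
Qed.

(** Testing the equation against a solution [v] of [v'' = b / (1 + t) v] makes
    the drift cancel: [x v - I v'] only moves with the noise. *)
Lemma wronskian (v dv : R -> R) :
  (forall t, 0 <= t -> is_derive t 1 v (dv t)) ->
  (forall t, 0 <= t -> is_derive t 1 dv (b / (1 + t) * v t)) ->
  forall t, 0 <= t ->
  x t * v t - I t * dv t = x 0 * v 0 - I 0 * dv 0
    + sigma * (v t * beta t - \int[mu]_(s in `[0, t]) (dv s * beta s)).
Proof.
move=> dv1 dv2 t t0.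
have h2 : -1 < - 2^-1 :> R by lra.
have h20 : - 2^-1 < 0 :> R by lra.
have hI s : - 2^-1 <= s -> -1 < s by exact: lt_le_trans.
have cf s : - 2^-1 <= s -> {for s, continuous (fun s => b / (1 + s) * I s)}.
  move=> s2; have s1 := hI _ s2.
  apply: cvgM; last exact: (deriv_cont (deriv_path_integral s1)).
  apply: cvgM; first exact: cvg_cst.
  apply: cvgV; first by apply/eqP; lra.
  by apply: cvgD; [exact: cvg_cst|exact: cvg_id].
pose N t := \int[mu]_(s in `[- 2^-1, t]) (b / (1 + s) * I s).
have dN s : 0 <= s -> is_derive s 1 N (b / (1 + s) * I s).
  by move=> s0; apply: deriv_Rintegral => //; exact: lt_le_trans s0.
have Nsplit s : 0 <= s -> N s = N 0 + \int[mu]_(s in `[0, s]) (b / (1 + s) * I s).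
  move=> s0; rewrite -Rintegral_itv_split ?(ltW h20)//.
  apply: cont_integrable; apply: cont_within => u; rewrite /= in_itv/= => /andP[u2 _].
  exact: cf.
pose y t := x 0 + (N t - N 0).
have yx s : 0 <= s -> y s = x s - sigma * beta s.
  move=> s0; have e : x s = x 0 + \int[mu]_(s in `[0, s]) (b / (1 + s) * I s) + sigma * beta s.
    exact: eqx.
  by rewrite /y (Nsplit _ s0) e; ring.
pose bb s := beta (Num.max 0 s).
have cbb : continuous bb by exact: continuous_clamp.
have bbE s : 0 <= s -> bb s = beta s by move=> s0; rewrite /bb max_r.
pose cdv s := dv (Num.max 0 s).
have ccdv : continuous cdv.
  apply: continuous_clamp; apply: cont_within => s; rewrite /= in_itv/= andbT => s0.
  exact: deriv_cont (dv2 _ s0).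
have cdvE s : 0 <= s -> cdv s = dv s by move=> s0; rewrite /cdv max_r.
have cdb s : {for s, continuous (fun s => cdv s * bb s)}.
  by apply: cvgM; [exact: ccdv|exact: cbb].
pose J t := \int[mu]_(s in `[- 2^-1, t]) (cdv s * bb s).
have dJ s : 0 <= s -> is_derive s 1 J (dv s * beta s).
  move=> s0; rewrite -cdvE// -bbE//; apply: deriv_Rintegral; first exact: lt_le_trans s0.
  by move=> u _; exact: cdb.
have Jsplit s : 0 <= s -> J s = J 0 + \int[mu]_(s in `[0, s]) (dv s * beta s).
  move=> s0; rewrite /J (@Rintegral_itv_split _ _ _ 0) ?(ltW h20)//; last first.
    by apply: cont_integrable; apply: cont_within => u _; exact: cdb.
  congr (_ + _); apply: eq_Rintegral => u; rewrite inE/= in_itv/= => /andP[u0 _].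
  by rewrite cdvE// bbE.
pose D t := y t * v t - I t * dv t + sigma * J t.
have dD s : 0 <= s <= t -> is_derive s 1 D ((fun=> 0) s).
  move=> /andP[s0 _].
  have dy : is_derive s 1 y (b / (1 + s) * I s).
    have := derivD (deriv_cst (x 0) s) (derivB (dN _ s0) (deriv_cst (N 0) s)).
    by rewrite subr0 add0r.
  have s1 : -1 < s by rewrite (lt_le_trans (ltrN10 R)).
  apply: (deriv_eq (derivD (derivB (derivM dy (dv1 _ s0))
    (derivM (deriv_path_integral s1) (dv2 _ s0))) (derivZ sigma (dJ _ s0)))).
  by rewrite yx//; ring.
have cc s : 0 <= s <= t -> {for s, continuous ((fun=> 0) : R -> R)} by move=> _; exact: cvg_cst.
have := FTC2 t0 dD cc.
rewrite Rintegral_cst//= mul0r => /eqP; rewrite eq_sym subr_eq0 => /eqP.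
rewrite /D !yx// beta0 mulr0 subr0 Jsplit// => h.
apply/eqP; rewrite -subr_eq0; apply/eqP.
transitivity (((x t - sigma * beta t) * v t - I t * dv t + sigma * (J 0 + \int[mu]_(s in `[0, t]) (dv s * beta s)))
  - (x 0 * v 0 - I 0 * dv 0 + sigma * J 0)); first by ring.
by rewrite h subrr.
Qed.

End path.

Lemma sqrV_le (R : realType) (x y : R) : 0 < x -> x <= y -> y ^- 2 <= x ^- 2.
Proof.
move=> x0 xy; have y0 := lt_le_trans x0 xy.
by rewrite lef_pV2 ?posrE ?exprn_gt0// lerXn2r// nnegrE ltW.
Qed.

(** By reduction of order [kap * Qf] is a second, growing solution of the
    homogeneous equation. The base point [- 1 / 2] makes [Qf] differentiable at
    time 0 as well. *)
HB.lock Definition Qf {R : realType} (b t : R) : R :=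
  \int[lebesgue_measure]_(u in `[- 2^-1, t]) (kap b u) ^- 2.

Section path_asymptotics.
Context {R : realType}.
Notation mu := (@lebesgue_measure R).
Variable b : R.
Hypothesis b0 : 0 < b.
Implicit Types (s t u v : R).
Notation kap := (kap b).
Notation eta := (eta b).
Notation Qf := (Qf b).

Let QfE : Qf = fun t => \int[mu]_(u in `[- 2^-1, t]) (kap u) ^- 2.
Proof. by rewrite Qf.unlock. Qed.

Let t_gtN1 t : 0 <= t -> -1 < t. Proof. exact: lt_le_trans (ltrN10 R). Qed.

Let kpos t : 0 <= t -> 0 < kap t. Proof. by move=> t0; exact: kap_gt0 (t_gtN1 t0). Qed.
Let epos t : 0 <= t -> 0 < eta t. Proof. by move=> t0; exact: eta_gt0 (t_gtN1 t0). Qed.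
Let kepos t : 0 <= t -> 0 < kap t * eta t.
Proof. by move=> t0; exact: mulr_gt0 (kpos t0) (epos t0). Qed.

(** A closed form growing like [Qf]: the quotient of the derivatives of [G] and
    [Qf] is [(1 + rho) / 2], which tends to 1. *)
Let G t : R := (2 * kap t * eta t)^-1.

Lemma cvg_kap_eta : kap t * eta t @[t --> +oo] --> (0 : R).
Proof.
have [D D0 hD] := kernel_decay b0.
have h : D ^+ 2 * t^-1 @[t --> +oo] --> (0 : R).
  rewrite -[X in _ --> X](mulr0 (D ^+ 2)); apply: cvgM; first exact: cvg_cst.
  by apply/gtr0_cvgV0; [near=> t|exact: cvg_id].
apply: squeeze_near0 h; near=> t.
have t0 : 0 < t by [].
have [hk he] := hD _ (ltW t0).
have k0 := kap_gt0 b0 (t_gtN1 (ltW t0)); have e0 := eta_gt0 b0 (t_gtN1 (ltW t0)).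
rewrite (ger0_norm (mulr_ge0 (ltW k0) (ltW e0))).
apply: (@le_trans _ _ ((D / (1 + t) ^+ 4) * (D / (1 + t) ^+ 4))).
  exact: ler_pM (ltW k0) (ltW e0) hk he.
have -> : (D / (1 + t) ^+ 4) * (D / (1 + t) ^+ 4) = D ^+ 2 * ((1 + t) ^+ 8)^-1.
  by field; rewrite gt_eqF// addr_gt0.
rewrite ler_wpM2l ?sqr_ge0// lef_pV2 ?posrE ?exprn_gt0 ?addr_gt0//.
apply: (@le_trans _ _ (1 + t)); first by rewrite lerDr.
by rewrite -[leLHS]expr1 ler_weXn2l// lerDl ltW.
Unshelve. all: by end_near. Qed.

Let Gpos t : 0 <= t -> 0 < G t.
Proof. by move=> t0; rewrite /G invr_gt0 -mulrA (mulr_gt0 _ (kepos t0)). Qed.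

Lemma cvg_G : G t @[t --> +oo] --> +oo.
Proof.
apply/gtr0_cvgV0.
  by near=> t; apply: Gpos.
have h : 2 * (kap t * eta t) @[t --> +oo] --> (0 : R).
  by rewrite -[X in _ --> X](mulr0 2); apply: cvgM; [exact: cvg_cst|exact: cvg_kap_eta].
apply: cvg_trans h; apply: near_eq_cvg; near=> t.
by rewrite /G /= invrK mulrA.
Unshelve. all: by end_near. Qed.

Let dG t : 0 <= t -> is_derive t 1 G ((1 + rho b t) / (2 * kap t ^+ 2)).
Proof.
move=> t0; have t1 := t_gtN1 t0.
have k0 := kap_gt0 b0 t1; have e0 := eta_gt0 b0 t1.
have dk := derivZ 2 (deriv_kap b0 t1); have de := deriv_eta b0 t1.
have nz : 2 * kap t * eta t != 0 by rewrite gt_eqF// -mulrA (mulr_gt0 _ (kepos t0)).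
apply: (deriv_eq (derivV (derivM dk de) nz)).
rewrite rho.unlock; field.
by rewrite (gt_eqF k0) (gt_eqF e0)/= gt_eqF//; lra.
Qed.

(** [(I / kap)' = W / kap ^ 2], and its quotient by [G'] is [2 W / (1 + rho)]. *)
Lemma kernel_lhopital (I x W : R -> R) (L : R) :
  (forall t, 0 <= t -> is_derive t 1 I (x t)) ->
  (forall t, 0 <= t -> x t * kap t + I t * eta t = W t) ->
  W t @[t --> +oo] --> L ->
  I t / kap t / G t @[t --> +oo] --> L.
Proof.
move=> dI eW WL.
have d t : 0 <= t -> is_derive t 1 (fun t => I t / kap t) (W t / kap t ^+ 2).
  move=> t0; have t1 := t_gtN1 t0; have k0 := kap_gt0 b0 t1.
  have nz : kap t != 0 by rewrite gt_eqF.
  apply: (deriv_eq (derivM (dI _ t0) (derivV (deriv_kap b0 t1) nz))).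
  by rewrite -eW//; field.
apply: (lhopital_infty d dG).
- move=> t t0; have t1 := t_gtN1 t0; have := rho_ge1 b0 t1 => r1.
  apply: divr_gt0; first by rewrite ltr_pwDl// (le_trans ler01).
  by rewrite (mulr_gt0 _ (exprn_gt0 2 (kpos t0))).
- exact: cvg_G.
have h : 2 * W t / (1 + rho b t) @[t --> +oo] --> L.
  rewrite (_ : L = 2 * L / (1 + 1)); last by field.
  apply: cvgM; first by apply: cvgM => //; exact: cvg_cst.
  by apply: cvgV; [rewrite gt_eqF|apply: cvgD; [exact: cvg_cst|exact: cvg_rho]].
apply: cvg_trans h; apply: near_eq_cvg; near=> t.
have t0 : 0 <= t by [].
have t1 := t_gtN1 t0; have r1 := rho_ge1 b0 t1; have k0 := kap_gt0 b0 t1.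
by field; rewrite (gt_eqF k0) gt_eqF// ltr_pwDl// (le_trans ler01).
Unshelve. all: by end_near. Qed.

(** The limit of [W] splits evenly between its two terms: [I eta] is
    [I / kap / G / 2], to which [kernel_lhopital] applies. *)
Lemma kernel_limit (I x W : R -> R) (L : R) :
  (forall t, 0 <= t -> is_derive t 1 I (x t)) ->
  (forall t, 0 <= t -> x t * kap t + I t * eta t = W t) ->
  W t @[t --> +oo] --> L ->
  kap t * x t @[t --> +oo] --> L / 2.
Proof.
move=> dI eW WL; have h := kernel_lhopital dI eW WL.
have h2 : W t - (I t / kap t / G t) / 2 @[t --> +oo] --> L / 2.
  rewrite (_ : L / 2 = L - L / 2); last by field.
  by apply: cvgB => //; apply: cvgM => //; exact: cvg_cst.
apply: cvg_trans h2; apply: near_eq_cvg; near=> t.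
have t0 : 0 <= t by [].
have t1 := t_gtN1 t0; have k0 := kap_gt0 b0 t1; have e0 := eta_gt0 b0 t1.
by rewrite -eW// /G; field; rewrite (gt_eqF k0) (gt_eqF e0).
Unshelve. all: by end_near. Qed.

Let N2_gtN1 u : - 2^-1 <= u -> -1 < u. Proof. by move=> h; lra. Qed.

Let cQ u : - 2^-1 <= u -> {for u, continuous (fun u => (kap u) ^- 2)}.
Proof.
move=> /N2_gtN1 u1; have k0 := kap_gt0 b0 u1; have ck := deriv_cont (deriv_kap b0 u1).
apply: cvgV; first by rewrite gt_eqF// exprn_gt0.
by apply: (@cvg_comp _ _ _ kap (fun y => y ^+ 2)); [exact: ck|exact: exprn_continuous].
Qed.

Lemma deriv_Qf t : 0 <= t -> is_derive t 1 Qf (kap t ^- 2).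
Proof.
move=> t0; rewrite QfE; apply: deriv_Rintegral; last exact: cQ.
by apply: lt_le_trans t0; lra.
Qed.

Lemma Qf_ge0 t : 0 <= Qf t.
Proof. by rewrite QfE; apply: Rintegral_ge0 => u _; rewrite invr_ge0 sqr_ge0. Qed.

Lemma kap_mono s t : -1 < s -> s <= t -> kap t <= kap s.
Proof.
move=> s1 st; rewrite -lerN2.
have h u : s <= u <= t -> is_derive u 1 (fun t => - kap t) (- - eta u).
  by move=> /andP[su _]; apply: derivN; apply: deriv_kap => //; exact: lt_le_trans su.
apply: (deriv_mono st h) => u /andP[su _].
by rewrite opprK ltW// eta_gt0//; exact: lt_le_trans su.
Qed.

(** The integrand of [Qf t] is largest at [t], because [kap] is nonincreasing. *)
Lemma Qf_le t : 0 <= t -> kap t ^+ 2 * Qf t <= t + 1.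
Proof.
move=> t0; have k0 := kap_gt0 b0 (t_gtN1 t0).
have tN : - 2^-1 <= t by apply: le_trans t0; lra.
have h (u : R) : - 2^-1 <= u -> u <= t -> kap u ^- 2 <= kap t ^- 2.
  move=> /N2_gtN1 u1 ut; have ku := kap_gt0 b0 u1; have kk := kap_mono u1 ut.
  exact: sqrV_le k0 kk.
have : Qf t <= \int[mu]_(u in `[- 2^-1, t]) (kap t ^- 2).
  rewrite QfE; apply: le_Rintegral; first by [].
  - by apply: cont_integrable; apply: cont_within => u; rewrite /= in_itv/= => /andP[/cQ].
  - by apply: cont_integrable; apply: cont_within => u _; exact: cvg_cst.
  by move=> u; rewrite /= in_itv/= => /andP[u2 ut]; exact: h.
rewrite Rintegral_cst//= lebesgue_measure_itv/= lte_fin (lt_le_trans _ t0); last by lra.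
rewrite -EFinD/= mulrC ler_pdivlMr ?exprn_gt0// mulrC => /le_trans; apply; lra.
Qed.

(** [G - Qf] is nondecreasing because [rho >= 1]. *)
Lemma Qf_increment s t : 0 <= s -> s <= t ->
  0 <= Qf t - Qf s /\ 2 * (kap t * eta t) * (Qf t - Qf s) < 1.
Proof.
move=> s0 st; have t0 := le_trans s0 st.
have pos u : s <= u -> 0 <= u by exact: le_trans.
have ke := kepos t0; have Gs0 := Gpos s0.
split.
  rewrite subr_ge0; apply: (deriv_mono st (f := fun u => kap u ^- 2)).
    by move=> u /andP[/pos u0 _]; exact: deriv_Qf.
  by move=> u _; rewrite invr_ge0 sqr_ge0.
have : G s - Qf s <= G t - Qf t.
  have h u : s <= u <= t -> is_derive u 1 (fun u => G u - Qf u)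
      ((1 + rho b u) / (2 * kap u ^+ 2) - kap u ^- 2).
    by move=> /andP[/pos u0 _]; apply: derivB; [exact: dG|exact: deriv_Qf].
  apply: (deriv_mono st h) => u /andP[/pos/t_gtN1 u1 _].
  have r1 := rho_ge1 b0 u1; have k0 := kap_gt0 b0 u1.
  have -> : (1 + rho b u) / (2 * kap u ^+ 2) - kap u ^- 2 = (rho b u - 1) / (2 * kap u ^+ 2).
    by field; rewrite (gt_eqF k0).
  by rewrite divr_ge0 ?subr_ge0// mulr_ge0// sqr_ge0.
have lt_of (q q' g g' : R) : 0 < g' -> g' - q' <= g - q -> q - q' < g by move=> *; lra.
move=> /(lt_of _ _ _ _ Gs0).
have k20 : 0 < 2 * (kap t * eta t) by rewrite mulr_gt0.
by rewrite /G -mulrA => hG; rewrite mulrC -ltr_pdivlMr// mul1r.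
Qed.

(** [kernel_lhopital] for [I = kap * Qf], for which [W] is constantly 1. *)
Lemma cvg_Qf : kap t * eta t * Qf t @[t --> +oo] --> (2^-1 : R).
Proof.
pose x t := Qf t * (- eta t) + kap t ^- 2 * kap t.
pose I t := Qf t * kap t.
have dI t : 0 <= t -> is_derive t 1 I (x t).
  move=> t0; apply: (deriv_eq (derivM (deriv_Qf t0) (deriv_kap b0 (t_gtN1 t0)))).
  by rewrite addrC.
have eW t : 0 <= t -> x t * kap t + I t * eta t = (fun=> 1) t.
  move=> t0; have k0 := kap_gt0 b0 (t_gtN1 t0).
  by rewrite /x /I; field; rewrite (gt_eqF k0).
have h := kernel_lhopital dI eW (cvg_cst (1 : R)).
have h2 : (I t / kap t / G t) / 2 @[t --> +oo] --> (2^-1 : R).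
  rewrite -[X in _ --> X]mul1r; apply: cvgM; first exact: h.
  exact: cvg_cst.
apply: cvg_trans h2; apply: near_eq_cvg; near=> t.
have t0 : 0 <= t by [].
have t1 := t_gtN1 t0; have k0 := kap_gt0 b0 t1; have e0 := eta_gt0 b0 t1.
by rewrite /I /G; field; rewrite (gt_eqF k0) (gt_eqF e0).
Unshelve. all: by end_near. Qed.

End path_asymptotics.

Section backward.
Context {R : realType}.
Notation mu := (@lebesgue_measure R).
Variable b : R.
Hypothesis b0 : 0 < b.
Implicit Types (s t u v : R).
Notation kap := (kap b).
Notation eta := (eta b).
Notation Qf := (Qf b).

Lemma ge0_gtN1 t : 0 <= t -> -1 < t. Proof. exact: lt_le_trans (ltrN10 R). Qed.

Lemma kap_pos t : 0 <= t -> 0 < kap t.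
Proof. by move=> t0; exact: kap_gt0 (ge0_gtN1 t0). Qed.

Lemma eta_pos t : 0 <= t -> 0 < eta t.
Proof. by move=> t0; exact: eta_gt0 (ge0_gtN1 t0). Qed.

Lemma cont_kap t : 0 <= t -> {for t, continuous kap}.
Proof. by move=> t0; exact: deriv_cont (deriv_kap b0 (ge0_gtN1 t0)). Qed.

Lemma cont_eta t : 0 <= t -> {for t, continuous eta}.
Proof. by move=> t0; exact: deriv_cont (deriv_eta b0 (ge0_gtN1 t0)). Qed.

(** By variation of constants this is the solution of the homogeneous equation
    with value 1 and slope 0 at time [t], so that testing against it extracts the
    value of a path at [t]; [dbsol] is its derivative. *)
Definition bsol t s := kap s / kap t * (1 - kap t * eta t * (Qf t - Qf s)).
Definition dbsol t s :=
  - eta s / kap t * (1 - kap t * eta t * (Qf t - Qf s)) + eta t / kap s.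

Lemma bsol_end t : 0 <= t -> bsol t t = 1.
Proof.
by move=> t0; rewrite /bsol subrr mulr0 subr0 mulr1 divff// (lt0r_neq0 (kap_pos t0)).
Qed.

Lemma dbsol_end t : dbsol t t = 0.
Proof. by rewrite /dbsol subrr mulr0 subr0 mulr1 mulNr addNr. Qed.

Let deriv_bracket t s : 0 <= s ->
  is_derive s 1 (fun s => 1 - kap t * eta t * (Qf t - Qf s)) (kap t * eta t * kap s ^- 2).
Proof.
move=> s0; apply: (deriv_eq (derivB (deriv_cst 1 s) (derivZ (kap t * eta t)
  (derivB (deriv_cst (Qf t) s) (deriv_Qf b0 s0))))).
by rewrite !sub0r mulrN opprK.
Qed.

Lemma deriv_bsol t s : 0 <= t -> 0 <= s -> is_derive s 1 (bsol t) (dbsol t s).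
Proof.
move=> t0 s0; have kt := lt0r_neq0 (kap_pos t0); have ks := lt0r_neq0 (kap_pos s0).
have d1 := derivM (deriv_kap b0 (ge0_gtN1 s0)) (deriv_cst (kap t)^-1 s).
apply: (deriv_eq (derivM d1 (deriv_bracket t s0))).
by rewrite /dbsol; field; rewrite kt ks.
Qed.

Lemma deriv_dbsol t s : 0 <= t -> 0 <= s ->
  is_derive s 1 (dbsol t) (b / (1 + s) * bsol t s).
Proof.
move=> t0 s0; have kt := lt0r_neq0 (kap_pos t0); have ks := lt0r_neq0 (kap_pos s0).
have s1 := ge0_gtN1 s0.
have d1 := derivM (derivN (deriv_eta b0 s1)) (deriv_cst (kap t)^-1 s).
have d2 := derivM d1 (deriv_bracket t s0).
have d3 := derivZ (eta t) (derivV (deriv_kap b0 s1) ks).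
apply: (deriv_eq (derivD d2 d3)).
rewrite /bsol; field; rewrite kt ks/= gt_eqF//; lra.
Qed.

Lemma bsol_gt0 t s : 0 <= s -> s <= t -> 0 < bsol t s.
Proof.
move=> s0 st; have t0 := le_trans s0 st.
have [_ h] := Qf_increment b0 s0 st.
rewrite /bsol mulr_gt0//; first exact: divr_gt0 (kap_pos s0) (kap_pos t0).
move: h; move: (kap t * eta t) (Qf t - Qf s) => p q; lra.
Qed.

(** [wronskian] for [bsol t], which has value 1 and slope 0 at [t]. *)
Lemma path_solution (sigma : R) (x beta : R -> R) :
  {within `[-1, +oo[, continuous x} -> {within `[0, +oo[, continuous beta} ->
  beta 0 = 0 ->
  (forall t, 0 <= t -> x t = x 0
     + \int[mu]_(s in `[0, t]) (b / (1 + s) * \int[mu]_(u in `[-1, s]) x u)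
     + sigma * beta t) ->
  forall t, 0 <= t ->
  x t = x 0 * bsol t 0 - (\int[mu]_(u in `[-1, 0]) x u) * dbsol t 0
    + sigma * (bsol t t * beta t - \int[mu]_(s in `[0, t]) (dbsol t s * beta s)).
Proof.
move=> cx cb be0 ex t t0.
have := wronskian cx cb be0 ex (fun s => @deriv_bsol t s t0)
  (fun s => @deriv_dbsol t s t0) t0.
by rewrite dbsol_end bsol_end// mulr0 subr0 mulr1.
Qed.

Lemma cvg_Qbracket :
  1 - kap t * eta t * (Qf t - Qf 0) @[t --> +oo] --> (2^-1 : R).
Proof.
have h : 1 - kap t * eta t * Qf t + kap t * eta t * Qf 0 @[t --> +oo] --> 1 - 2^-1 + 0 * Qf 0.
  apply: cvgD.
    by apply: cvgB; [exact: cvg_cst|exact: cvg_Qf].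
  by apply: cvgM; [exact: cvg_kap_eta|exact: cvg_cst].
rewrite (_ : 2^-1 = 1 - 2^-1 + 0 * Qf 0); last by rewrite mul0r addr0; lra.
apply: cvg_trans h; apply: near_eq_cvg; near=> t; ring.
Unshelve. all: by end_near. Qed.

Lemma cvg_mean (x0 I0 : R) :
  kap t * (x0 * bsol t 0 - I0 * dbsol t 0) @[t --> +oo] -->
    (x0 * kap 0 + I0 * eta 0) / 2.
Proof.
have h : (x0 * kap 0 + I0 * eta 0) * (1 - kap t * eta t * (Qf t - Qf 0))
    - I0 / kap 0 * (kap t * eta t) @[t --> +oo] -->
    (x0 * kap 0 + I0 * eta 0) / 2 - I0 / kap 0 * 0.
  apply: cvgB.
    by apply: cvgM; [exact: cvg_cst|exact: cvg_Qbracket].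
  by apply: cvgM; [exact: cvg_cst|exact: cvg_kap_eta].
rewrite mulr0 subr0 in h.
apply: cvg_trans h; apply: near_eq_cvg; near=> t.
have t0 : 0 <= t by [].
have kt := lt0r_neq0 (kap_pos t0); have ks := lt0r_neq0 (kap_pos (lexx 0)).
by rewrite /bsol /dbsol; field; rewrite kt ks.
Unshelve. all: by end_near. Qed.

Lemma integrable_inv_sqr : mu.-integrable `[0, +oo[ (EFin \o (fun t : R => (1 + t) ^- 2)).
Proof.
have d t : -1 < t -> is_derive t 1 (fun t : R => - (1 + t)^-1) ((1 + t) ^- 2).
  move=> t1; have nz : 1 + t != 0 by apply/eqP; lra.
  have := derivN (derivV (derivD (deriv_cst 1 t) (deriv_id t)) nz).
  by rewrite add0r mulNr opprK mul1r.
have c t : 0 <= t -> {for t, continuous (fun t : R => (1 + t) ^- 2)}.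
  move=> t0; apply: cvgV; first by rewrite expf_neq0//; apply/eqP; lra.
  apply: (@cvg_comp _ _ _ (fun t => 1 + t) (fun y => y ^+ 2)); last exact: exprn_continuous.
  by apply: cvgD; [exact: cvg_cst|exact: cvg_id].
have cw : {within `[0, +oo[, continuous (fun t : R => (1 + t) ^- 2)}.
  by apply: cont_within => t; rewrite /= in_itv/= andbT; exact: c.
have ge t : 0 <= t -> 0 <= (1 + t) ^- 2 by move=> _; rewrite invr_ge0 sqr_ge0.
have lim : - (1 + t)^-1 @[t --> +oo] --> (0 : R).
  rewrite -[X in _ --> X]oppr0; apply: cvgN; apply/gtr0_cvgV0.
    by near=> t; have : 0 <= t by []; lra.
  exact: cvg_addrl.
have dd t : 0 < t -> derivable (fun t : R => - (1 + t)^-1) t 1.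
  by move=> t0; exact: deriv_derivable (d _ (lt_trans (ltrN10 R) t0)).
have e := ge0_continuous_FTC2y ge cw lim dd
  (cvg_at_right_filter (deriv_cont (d _ (ltrN10 R)))).
apply/integrableP; split.
  by apply/measurable_EFinP; apply: subspace_continuous_measurable_fun.
under eq_integral => t _ do rewrite /= ger0_norm ?invr_ge0 ?sqr_ge0//.
rewrite e; first by rewrite -EFinB ltry.
by move=> t; rewrite in_itv/= andbT => /(lt_trans (ltrN10 R))/d/deriv_derive1.
Unshelve. all: by end_near. Qed.

(** The forms in which [kernel_decay] is used. *)
Lemma kernel_decay2 : exists2 D, 0 < D & forall t, 0 <= t ->
  [/\ kap t <= D / (1 + t) ^+ 4, kap t * (1 + t) ^+ 2 <= D / (1 + t) ^+ 2,
    eta t * (1 + t) ^+ 2 <= D / (1 + t) ^+ 2 & kap t <= D].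
Proof.
have [D D0 h] := kernel_decay b0; exists D => // t t0.
have [hk he] := h _ t0.
have p0 : 0 < 1 + t by lra.
have aux x : x <= D / (1 + t) ^+ 4 -> x * (1 + t) ^+ 2 <= D / (1 + t) ^+ 2.
  move=> hx; rewrite (_ : D / _ = D / (1 + t) ^+ 4 * (1 + t) ^+ 2).
    by rewrite ler_wpM2r// sqr_ge0.
  by field; rewrite gt_eqF.
split; [by []|exact: aux|exact: aux|].
apply: le_trans hk _; rewrite ler_pdivrMr ?exprn_gt0// ler_peMr ?(ltW D0)//.
by rewrite exprn_ege1// lerDl.
Qed.

Lemma integrable_kap_sqr : mu.-integrable `[0, +oo[ (EFin \o (fun t => kap t ^+ 2)).
Proof.
have [D D0 h] := kernel_decay2.
have i := @integrable_scaler _ _ _ mu _ _ (measurable_itv `[0, +oo[) integrable_inv_sqr (D ^+ 2).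
apply: le_integrable i => //.
  apply/measurable_EFinP; apply: subspace_continuous_measurable_fun => //.
  apply: cont_within => t; rewrite /= in_itv/= andbT => t0.
  by apply: (@cvg_comp _ _ _ kap (fun y => y ^+ 2)); [exact: cont_kap|exact: exprn_continuous].
move=> t; rewrite /= in_itv/= andbT => t0; rewrite lee_fin.
have p0 : 0 < 1 + t by rewrite ltr_pwDl.
have [hk _ _ _] := h _ t0.
rewrite !ger0_norm ?sqr_ge0//; last by rewrite mulr_ge0 ?invr_ge0 ?sqr_ge0.
rewrite -exprVn -exprMn !expr2.
have k1 : kap t <= D / (1 + t).
  apply: le_trans hk _; rewrite ler_wpM2l ?(ltW D0)// lef_pV2 ?posrE ?exprn_gt0//.
  by rewrite -[leLHS]expr1 ler_weXn2l// lerDl.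
by have kt := ltW (kap_pos t0); apply: ler_pM.
Qed.

Lemma Rintegral_kap_sqr_gt0 : 0 < \int[mu]_(s in `[0, +oo[) (kap s ^+ 2).
Proof.
have i := integrable_kap_sqr.
have i1 : mu.-integrable `[0, 1] (EFin \o (fun t => kap t ^+ 2)).
  by apply: integrableS i => // t; rewrite /= !in_itv/= => /andP[->].
apply: (@lt_le_trans _ _ (\int[mu]_(s in `[0, 1]) (kap 1 ^+ 2))).
  rewrite Rintegral_cst//= lebesgue_measure_itv/= lte_fin ltr01 oppr0 adde0/= mulr1.
  by rewrite exprn_gt0// kap_pos.
apply: (@le_trans _ _ (\int[mu]_(s in `[0, 1]) (kap s ^+ 2))).
  apply: le_Rintegral; first by [].
  - by apply: cont_integrable; apply: cont_within => u _; exact: cvg_cst.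
  - exact: i1.
  move=> u; rewrite /= in_itv/= => /andP[u0 u1]; rewrite !expr2.
  have hk := kap_mono b0 (ge0_gtN1 u0) u1.
  have k1 := ltW (kap_pos (@ler01 R)).
  exact: ler_pM.
rewrite /Rintegral; apply: fine_le.
- exact: integrable_fin_num.
- exact: integrable_fin_num.
apply: ge0_subset_integral => //.
- by move/integrableP : i => [].
- by move=> u _; rewrite lee_fin sqr_ge0.
- by move=> t; rewrite /= !in_itv/= => /andP[->].
Qed.

(** [kap t * bsol t s] is [kap s * (p t + kap t * eta t * Qf s)] with [p t] tending
    to 1/2, and by [Qf_le] the correction is small uniformly in [s]. *)
Lemma cvg_variance :
  kap t ^+ 2 * \int[mu]_(s in `[0, t]) (bsol t s ^+ 2) @[t --> +oo] -->
    (\int[mu]_(s in `[0, +oo[) (kap s ^+ 2)) / 4.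
Proof.
set S := \int[mu]_(s in `[0, +oo[) _.
pose p t := 1 - kap t * eta t * Qf t.
have pl : p t @[t --> +oo] --> (2^-1 : R).
  rewrite (_ : 2^-1 = 1 - 2^-1); last by lra.
  by apply: cvgB; [exact: cvg_cst|exact: cvg_Qf].
have [D D0 hD] := kernel_decay2.
pose c t := p t ^+ 2 * \int[mu]_(s in `[0, t]) (kap s ^+ 2).
have cl : c t @[t --> +oo] --> S / 4.
  rewrite (_ : S / 4 = 2^-1 ^+ 2 * S); last by field.
  apply: cvgM; last exact: cvg_Rintegral_itv0y integrable_kap_sqr.
  by apply: (@cvg_comp _ _ _ p (fun y => y ^+ 2)); [exact: pl|exact: exprn_continuous].
have e0l : 3 * D * (1 + t)^-1 @[t --> +oo] --> (0 : R).
  rewrite -[X in _ --> X](mulr0 (3 * D)); apply: cvgM; first exact: cvg_cst.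
  apply/gtr0_cvgV0; last exact: cvg_addrl.
  by near=> t; have : 0 <= t by []; lra.
have dl : c t + 3 * D * (1 + t)^-1 * D @[t --> +oo] --> S / 4.
  rewrite -[X in _ --> X]addr0 -(mul0r D); apply: cvgD => //.
  by apply: cvgM => //; exact: cvg_cst.
apply: squeeze_cvgr cl dl; near=> t.
have t0 : 0 <= t by [].
have p0 : 0 <= p t by near: t; exact: cvgr_ge pl _ _.
have kt := kap_pos t0; have et := eta_pos t0.
have ke : 0 < kap t * eta t by exact: mulr_gt0.
have p1 : p t <= 1.
  by rewrite /p gerBl; exact: mulr_ge0 (ltW ke) (Qf_ge0 b t).
have cs : {within `[0, t], continuous (fun s => kap s ^+ 2)}.
  apply: cont_within => s; rewrite /= in_itv/= => /andP[s0 _].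
  by apply: (@cvg_comp _ _ _ kap (fun y => y ^+ 2)); [exact: cont_kap|exact: exprn_continuous].
have ik := cont_integrable cs.
have cb : {within `[0, t], continuous (fun s => bsol t s ^+ 2)}.
  apply: cont_within => s; rewrite /= in_itv/= => /andP[s0 _].
  apply: (@cvg_comp _ _ _ (bsol t) (fun y => y ^+ 2)); last exact: exprn_continuous.
  exact: deriv_cont (deriv_bsol t0 s0).
have ib := cont_integrable cb.
have E s : kap t ^+ 2 * bsol t s ^+ 2 = kap s ^+ 2 * (p t + kap t * eta t * Qf s) ^+ 2.
  by rewrite /bsol /p; field; exact: lt0r_neq0.
have e1 : kap t ^+ 2 * \int[mu]_(s in `[0, t]) (bsol t s ^+ 2) =
  \int[mu]_(s in `[0, t]) (kap t ^+ 2 * bsol t s ^+ 2) by rewrite RintegralZl.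
have e2 : c t = \int[mu]_(s in `[0, t]) (p t ^+ 2 * kap s ^+ 2).
  by rewrite /c RintegralZl.
rewrite e1 e2.
apply/andP; split.
  apply: le_Rintegral; [by []|exact: integrable_scaler|exact: integrable_scaler|].
  move=> s _; rewrite E [leLHS]mulrC ler_wpM2l ?sqr_ge0//.
  have := mulr_ge0 (ltW ke) (Qf_ge0 b s).
  move: (_ * Qf s) (p t) p0 => q r r0 q0; nra.
have h3 : \int[mu]_(s in `[0, t]) (3 * D * (1 + t) ^- 2 * D) <= 3 * D * (1 + t)^-1 * D.
  rewrite Rintegral_cst//= lebesgue_measure_itv/= lte_fin.
  have {}t0 : 0 < t by []; rewrite t0 -EFinB/= subr0.
  have p2 : 0 < 1 + t by rewrite addr_gt0.
  have -> : 3 * D * (1 + t)^-1 * D = 3 * D * (1 + t) ^- 2 * D * (1 + t).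
    by field; exact: lt0r_neq0.
  by rewrite ler_wpM2l ?lerDr// !mulr_ge0 ?(ltW D0)// invr_ge0 sqr_ge0.
apply: (@le_trans _ _ (\int[mu]_(s in `[0, t]) (p t ^+ 2 * kap s ^+ 2)
   + \int[mu]_(s in `[0, t]) (3 * D * (1 + t) ^- 2 * D))); last by rewrite lerD2l.
have ic : mu.-integrable `[0, t] (EFin \o (fun=> 3 * D * (1 + t) ^- 2 * D)).
  by apply: cont_integrable; apply: cont_within => u _; exact: cvg_cst.
rewrite -RintegralD//; last exact: integrable_scaler.
apply: le_Rintegral; [by []|exact: integrable_scaler|by apply: integrable_addr => //; exact: integrable_scaler|].
move=> s; rewrite /= in_itv/= => /andP[s0 st]; rewrite E.
have Qs := Qf_ge0 b s; have Q2 := Qf_le b0 s0.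
have [Qst _] := Qf_increment b0 s0 st.
have [_ _ he hk] := hD _ t0.
have p2 : 0 < 1 + t by rewrite ltr_pwDl.
have ks := kap_pos s0.
have keQ : kap t * eta t * Qf s <= 1.
  apply: (@le_trans _ _ (kap t * eta t * Qf t)).
    by rewrite ler_wpM2l ?(ltW ke)// -subr_ge0.
  by move: p0; rewrite /p subr_ge0.
have h4 : kap t * eta t * (kap s ^+ 2 * Qf s) <= D * (1 + t) ^- 2 * D.
  apply: (@le_trans _ _ (D * eta t * (1 + t))).
    apply: ler_pM; [exact: ltW|by rewrite mulr_ge0// sqr_ge0| |].
      by rewrite ler_wpM2r ?(ltW et).
    by apply: le_trans Q2 _; rewrite addrC lerD2l.
  rewrite -mulrA mulrC ler_wpM2r ?(ltW D0)//.
  apply: le_trans he; rewrite ler_wpM2l ?(ltW et)//.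
  by rewrite expr2 ler_peMr ?(ltW p2)// lerDl.
apply: (@le_trans _ _ (p t ^+ 2 * kap s ^+ 2 + 3 * (kap t * eta t * (kap s ^+ 2 * Qf s)))).
  have := mulr_ge0 (ltW ke) Qs; move: keQ.
  have -> : kap t * eta t * (kap s ^+ 2 * Qf s) = kap s ^+ 2 * (kap t * eta t * Qf s) by ring.
  have := sqr_ge0 (kap s); move: (kap s ^+ 2) (kap t * eta t * Qf s) (p t) p0 p1.
  move=> k q r r0 r1 k0 q1 q0.
  have -> : k * (r + q) ^+ 2 = r ^+ 2 * k + k * (q * (2 * r + q)) by ring.
  rewrite lerD2l [3 * _]mulrC -mulrA ler_wpM2l// ler_wpM2l//; lra.
rewrite lerD2l; have h30 : 0 <= 3 :> R by [].
by apply: le_trans (ler_wpM2l h30 h4) _; rewrite !mulrA.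
Unshelve. all: by end_near. Qed.

Lemma cvg_kap_path (beta : R -> R) (c : R) :
  (forall t, 0 <= t -> `|beta t| <= c * (1 + t) ^+ 2) ->
  kap t * beta t @[t --> +oo] --> (0 : R).
Proof.
move=> hb; have [D D0 hD] := kernel_decay2.
have c0 : 0 <= c.
  by have := hb 0 (lexx _); rewrite addr0 expr1n mulr1; exact: le_trans.
have h : c * D * (1 + t)^-1 @[t --> +oo] --> (0 : R).
  rewrite -[X in _ --> X](mulr0 (c * D)); apply: cvgM; first exact: cvg_cst.
  apply/gtr0_cvgV0; last exact: cvg_addrl.
  by near=> t; have : 0 <= t by []; lra.
apply: squeeze_near0 h; near=> t.
have t0 : 0 <= t by [].
have p0 : 0 < 1 + t by rewrite ltr_pwDl.
have [_ hk _ _] := hD _ t0; have kt := kap_pos t0.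
rewrite normrM (gtr0_norm kt).
apply: (@le_trans _ _ (kap t * (c * (1 + t) ^+ 2))).
  by rewrite ler_wpM2l ?(ltW kt) ?hb.
rewrite mulrCA -[leRHS]mulrA ler_wpM2l//; apply: le_trans hk _.
rewrite ler_wpM2l ?(ltW D0)// lef_pV2 ?posrE ?exprn_gt0//.
by rewrite -[leLHS]expr1 ler_weXn2l// lerDl.
Unshelve. all: by end_near. Qed.

(** The decay of [eta] makes [eta * beta] integrable, and the boundary term
    vanishes by [cvg_kap_path]. *)
Lemma cvg_noise (beta : R -> R) (c : R) :
  {within `[0, +oo[, continuous beta} ->
  (forall t, 0 <= t -> `|beta t| <= c * (1 + t) ^+ 2) ->
  kap t * beta t - \int[mu]_(s in `[0, t]) (- eta s * beta s) @[t --> +oo] -->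
    \int[mu]_(s in `[0, +oo[) (eta s * beta s).
Proof.
move=> cb hb; have [D D0 hD] := kernel_decay2.
have c0 : 0 <= c.
  by have := hb 0 (lexx _); rewrite addr0 expr1n mulr1; exact: le_trans.
have i : mu.-integrable `[0, +oo[ (EFin \o (fun s => eta s * beta s)).
  have j := @integrable_scaler _ _ _ mu _ _ (measurable_itv `[0, +oo[) integrable_inv_sqr (c * D).
  apply: le_integrable j => //.
    apply/measurable_EFinP; apply: measurable_funM;
      apply: subspace_continuous_measurable_fun => //.
    by apply: cont_within => t; rewrite /= in_itv/= andbT => t0; exact: cont_eta.
  move=> t; rewrite /= in_itv/= andbT => t0; rewrite lee_fin.
  have [_ _ he _] := hD _ t0; have et := eta_pos t0.
  have r0 : 0 <= c * D / (1 + t) ^+ 2.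
    by rewrite mulr_ge0 ?invr_ge0 ?sqr_ge0// mulr_ge0// ltW.
  rewrite normrM (gtr0_norm et) (ger0_norm r0).
  apply: (@le_trans _ _ (eta t * (c * (1 + t) ^+ 2))).
    by rewrite ler_wpM2l ?(ltW et) ?hb.
  by rewrite mulrCA -[leRHS]mulrA ler_wpM2l.
have h1 := cvg_Rintegral_itv0y i.
have h2 := cvg_kap_path hb.
have h3 : kap t * beta t + \int[mu]_(s in `[0, t]) (eta s * beta s) @[t --> +oo] -->
    0 + \int[mu]_(s in `[0, +oo[) (eta s * beta s) by apply: cvgD.
rewrite add0r in h3; apply: cvg_trans h3; apply: near_eq_cvg; near=> t.
have ip : mu.-integrable `[0, t] (EFin \o (fun s => eta s * beta s)).
  by apply: integrableS i => // s; rewrite /= !in_itv/= => /andP[->].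
have -> : \int[mu]_(s in `[0, t]) (- eta s * beta s) =
    -1 * \int[mu]_(s in `[0, t]) (eta s * beta s).
  by rewrite -RintegralZl//; apply: eq_Rintegral => s _; rewrite mulN1r mulNr.
by rewrite mulN1r opprK.
Unshelve. all: by end_near. Qed.

End backward.

(** * Gaussian variables *)

Lemma cvg_integral_bounded d (T : measurableType d) (R : realType) (mu : probability T R)
    (f_ : nat -> T -> R) (f : T -> R) :
  (forall n, measurable_fun setT (f_ n)) -> measurable_fun setT f ->
  (forall n w, `|f_ n w| <= 1) ->
  {ae mu, forall w, f_ n w @[n --> \oo] --> f w} ->
  (\int[mu]_w (f_ n w)%:E)%E @[n --> \oo] --> (\int[mu]_w (f w)%:E)%E.
Proof.
move=> mf_ mf b1 h.
have m1 n : measurable_fun setT (fun w => (f_ n w)%:E) by apply/measurable_EFinP.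
have m2 : measurable_fun setT (EFin \o f) by apply/measurable_EFinP.
have h1 : {ae mu, forall w, setT w -> (f_ n w)%:E @[n --> \oo] --> (f w)%:E}.
  by apply: filterS h => w hw _; apply: cvg_EFin; [exact: nearW|exact: hw].
have i1 : mu.-integrable setT (cst 1%E : T -> \bar R).
  exact: finite_measure_integrable_cst.
have d1 : {ae mu, forall w n, setT w -> (`|(f_ n w)%:E| <= cst 1 w)%E}.
  by apply/aeW => w n _; rewrite lee_fin.
by have [] := dominated_convergence measurableT m1 m2 h1 i1 d1.
Qed.

Section laws.
Context d (T : measurableType d) (R : realType) (P : probability T R).
Implicit Types (Y Z : T -> R) (x : R).

(** The rays generate the Borel sets and are stable under intersection. *)
Lemma law_unique Y (nu : {measure set (measurableTypeR R) -> \bar R}) :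
  measurable_fun setT Y ->
  (forall x, P (Y @^-1` `]-oo, x[) = nu `]-oo, x[%classic) ->
  forall U : set R, measurable U -> P (Y @^-1` U) = nu U.
Proof.
move=> mY h U mU.
pose Y' : {mfun T >-> measurableTypeR R} :=
  HB.pack Y (isMeasurableFun.Build _ _ T (measurableTypeR R) Y mY).
rewrite -[LHS]/(distribution P Y' U).
have mG : @measurable _ (measurableTypeR R) = <<s @RGenInftyO.G R >>.
  exact: RGenInftyO.measurableE.
have IG : setI_closed (@RGenInftyO.G R).
  move=> A B [a ->] [b ->]; exists (Num.min a b).
  apply/seteqP; split => y /=; rewrite !in_itv/= lt_min.
    by move=> [-> ->].
  by move=> /andP[].
have gG (i : nat) : @RGenInftyO.G R `]-oo, i%:R[%classic by exists i%:R.
have gT : \bigcup_(k : nat) `]-oo, (k%:R : R)[%classic = setT.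
  apply/seteqP; split=> // x _; exists (Num.truncn x).+1 => //=.
  by rewrite in_itv/= truncnS_gt.
have e A : @RGenInftyO.G R A -> distribution P Y' A = nu A.
  by move=> [a ->]; exact: h.
have fin (k : nat) : (distribution P Y' `]-oo, (k%:R : R)[%classic < +oo)%E.
  by rewrite (le_lt_trans (probability_le1 _ _)) ?ltry.
exact: (@measure_unique _ R (measurableTypeR R) _ _ mG IG gG gT (distribution P Y') nu e fin U mU).
Qed.

Lemma ge0_integral_law Y (nu : {measure set (measurableTypeR R) -> \bar R})
    (f : R -> \bar R) :
  measurable_fun setT Y -> (forall U, measurable U -> P (Y @^-1` U) = nu U) ->
  measurable_fun setT f -> (forall y, 0 <= f y)%E ->
  (\int[P]_w f (Y w) = \int[nu]_y f y)%E.
Proof.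
move=> mY law mf f0.
pose Y' : {mfun T >-> measurableTypeR R} :=
  HB.pack Y (isMeasurableFun.Build _ _ T (measurableTypeR R) Y mY).
rewrite -[LHS](@ge0_integral_distribution _ _ _ _ _ P Y' f)//.
by apply: eq_measure_integral => A mA _; exact: law.
Qed.

(** Continuous approximations of the indicator of the ray below [x]. *)
Let ramp x (n : nat) (y : R) : R := Num.max 0 (Num.min 1 (n%:R * (x - y))).

Let ramp01 x n y : 0 <= ramp x n y <= 1.
Proof. by rewrite /ramp le_max lexx/= ge_max ler01/= ge_min lexx. Qed.

Let cont_ramp x n : continuous (ramp x n).
Proof.
move=> y; apply: (@continuous_max _ _ (fun=> 0) (fun y => Num.min 1 (n%:R * (x - y)))).
  exact: cvg_cst.
apply: (@continuous_min _ _ (fun=> 1) (fun y => n%:R * (x - y))); first exact: cvg_cst.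
apply: cvgM; first exact: cvg_cst.
by apply: cvgB; [exact: cvg_cst|exact: cvg_id].
Qed.

Let cvg_ramp x y : ramp x n y @[n --> \oo] --> (\1_`]-oo, x[ y : R).
Proof.
rewrite indicE; have [yx|xy] := ltP y x.
  have -> : (y \in `]-oo, x[%classic) = true by apply/mem_set; rewrite /= in_itv.
  apply: cvg_near_cst; near=> n.
  have h : (x - y)^-1 <= n%:R by near: n; exact: nbhs_infty_ger.
  rewrite /ramp min_l ?max_r//.
  by rewrite -ler_pdivrMr ?subr_gt0// mul1r.
have -> : (y \in `]-oo, x[%classic) = false.
  by apply: memNset; rewrite /= in_itv/= ltNge xy.
apply: cvg_near_cst; near=> n.
have h : n%:R * (x - y) <= 0 by rewrite mulr_ge0_le0// subr_le0.
by rewrite /ramp min_r ?max_l// (le_trans h).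
Unshelve. all: by end_near. Qed.

(** The laws agree on bounded continuous test functions, through which almost
    sure limits pass, hence on rays. *)
Lemma law_limit (Y_ : nat -> T -> R) Y (nu : probability (measurableTypeR R) R) :
  (forall n, measurable_fun setT (Y_ n)) -> measurable_fun setT Y ->
  (forall n U, measurable U -> P (Y_ n @^-1` U) = nu U) ->
  {ae P, forall w, Y_ n w @[n --> \oo] --> Y w} ->
  forall U, measurable U -> P (Y @^-1` U) = nu U.
Proof.
move=> mY_ mY law ae.
apply: law_unique => // x.
have mr k : measurable_fun setT (ramp x k) by exact: continuous_measurable_fun.
have b1 k y : `|ramp x k y| <= 1.
  by have /andP[r0 r1] := ramp01 x k y; rewrite ger0_norm.
have E k : (\int[P]_w (ramp x k (Y w))%:E = \int[nu]_y (ramp x k y)%:E)%E.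
  have h : (\int[P]_w (ramp x k (Y_ n w))%:E)%E @[n --> \oo] --> (\int[P]_w (ramp x k (Y w))%:E)%E.
    apply: cvg_integral_bounded.
    - by move=> n; exact: measurableT_comp.
    - exact: measurableT_comp.
    - by move=> n w; exact: b1.
    - apply: filterS ae => w hw; apply: (@cvg_comp _ _ _ (fun n => Y_ n w) (ramp x k)); first exact: hw.
      exact: cont_ramp.
  rewrite (_ : (fun n => _) = (fun=> \int[nu]_y (ramp x k y)%:E)%E) in h; last first.
    apply/funext => n; apply: (ge0_integral_law (mY_ n) (law n)) => //.
      by apply/measurable_EFinP; exact: mr.
    by move=> y; rewrite lee_fin; have /andP[] := ramp01 x k y.
  exact: (cvg_unique _ h (cvg_cst _)).
have mI : measurable (`]-oo, x[%classic : set (measurableTypeR R)) by [].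
have mYI : measurable (Y @^-1` `]-oo, x[) by rewrite -[_ @^-1` _]setTI; exact: mY.
have h1 : (\int[P]_w (ramp x k (Y w))%:E)%E @[k --> \oo] --> (\int[P]_w (\1_`]-oo, x[ (Y w))%:E)%E.
  apply: cvg_integral_bounded.
  - by move=> n; exact: measurableT_comp.
  - by apply: measurableT_comp => //; exact: measurable_indic.
  - by move=> n w; exact: b1.
  - by apply/aeW => w; exact: cvg_ramp.
have h2 : (\int[nu]_y (ramp x k y)%:E)%E @[k --> \oo] --> (\int[nu]_y (\1_`]-oo, x[ y)%:E)%E.
  apply: cvg_integral_bounded.
  - exact: mr.
  - exact: measurable_indic.
  - by move=> n w; exact: b1.
  - by apply/aeW => w; exact: cvg_ramp.
rewrite (_ : (fun k => _) = (fun k => (\int[P]_w (ramp x k (Y w))%:E)%E)) in h2; last first.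
  by apply/funext => k; rewrite E.
have := cvg_unique (@ereal_hausdorff R) h1 h2.
rewrite (integral_indic _ _ mI)// setIT => <-.
rewrite (eq_integral (fun w => (\1_(Y @^-1` `]-oo, x[) w)%:E)); last first.
  by move=> w _; rewrite !indicE; congr (_%:E); congr (_%:R).
by rewrite integral_indic// setIT.
Qed.

End laws.

Section density.
Context d (T : measurableType d) (R : realType).
Variables (mu nu : {measure set T -> \bar R}) (p : T -> R).
Hypotheses (mp : measurable_fun setT p) (p0 : forall x, 0 <= p x)
  (nuE : forall A, measurable A -> nu A = (\int[mu]_(x in A) (p x)%:E)%E).

Import HBNNSimple.

(** Integration against a measure with a density, by monotone approximation. *)
Lemma ge0_integral_density (f : T -> \bar R) :
  measurable_fun setT f -> (forall x, 0 <= f x)%E ->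
  (\int[nu]_x f x = \int[mu]_x (f x * (p x)%:E))%E.
Proof.
move=> mf f0.
have mpE : measurable_fun setT (EFin \o p) by exact/measurable_EFinP.
have pE0 x : (0 <= (p x)%:E)%E by rewrite lee_fin.
pose f_ := nnsfun_approx measurableT mf.
have cvf x : (f_ n x)%:E @[n --> \oo] --> f x by exact: cvg_nnsfun_approx.
transitivity (limn (fun n => \int[nu]_x (f_ n x)%:E)%E).
  rewrite -monotone_convergence//.
  - by apply: eq_integral => y _; apply/esym/cvg_lim.
  - by move=> n; exact/measurable_EFinP/measurable_funP.
  - by move=> n y _; rewrite lee_fin.
  - by move=> y _ k n kn; rewrite lee_fin; exact/lefP/nd_nnsfun_approx.
rewrite [X in limn X](_ : _ = (fun n => \int[mu]_x ((f_ n x)%:E * (p x)%:E))%E).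
  rewrite -monotone_convergence//.
  - apply: eq_integral => x _; apply/cvg_lim => //.
    by apply: cvgeZr => //; exact: cvf.
  - by move=> n; apply: emeasurable_funM => //; exact/measurable_EFinP/measurable_funP.
  - by move=> n x _; rewrite mule_ge0// lee_fin.
  - by move=> x _ k n kn; rewrite lee_wpmul2r// lee_fin; exact/lefP/nd_nnsfun_approx.
apply/funext => n.
under eq_integral do rewrite fimfunE -fsumEFin//.
rewrite ge0_integral_fsum//; last 2 first.
- by move=> y; exact/measurable_EFinP/measurable_funM.
- by move=> y x _; rewrite nnfun_muleindic_ge0.
have e x : ((f_ n x)%:E * (p x)%:E =
    \sum_(k \in range (f_ n)) ((k * \1_(f_ n @^-1` [set k]) x)%:E * (p x)%:E))%E.
  rewrite {1}fimfunE -fsumEFin// ge0_mule_fsuml// => k.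
  exact: nnfun_muleindic_ge0.
under [RHS]eq_integral do rewrite e.
rewrite ge0_integral_fsum//; last 2 first.
- by move=> y; apply: emeasurable_funM => //; exact/measurable_EFinP/measurable_funM.
- by move=> y x _; rewrite mule_ge0// nnfun_muleindic_ge0.
apply: eq_fsbigr => r _; rewrite integralZl_indic_nnsfun// integral_indic//= setIT.
rewrite nuE// integral_mkcond.
have [r0|r0] := ltP r 0.
  rewrite preimage_nnfun0//.
  rewrite (eq_integral (cst 0%E)) ?integral0 ?mule0; last first.
    by move=> x _; rewrite patchE memNset.
  rewrite [RHS](eq_integral (cst 0%E)) ?integral0// => x _.
  by rewrite indicE memNset// mulr0 mul0e.
rewrite -ge0_integralZl//=.
- apply: eq_integral => x _; rewrite patchE indicE; case: ifPn => _.
    by rewrite mulr1.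
  by rewrite mule0 mulr0 mul0e.
- by apply/(measurable_restrictT _ _).1 => //; exact: measurable_funTS.
- by move=> x _; rewrite patchE; case: ifPn.
Qed.

End density.

Section normal.
Context {R : realType}.
Notation mu := (@lebesgue_measure R).
Implicit Types (m s a c x y : R).

Lemma normal_pdf_affine m s a c x : 0 < s -> 0 < c ->
  normal_pdf m s ((x - a) / c) * c^-1 = normal_pdf (a + c * m) (c * s) x.
Proof.
move=> s0 c0.
rewrite !normal_pdfE; last 2 first.
- by rewrite gt_eqF// mulr_gt0.
- by rewrite gt_eqF.
rewrite /normal_peak /normal_fun.
have -> : - ((x - a) / c - m) ^+ 2 / (s ^+ 2 *+ 2) =
          - (x - (a + c * m)) ^+ 2 / ((c * s) ^+ 2 *+ 2).
  by field; rewrite (gt_eqF s0) (gt_eqF c0).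
rewrite mulrAC; congr (_ * _).
have -> : (c * s) ^+ 2 * pi *+ 2 = c ^+ 2 * (s ^+ 2 * pi *+ 2).
  by ring.
by rewrite sqrtrM ?sqr_ge0// sqrtr_sqr gtr0_norm// invfM mulrC.
Qed.

(** The normal law has a density, hence no atoms. *)
Lemma normal_prob_ray m s x (b1 b2 : bool) :
  normal_prob m s [set` Interval -oo%O (BSide b1 x)] =
  normal_prob m s [set` Interval -oo%O (BSide b2 x)].
Proof.
have h : normal_prob m s `]-oo, x[ = normal_prob m s `]-oo, x].
  rewrite /normal_prob integral_itv_bndo_bndc//.
  by apply/measurable_EFinP/measurable_funTS; exact: measurable_normal_pdf.
by case: b1; case: b2.
Qed.

Lemma normal_prob_affine m s a c (U : set R) : 0 < s -> 0 < c -> measurable U ->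
  normal_prob m s ((fun z => a + c * z) @^-1` U) = normal_prob (a + c * m) (c * s) U.
Proof.
move=> s0 c0 mU; have cs0 : 0 < c * s by rewrite mulr_gt0.
have mf : measurable_fun setT (fun z : measurableTypeR R => (a + c * z : R)).
  by apply: measurable_funD => //; exact: measurable_funM.
apply: (@law_unique _ (measurableTypeR R) _ (normal_prob m s)
  (fun z => a + c * z) (normal_prob (a + c * m) (c * s))) => // x.
have -> : (fun z => a + c * z) @^-1` `]-oo, x[ = `]-oo, (x - a) / c[%classic.
  apply/seteqP; split=> z /=; rewrite !in_itv/=; last first.
    by rewrite ltr_pdivlMr// mulrC; lra.
  by rewrite ltr_pdivlMr// [z * c]mulrC; lra.
transitivity (normal_prob m s `]-oo, (x - a) / c]%classic).
  exact: (@normal_prob_ray m s _ true false).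
transitivity (normal_prob (a + c * m) (c * s) `]-oo, x]%classic); last first.
  exact: (@normal_prob_ray _ _ _ false true).
pose F x : R := (x - a) / c.
have dF y : is_derive y 1 F c^-1.
  by have := derivM (derivB (deriv_id y) (deriv_cst a y)) (deriv_cst c^-1 y);
    rewrite subr0 mul1r mulr0 addr0.
have F'E : (F^`())%classic = cst c^-1.
  by apply/funext => y; exact: deriv_derive1 (dF y).
have Fy : F y @[y --> -oo] --> -oo.
  apply: gt0_cvgMlNy; first by rewrite invr_gt0.
  exact: cvg_addrr_Ny.
have c' : 0 < c^-1 by rewrite invr_gt0.
rewrite /normal_prob -/(F x) (@increasing_ge0_integration_by_substitutionNy _ F)//.
- apply: eq_integral => y _; rewrite F'E/= -normal_pdf_affine//.
- by move=> y z _ _ yz; rewrite ltr_pM2r// ltrD2r.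
- by move=> y _; rewrite F'E; exact: cst_continuous.
- by rewrite F'E; exact: is_cvg_cst.
- by rewrite F'E; exact: cvg_cst.
- split; first by move=> y _; exact: deriv_derivable (dF y).
  by apply: cvg_at_left_filter; exact: deriv_cont (dF x).
- by apply: cont_within => y _; apply: continuous_normal_pdf; rewrite gt_eqF.
- by move=> y _; exact: normal_pdf_ge0.
Qed.

Lemma normal_prob_opp s (U : set R) : 0 < s -> measurable U ->
  normal_prob 0 s (-%R @^-1` U) = normal_prob 0 s U.
Proof.
move=> s0 mU.
apply: (@law_unique _ (measurableTypeR R) _ (normal_prob 0 s) -%R (normal_prob 0 s)) => // x.
have sym y : normal_pdf 0 s (- y) = normal_pdf 0 s y.
  by rewrite !normal_pdfE ?gt_eqF// /normal_fun !subr0 sqrrN.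
have -> : -%R @^-1` `]-oo, x[ = `]- x, +oo[%classic.
  by apply/seteqP; split=> y /=; rewrite !in_itv/= andbT ltrNl.
transitivity (normal_prob 0 s `]-oo, x]%classic); last first.
  exact: (@normal_prob_ray _ _ _ false true).
have e := @ge0_integration_by_substitutionNy R (normal_pdf 0 s) (- x).
rewrite opprK in e; rewrite /normal_prob e; last 2 first.
- by apply: cont_within => y _; apply: continuous_normal_pdf; rewrite gt_eqF.
- by move=> y _; exact: normal_pdf_ge0.
transitivity (\int[mu]_(y in `[(- x)%R, +oo[) (normal_pdf 0 s y)%:E)%E.
  rewrite -integral_itv_obnd_cbnd//.
  by apply/measurable_EFinP/measurable_funTS; exact: measurable_normal_pdf.
by apply: eq_integral => y _; rewrite /= sym.
Qed.

Let phi : R -> R := normal_pdf 0 1.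

Let phiE x : phi x = normal_peak 1 * expR (- (x ^+ 2 / 2)).
Proof.
rewrite /phi normal_pdfE ?oner_neq0// /normal_fun subr0 expr1n mulNr.
by rewrite -[1 *+ 2]/2%:R.
Qed.

Let deriv_phi x : is_derive x 1 phi (- x * phi x).
Proof.
have -> : phi = fun x => normal_peak 1 * expR (- (2^-1 * x ^+ 2)).
  by apply/funext => y; rewrite phiE [y ^+ 2 / 2]mulrC.
have h : is_derive x 1 (fun x : R => - (2^-1 * (x * x))) (- (2^-1 * (1 * x + x * 1))).
  exact: (derivN (derivZ 2^-1 (derivM (deriv_id x) (deriv_id x)))).
apply: (deriv_eq (derivZ (normal_peak 1) (deriv_exp h))).
by rewrite expr2; field.
Qed.

Let phi_decay x : 0 <= x -> x ^+ 2 * phi x <= 4 * normal_peak 1 * expR 1 * expR (- 1 * x)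
  /\ phi x <= normal_peak 1 * expR 1 * expR (- 1 * x).
Proof.
move=> x0; have c0 := @normal_peak_ge0 R 1.
have e1 : expR 1 * expR (- 1 * x) = expR (1 - x) by rewrite -expRD mulN1r.
have h1 : expR (- (x ^+ 2 / 4)) <= expR (1 - x) by rewrite ler_expR; have := sqr_ge0 (x / 2 - 1); nra.
have h2 : expR (- (x ^+ 2 / 2)) = expR (- (x ^+ 2 / 4)) * expR (- (x ^+ 2 / 4)).
  by rewrite -expRD; congr expR; field.
have e0 := expR_gt0 (- (x ^+ 2 / 4)).
have h3 : x ^+ 2 * expR (- (x ^+ 2 / 4)) <= 4.
  rewrite expRN ler_pdivrMr ?expR_gt0//.
  by have := expR_ge1Dx (x ^+ 2 / 4); lra.
have h4 : expR (- (x ^+ 2 / 4)) <= 1.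
  by rewrite -expR0 ler_expR oppr_le0 divr_ge0 ?sqr_ge0.
rewrite phiE h2; move: h3 h4 h1 e0; move: (expR (- (x ^+ 2 / 4))) => E h3 h4 h1 e0.
rewrite -[4 * _ * _]mulrA -[4 * _ * _]mulrA -[normal_peak 1 * _ * _]mulrA e1; split.
  rewrite mulrCA [4 * _]mulrCA ler_wpM2l// mulrA.
  by apply: ler_pM => //; [rewrite mulr_ge0 ?sqr_ge0 ?(ltW e0)|exact: ltW].
rewrite ler_wpM2l//; apply: le_trans h1.
by rewrite ler_piMr ?(ltW e0).
Qed.

(** With [phi] the standard normal density, [- x * phi x] vanishes at 0 and at
    infinity and is a primitive of [x ^ 2 * phi x - phi x]. *)
Lemma integral_sqr_normal_pdf :
  (\int[mu]_x (x ^+ 2 * normal_pdf 0 1 x)%:E)%E = 1%E.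
Proof.
have cphi : continuous phi by move=> x; exact: deriv_cont (deriv_phi x).
have csq : continuous (fun x => x ^+ 2 * phi x).
  by move=> x; apply: cvgM; [exact: exprn_continuous|exact: cphi].
have c0 := @normal_peak_ge0 R 1.
have phi0 x : 0 <= phi x by exact: normal_pdf_ge0.
have i1 : mu.-integrable `[0, +oo[ (EFin \o phi).
  apply: (@expdecay_integrable _ _ (normal_peak 1 * expR 1) 1) => // x x0.
  by rewrite ger0_norm//; have [] := phi_decay x0.
have i2 : mu.-integrable `[0, +oo[ (EFin \o (fun x => x ^+ 2 * phi x)).
  apply: (@expdecay_integrable _ _ (4 * normal_peak 1 * expR 1) 1) => // x x0.
  by rewrite ger0_norm ?mulr_ge0 ?sqr_ge0//; have [] := phi_decay x0.
have lim : - (x * phi x) @[x --> +oo] --> (0 : R).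
  have h := @cvg_expdecay R (5 * normal_peak 1 * expR 1) 1 ltr01.
  apply: squeeze_near0 h; near=> x; have x0 : 0 <= x by [].
  have [d1 d2] := phi_decay x0; rewrite normrN ger0_norm ?mulr_ge0//.
  apply: (@le_trans _ _ (x ^+ 2 * phi x + phi x)).
    by rewrite -[X in _ + X]mul1r -mulrDl ler_wpM2r//; nra.
  apply: le_trans (lerD d1 d2) _.
  by rewrite le_eqVlt; apply/orP; left; apply/eqP; ring.
have dF x : is_derive x 1 (fun x => - (x * phi x)) (x ^+ 2 * phi x - phi x).
  apply: (deriv_eq (derivN (derivM (deriv_id x) (deriv_phi x)))).
  by ring.
have cf x : {for x, continuous (fun x => x ^+ 2 * phi x - phi x)}.
  by apply: cvgB; [exact: csq|exact: cphi].
have i3 : mu.-integrable `[0, +oo[ (EFin \o (fun x => x ^+ 2 * phi x - phi x)).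
  by apply: integrable_subr.
have := FTC2y (fun x _ => dF x) (fun x _ => cf x) i3 lim.
rewrite mul0r oppr0 subr0 RintegralB// => /eqP; rewrite subr_eq0 => /eqP e.
have seq0 : [set x : R | 0 <= x] = `[0, +oo[%classic.
  by apply/seteqP; split=> x /=; rewrite in_itv/= andbT.
have sym x : phi (- x) = phi x by rewrite !phiE sqrrN.
have s1 := @ge0_symfun_integralT R phi phi0 cphi (fun x => esym (sym x)).
have s2 := @ge0_symfun_integralT R (fun x => x ^+ 2 * phi x) _ csq _.
rewrite s2; last 2 first.
- by move=> x; rewrite mulr_ge0// sqr_ge0.
- by move=> x /=; rewrite sqrrN sym.
rewrite -(@integral_normal_pdf R 0 1) -/phi s1 seq0; congr (_ * _)%E.
rewrite -[LHS]fineK; last exact: integrable_fin_num.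
rewrite -[RHS]fineK; last exact: integrable_fin_num.
by congr (_%:E).
Unshelve. all: by end_near. Qed.

(** Completing the square in [y]: the joint density of a sum and one of its terms
    is that of the sum times the conditional density of the term. *)
Lemma normal_pdf_mul v w y z : 0 < v -> 0 < w ->
  normal_pdf 0 (Num.sqrt v) y * normal_pdf y (Num.sqrt w) z =
  normal_pdf 0 (Num.sqrt (v + w)) z *
    normal_pdf (z * v / (v + w)) (Num.sqrt (v * w / (v + w))) y.
Proof.
move=> v0 w0; have vw0 : 0 < v + w by rewrite addr_gt0.
have vwd0 : 0 < v * w / (v + w) by rewrite divr_gt0// mulr_gt0.
rewrite !normal_pdfE; try by rewrite gt_eqF// sqrtr_gt0.
rewrite /normal_peak /normal_fun !sqr_sqrtr ?ltW// subr0.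
rewrite mulrACA [RHS]mulrACA -!expRD; congr (_ * expR _); last first.
  by field; rewrite !gt_eqF// mulr_gt0.
have pi0 := pi_gt0 R.
rewrite -!invfM -!sqrtrM; try by rewrite -mulr_natr !mulr_ge0// ltW.
by congr ((Num.sqrt _)^-1); field; rewrite gt_eqF.
Qed.

End normal.

Section gaussian.
Context d (T : measurableType d) (R : realType) (P : probability T R).
Notation mu := (@lebesgue_measure R).
Implicit Types (Y Z : T -> R) (v c m : R).

(** The variance is positive because [normal_prob 0 0] is not a Dirac mass. *)
Definition gaussian Y v := [/\ 0 < v, measurable_fun setT Y &
  forall U : set R, measurable U -> P (Y @^-1` U) = normal_prob 0 (Num.sqrt v) U].

Lemma gaussian_affine Y v m c (U : set R) : gaussian Y v -> 0 < c -> measurable U ->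
  P ((fun w => m + c * Y w) @^-1` U) = normal_prob m (c * Num.sqrt v) U.
Proof.
move=> [v0 mY law] c0 mU.
have mf : measurable_fun setT (fun z : R => m + c * z).
  apply: continuous_measurable_fun => z; apply: cvgD; first exact: cvg_cst.
  by apply: cvgM; [exact: cvg_cst|exact: cvg_id].
have mV : measurable ((fun z : R => m + c * z) @^-1` U).
  by rewrite -[_ @^-1` _]setTI; exact: mf.
rewrite -[X in normal_prob X](addr0 m) -[X in _ + X](mulr0 c).
rewrite -normal_prob_affine ?sqrtr_gt0//.
exact: law.
Qed.

Lemma gaussian_scale Y v c : gaussian Y v -> 0 < c ->
  gaussian (fun w => c * Y w) (c ^+ 2 * v).
Proof.
move=> g c0; have [v0 mY law] := g; split.
- by rewrite mulr_gt0// exprn_gt0.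
- exact: measurable_funM.
- move=> U mU; have := gaussian_affine 0 g c0 mU.
  rewrite sqrtrM ?sqr_ge0// sqrtr_sqr gtr0_norm// => <-; congr (P _).
  by apply/seteqP; split => w /=; rewrite add0r.
Qed.

Lemma gaussian_sqr Y v : gaussian Y v -> (\int[P]_w (Y w ^+ 2)%:E = v%:E)%E.
Proof.
move=> g; have [v0 mY _] := g.
have s0 : 0 < Num.sqrt v by rewrite sqrtr_gt0.
have s' : 0 < (Num.sqrt v)^-1 by rewrite invr_gt0.
have [_ mZ lawZ] := gaussian_scale g s'.
have e1 : (Num.sqrt v)^-1 ^+ 2 * v = 1.
  by rewrite exprVn sqr_sqrtr ?(ltW v0)// mulVf// gt_eqF.
rewrite e1 sqrtr1 in lawZ.
have msq : measurable_fun setT (fun y : R => (y ^+ 2)%:E).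
  by apply/measurable_EFinP; apply: continuous_measurable_fun; exact: exprn_continuous.
have h := ge0_integral_law mZ lawZ msq (fun y => _).
have {}h : (\int[P]_w (((Num.sqrt v)^-1 * Y w) ^+ 2)%:E = 1)%E.
  rewrite h; last by move=> y; rewrite lee_fin sqr_ge0.
  rewrite (@ge0_integral_density _ _ _ mu (normal_prob 0 1) (normal_pdf 0 1)) //.
  - by rewrite -integral_sqr_normal_pdf.
  - exact: measurable_normal_pdf.
  - exact: normal_pdf_ge0.
  - by move=> y; rewrite lee_fin sqr_ge0.
rewrite -[RHS]mule1 -h -ge0_integralZl//.
- apply: eq_integral => x _; rewrite -EFinM; congr (_%:E).
  by rewrite exprMn mulrA [v * _]mulrC e1 mul1r.
- by apply/measurable_EFinP; exact: measurable_funX.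
- by move=> x _; rewrite lee_fin sqr_ge0.
- by rewrite lee_fin ltW.
Qed.

Lemma gaussian_integrable_sqr Y v : gaussian Y v ->
  P.-integrable setT (EFin \o (fun w => Y w ^+ 2)).
Proof.
move=> g; have [v0 mY _] := g; apply/integrableP; split.
  by apply/measurable_EFinP; exact: measurable_funX.
under eq_integral => w _ do rewrite /= ger0_norm ?sqr_ge0//.
by rewrite (gaussian_sqr g) ltry.
Qed.

Lemma gaussian_integrable Y v : gaussian Y v -> P.-integrable setT (EFin \o Y).
Proof.
move=> g; have [v0 mY _] := g.
have i1 : P.-integrable setT (EFin \o (fun w : T => (1 : R))).
  exact: finite_measure_integrable_cst.
have i := integrable_addr measurableT i1 (gaussian_integrable_sqr g).
apply: le_integrable i => //; first exact/measurable_EFinP.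
move=> w _; rewrite lee_fin [leRHS]ger0_norm; last by rewrite addr_ge0// sqr_ge0.
rewrite -[Y w ^+ 2]real_normK ?num_real//.
by have := sqr_ge0 (`|Y w| - 1); have := normr_ge0 (Y w); nra.
Qed.

(** By symmetry of the law. *)
Lemma gaussian_mean Y v : gaussian Y v -> (\int[P]_w (Y w)%:E = 0)%E.
Proof.
move=> g; have [v0 mY law] := g; have iY := gaussian_integrable g.
have s0 : 0 < Num.sqrt v by rewrite sqrtr_gt0.
have mN : measurable_fun setT (fun w => - Y w) by exact: measurableT_comp.
have lawN (U : set R) : measurable U -> P ((fun w => - Y w) @^-1` U) = normal_prob 0 (Num.sqrt v) U.
  move=> mU; have mV : measurable (-%R @^-1` U).
    have mo : measurable_fun setT (-%R : R -> R).
      by apply: continuous_measurable_fun => y; exact: oppr_continuous.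
    by rewrite -[_ @^-1` _]setTI; exact: mo.
  by rewrite -(normal_prob_opp s0 mU) -law.
have pos (f : R -> R) : measurable_fun setT f -> (forall y, 0 <= f y) ->
    (\int[P]_w (f (Y w))%:E = \int[P]_w (f (- Y w))%:E)%E.
  move=> mf f0; have mfE : measurable_fun setT (EFin \o f) by exact/measurable_EFinP.
  have f0E y : (0 <= (EFin \o f) y)%E by rewrite lee_fin.
  by rewrite [LHS](ge0_integral_law mY law mfE f0E) [RHS](ge0_integral_law mN lawN mfE f0E).
rewrite integralE.
have e1 : (\int[P]_w (EFin \o Y)^\+ w = \int[P]_w (EFin \o Y)^\- w)%E.
  transitivity (\int[P]_w (Num.max (Y w) 0)%:E)%E.
    by apply: eq_integral => w _; rewrite funeposE /= EFin_max.
  rewrite (pos (fun y => Num.max y 0)).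
  - by apply: eq_integral => w _; rewrite funenegE /= EFin_max EFinN.
  - by apply: measurable_maxr.
  - by move=> y; rewrite le_max lexx orbT.
rewrite e1 subee//.
by apply: integrable_neg_fin_num.
Qed.

Lemma limn_einf_gt (u : nat -> \bar R) (c : \bar R) : (c < limn_einf u)%E ->
  \forall n \near \oo, (c < u n)%E.
Proof.
rewrite limn_einf_lim => h.
have := nondecreasing_einfs u => nd.
have cv := ereal_nondecreasing_cvgn nd.
move: h; rewrite (cvg_lim _ cv)// => /ereal_sup_gt[_ [N _ <-] hN].
exists N => // n /= Nn; apply: lt_le_trans hN _.
by apply: ge_ereal_inf; exists (u n) => //=; exists n.
Qed.

(** Once normalised the variables are identically distributed, so [law_limit]
    gives the law of the limit. Convergence in mean square then comes from Fatou's
    lemma for [(Y_n + Y) ^ 2 = 2 Y_n ^ 2 + 2 Y ^ 2 - (Y_n - Y) ^ 2], as all second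
    moments converge. *)
Lemma gaussian_limit (Y_ : nat -> T -> R) (v_ : nat -> R) Y v :
  (forall n, gaussian (Y_ n) (v_ n)) -> measurable_fun setT Y ->
  v_ n @[n --> \oo] --> v -> 0 < v ->
  {ae P, forall w, Y_ n w @[n --> \oo] --> Y w} ->
  gaussian Y v /\
  (\int[P]_w ((Y_ n w - Y w) ^+ 2)%:E)%E @[n --> \oo] --> 0%E.
Proof.
move=> g_ mY vv v0 ae.
have sv : 0 < Num.sqrt v by rewrite sqrtr_gt0.
have svn n : 0 < Num.sqrt (v_ n) by have [h _ _] := g_ n; rewrite sqrtr_gt0.
have svi n : 0 < (Num.sqrt (v_ n))^-1 by rewrite invr_gt0.
pose Z_ n w : R := (Num.sqrt (v_ n))^-1 * Y_ n w.
pose Z w : R := (Num.sqrt v)^-1 * Y w.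
have gZ n : gaussian (Z_ n) 1.
  have := gaussian_scale (g_ n) (svi n).
  by rewrite exprVn sqr_sqrtr ?mulVf ?gt_eqF//; have [/ltW h _ _] := g_ n; have [h' _ _] := g_ n.
have mZ : measurable_fun setT Z by exact: measurable_funM.
have lawZ (U : set R) : measurable U -> P (Z @^-1` U) = normal_prob 0 1 U.
  apply: (@law_limit _ _ _ P Z_ Z (normal_prob 0 1)) => //.
  - by move=> n; have [] := gZ n.
  - by move=> n V mV; have [_ _] := gZ n; rewrite sqrtr1; apply.
  - apply: filterS ae => w hw; apply: cvgM; last exact: hw.
    apply: cvgV; first by rewrite gt_eqF.
    exact: (cvg_comp _ _ vv (@sqrt_continuous R v)).
have gZ1 : gaussian Z 1 by split=> // U mU; rewrite sqrtr1; exact: lawZ.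
have gY : gaussian Y v.
  have eZ : (fun w => Num.sqrt v * Z w) = Y.
    by apply/funext => w; rewrite /Z mulVKf// (gt_eqF sv).
  have ev : Num.sqrt v ^+ 2 * 1 = v by rewrite mulr1 sqr_sqrtr// ltW.
  by have := gaussian_scale gZ1 sv; rewrite eZ ev.
split=> //.
pose e n := (\int[P]_w ((Y_ n w - Y w) ^+ 2)%:E)%E.
have mYn n : measurable_fun setT (Y_ n) by have [] := g_ n.
have me n : measurable_fun setT (fun w => ((Y_ n w - Y w) ^+ 2)%:E).
  by apply/measurable_EFinP; apply: measurable_funX; exact: measurable_funB.
have mp n : measurable_fun setT (fun w => ((Y_ n w + Y w) ^+ 2)%:E).
  by apply/measurable_EFinP; apply: measurable_funX; exact: measurable_funD.
have sum n : (\int[P]_w ((Y_ n w + Y w) ^+ 2)%:E + e n = (2 * v_ n + 2 * v)%:E)%E.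
  rewrite /e -ge0_integralD//; last 2 first.
  - by move=> w _; rewrite lee_fin sqr_ge0.
  - by move=> w _; rewrite lee_fin sqr_ge0.
  rewrite EFinD !EFinM -(gaussian_sqr (g_ n)) -(gaussian_sqr gY).
  have ms n' : measurable_fun setT (fun w => (Y_ n' w ^+ 2)%:E).
    by apply/measurable_EFinP; exact: measurable_funX.
  have msY : measurable_fun setT (fun w => (Y w ^+ 2)%:E).
    by apply/measurable_EFinP; exact: measurable_funX.
  rewrite -!ge0_integralZl//; try by move=> w _; rewrite lee_fin sqr_ge0.
  rewrite -ge0_integralD//; first by apply: eq_integral => w _; rewrite -!EFinM -!EFinD; congr (_%:E); ring.
  - by move=> w _; rewrite mule_ge0// lee_fin sqr_ge0.
  - by apply: measurable_funeM.
  - by move=> w _; rewrite mule_ge0// lee_fin sqr_ge0.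
  - by apply: measurable_funeM.
have p0 n w : setT w -> (0 <= ((Y_ n w + Y w) ^+ 2)%:E)%E.
  by move=> _; rewrite lee_fin sqr_ge0.
have F := fatou P measurableT mp p0.
have L : (\int[P]_w limn_einf (fun n => ((Y_ n w + Y w) ^+ 2)%:E) = (4 * v)%:E)%E.
  have msY : measurable_fun setT (fun w => (Y w ^+ 2)%:E).
    by apply/measurable_EFinP; exact: measurable_funX.
  rewrite EFinM -(gaussian_sqr gY) -ge0_integralZl//; last first.
    by move=> w _; rewrite lee_fin sqr_ge0.
  apply: ae_eq_integral => //.
  - apply: (@measurableT_comp _ _ _ _ _ _ -%E) => //.
    by apply: measurable_fun_limn_esup => n; exact: (@measurableT_comp _ _ _ _ _ _ -%E).
  - exact: measurable_funeM.
  - apply: filterS ae => w hw _; apply: (cvg_limn_einf_sup _).1.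
    apply: cvg_EFin; first exact: nearW.
    rewrite (_ : 4 * Y w ^+ 2 = (Y w + Y w) ^+ 2); last by ring.
    apply: (@cvg_comp _ _ _ (fun n => Y_ n w + Y w) (fun y => y ^+ 2)); last exact: exprn_continuous.
    by apply: cvgD => //; exact: cvg_cst.
have e0 n : (0 <= e n)%E by apply: integral_ge0 => w _; rewrite lee_fin sqr_ge0.
have pn n : (0 <= \int[P]_w ((Y_ n w + Y w) ^+ 2)%:E)%E by apply: integral_ge0 => w _; exact: p0.
have efin n : e n \is a fin_num.
  rewrite ge0_fin_numE//; apply: (@le_lt_trans _ _ (2 * v_ n + 2 * v)%:E); last exact: ltry.
  by rewrite -sum leeDr.
apply/fine_cvgP; split; first by apply: nearW => n; exact: efin.
apply/cvgrPdist_le => eps' eps0; pose eps : R := eps'; change (is_true (0 < eps)) in eps0; rewrite -/eps.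
have e4 : 0 < eps / 4 by rewrite divr_gt0.
have lt4 : ((4 * v - eps / 4)%:E < limn_einf (fun n => \int[P]_w ((Y_ n w + Y w) ^+ 2)%:E))%E.
  by apply: lt_le_trans F; rewrite L lte_fin gtrDl oppr_lt0.
have near1 := limn_einf_gt lt4.
have near2 : \forall n \near \oo, `|v - v_ n| <= eps / 4 by move/cvgrPdist_le : vv; exact.
near=> n.
have h1 : ((4 * v - eps / 4)%:E < \int[P]_w ((Y_ n w + Y w) ^+ 2)%:E)%E by near: n.
have h2 : `|v - v_ n| <= eps / 4 by near: n.
have := sum n; rewrite -(fineK (efin n)) /= sub0r normrN.
change (`|fine (\int[P]_w ((Y_ n w - Y w) ^+ 2)%:E)|) with (`|fine (e n)|).
rewrite (ger0_norm (fine_ge0 (e0 n))).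
move: h1 (fine (e n)); case: (\int[P]_w _)%E => [a|//|//].
rewrite lte_fin => h1 z; rewrite -EFinD => -[h3].
have := ler_norm (- (v - v_ n)); rewrite normrN => h4; lra.
Unshelve. all: by end_near. Qed.

End gaussian.

Section gaussian_add.
Context (R : realType).
Notation mu := (@lebesgue_measure R).
Implicit Types (v w y z : R).

(** Tonelli and [normal_pdf_mul]: the conditional density integrates to 1. *)
Lemma normal_prob_convolution v w (U : set R) : 0 < v -> 0 < w -> measurable U ->
  (\int[mu]_y (normal_prob y (Num.sqrt w) U * (normal_pdf 0 (Num.sqrt v) y)%:E) =
   normal_prob 0 (Num.sqrt (v + w)) U)%E.
Proof.
move=> v0 w0 mU; have vw0 : 0 < v + w by rewrite addr_gt0.
have vwd0 : 0 < v * w / (v + w) by rewrite divr_gt0// mulr_gt0.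
have sw : 0 < Num.sqrt w by rewrite sqrtr_gt0.
pose g y z : R := \1_U z * (normal_pdf 0 (Num.sqrt v) y * normal_pdf y (Num.sqrt w) z).
pose f (p : measurableTypeR R * measurableTypeR R) := (g p.1 p.2)%:E.
have f0 p : (0 <= f p)%E by rewrite lee_fin !mulr_ge0 ?normal_pdf_ge0.
have shift y z : normal_pdf y (Num.sqrt w) z = normal_pdf 0 (Num.sqrt w) (z - y).
  have := normal_pdf_affine 0 y z sw ltr01.
  by rewrite !divr1 !mul1r addr0 => ->.
have mf : measurable_fun setT f.
  apply/measurable_EFinP; apply: measurable_funM.
    by apply: measurableT_comp; [exact: measurable_indic|exact: measurable_snd].
  apply: measurable_funM.
    by apply: measurableT_comp; [exact: measurable_normal_pdf|exact: measurable_fst].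
  under eq_fun => p do rewrite shift.
  apply: measurableT_comp; first exact: measurable_normal_pdf.
  by apply: measurable_funB; [exact: measurable_snd|exact: measurable_fst].
have mpdf m s : measurable_fun setT (fun z : measurableTypeR R => (normal_pdf m s z)%:E).
  by apply/measurable_EFinP; exact: measurable_normal_pdf.
have mind : measurable_fun setT (fun z : measurableTypeR R => (\1_U z)%:E : \bar R).
  by apply/measurable_EFinP; exact: measurable_indic.
transitivity (\int[mu]_y \int[mu]_z f (y, z))%E.
  apply: eq_integral => y _; rewrite /normal_prob integral_mkcond muleC.
  rewrite -ge0_integralZl//.
  - apply: eq_integral => z _; rewrite /f /g /= patchE indicE.
    by case: ifP => _; rewrite ?mule0 ?mul0r// mul1r.
  - by apply/(measurable_restrictT _ mU); apply: measurable_funTS; exact: mpdf.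
  - by move=> z _; rewrite patchE; case: ifP => // _; rewrite lee_fin normal_pdf_ge0.
  - by rewrite lee_fin normal_pdf_ge0.
rewrite (fubini_tonelli (m1 := mu) (m2 := mu) f mf f0).
rewrite /normal_prob [RHS]integral_mkcond; apply: eq_integral => z _.
transitivity (\int[mu]_y ((\1_U z * normal_pdf 0 (Num.sqrt (v + w)) z)%:E *
    (normal_pdf (z * v / (v + w)) (Num.sqrt (v * w / (v + w))) y)%:E))%E.
  by apply: eq_integral => y _; rewrite /f /g /= normal_pdf_mul// mulrA EFinM.
rewrite ge0_integralZl//; last 2 first.
- by move=> y _; rewrite lee_fin normal_pdf_ge0.
- by rewrite lee_fin mulr_ge0 ?normal_pdf_ge0.
rewrite integral_normal_pdf mule1 patchE indicE.
by case: ifP => _; rewrite ?mul0r// mul1r.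
Qed.

(** Uniqueness of product measures identifies the joint law, so the law of the
    sum is the convolution of [normal_prob_convolution]. *)
Lemma gaussian_add d (T : measurableType d) (P : probability T R) (Y Z : T -> R) v w :
  gaussian P Y v -> gaussian P Z w ->
  (forall V U : set R, measurable V -> measurable U ->
     P (Y @^-1` V `&` Z @^-1` U) = (P (Y @^-1` V) * P (Z @^-1` U))%E) ->
  gaussian P (fun x => Y x + Z x) (v + w).
Proof.
move=> [v0 mY lawY] [w0 mZ lawZ] ind; split.
- by rewrite addr_gt0.
- exact: measurable_funD.
move=> U mU; rewrite -normal_prob_convolution//.
have sw : 0 < Num.sqrt w by rewrite sqrtr_gt0.
pose m1 := normal_prob (0 : R) (Num.sqrt v).
pose m2 := normal_prob (0 : R) (Num.sqrt w).
pose YZ x : measurableTypeR R * measurableTypeR R := (Y x, Z x).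
have mYZ : measurable_fun setT YZ by exact/measurable_fun_pair.
have madd : measurable_fun setT (fun p : measurableTypeR R * measurableTypeR R => p.1 + p.2 : R).
  by apply: measurable_funD; [exact: measurable_fst|exact: measurable_snd].
pose X := (fun p : measurableTypeR R * measurableTypeR R => p.1 + p.2 : R) @^-1` U.
have mX : measurable X by rewrite -[X]setTI; exact: madd.
have prodE : (forall A B : set (measurableTypeR R), measurable A -> measurable B ->
    pushforward P YZ (A `*` B) = m1 A * m2 B)%E.
  move=> A B mA mB; rewrite /pushforward /m1 /m2 -(lawY _ mA) -(lawZ _ mB) -ind//.
have := @product_measure_unique _ _ (measurableTypeR R) (measurableTypeR R) R m1 m2
  (pushforward P (mfun_Sub (mem_set mYZ))) prodE X mX.
rewrite /pushforward => h.
transitivity ((m1 \x m2) X)%E; first by rewrite h.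
rewrite /product_measure1.
have xs y : xsection X y = (fun z : R => y + 1 * z) @^-1` U.
  by apply/seteqP; split => z; rewrite /xsection /= inE mul1r.
have dens := @ge0_integral_density _ _ _ mu m1 (normal_pdf 0 (Num.sqrt v))
  (measurable_normal_pdf 0 (Num.sqrt v)) (normal_pdf_ge0 0 (Num.sqrt v))
  (fun U _ => erefl) _ (measurable_fun_xsection m2 mX) (fun y => measure_ge0 m2 _).
rewrite dens; apply: eq_integral => y _; congr (_ * _)%E.
by rewrite /m2 /= xs normal_prob_affine// mulr0 addr0 mul1r.
Qed.

End gaussian_add.

(** * Riemann sums and step functions *)

Section riemann_sums.
Context {R : realType}.
Notation mu := (@lebesgue_measure R).
Implicit Types (u du beta f : R -> R) (F : nat -> R) (h s t : R) (n N j : nat).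

Lemma cont_bounded beta t : continuous beta -> 0 <= t ->
  exists2 C : R, 0 <= C & forall s, 0 <= s <= t -> `|beta s| <= C.
Proof.
move=> cb t0; have [|c _ hc] := @EVT_max R (fun s => `|beta s|) 0 t t0.
  by apply: cont_within => s _; apply: cvg_norm; exact: cb.
exists `|beta c| => // s hs; apply: hc; by rewrite in_itv.
Qed.

Lemma Rintegral_grid f F h N : 0 < h ->
  mu.-integrable `[0, h * N%:R] (EFin \o f) ->
  (forall j, (j < N)%N -> \int[mu]_(s in `]h * j%:R, h * j.+1%:R]) f s = F j) ->
  \int[mu]_(s in `[0, h * N%:R]) f s = \sum_(j < N) F j.
Proof.
move=> h0; elim: N => [|n IH] fi hF.
  by rewrite big_ord0 mulr0 set_itv1 Rintegral_set1.
have le1 : 0 <= h * n%:R by rewrite mulr_ge0 ?ler0n ?ltW.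
have le2 : h * n%:R <= h * n.+1%:R by rewrite ler_pM2l// ler_nat.
rewrite (Rintegral_itv_split le1 le2 fi) big_ord_recr/= IH; first last.
- by move=> j jn; apply: hF; exact: ltnW.
- by apply: integrableS fi => // s; rewrite /= !in_itv/= => /andP[-> /le_trans ->].
congr (_ + _); rewrite -hF// Rintegral_itv_obnd_cbnd//.
apply: (@integrableS _ _ _ mu _ _ _ _ _ _ fi) => // s; rewrite /= !in_itv/= => /andP[s1 ->].
by rewrite andbT (le_trans le1)// ltW.
Qed.

(** The smallest point of the grid of mesh [h] that is at least [s]. *)
Definition rup h s : R := h * (Num.ceil (s / h))%:~R.

Lemma le_rup h s : 0 < h -> s <= rup h s.
Proof. by move=> h0; rewrite /rup mulrC -ler_pdivrMr// ceil_ge. Qed.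

Lemma rup_lt h s : 0 < h -> rup h s < s + h.
Proof.
move=> h0; rewrite /rup mulrC -ltr_pdivlMr// mulrDl divff ?gt_eqF//.
by rewrite -ltrBlDr; have := ceilB1_lt (s / h); rewrite intrB.
Qed.

Lemma rup_grid h j s : 0 < h -> h * j%:R < s <= h * j.+1%:R -> rup h s = h * j.+1%:R.
Proof.
move=> h0 /andP[a b]; rewrite /rup (_ : Num.ceil _ = j.+1)//.
apply/ceil_def; rewrite ltr_pdivlMr// ler_pdivrMr// ![_ * h]mulrC b andbT.
by rewrite intrD -addn1 PoszD intrD addrK.
Qed.

Lemma measurable_rup h : 0 < h -> measurable_fun setT (rup h).
Proof.
move=> h0; apply: nondecreasing_measurable => // s t st.
by rewrite /rup ler_pM2l// ler_int le_ceil// ler_pM2r// invr_gt0.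
Qed.

Lemma integrable_rup h t du beta : 0 < h -> 0 <= t -> continuous beta ->
  {within `[0, t], continuous du} ->
  mu.-integrable `[0, t] (EFin \o (fun s => du s * beta (rup h s))).
Proof.
move=> h0 t0 cb cdu; have th0 : 0 <= t + h by rewrite addr_ge0// ltW.
have [C C0 hC] := cont_bounded cb th0.
have i := @integrable_scaler _ _ _ mu _ _ (measurable_itv `[0, t]) (cont_integrable cdu) C.
have key s : 0 <= s <= t -> `|du s * beta (rup h s)| <= `|C * du s|.
  move=> /andP[s0 st]; rewrite !normrM mulrC ler_wpM2r// (ger0_norm C0); apply: hC.
  by rewrite (le_trans s0 (le_rup s h0))/= (le_trans (ltW (rup_lt s h0)))// lerD2r.
apply: (le_integrable _ _ _ i) => //.
  apply/measurable_EFinP; apply: measurable_funM.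
    exact: subspace_continuous_measurable_fun.
  apply: measurable_funTS; apply: measurableT_comp; last exact: measurable_rup.
  exact: continuous_measurable_fun.
Qed.

(** Summation by parts turns a Riemann-Stieltjes sum against [beta] into an
    integral of [beta] rounded up to the grid. *)
Lemma abel_sum u du beta h N : 0 < h -> continuous beta -> beta 0 = 0 ->
  (forall s, 0 <= s <= h * N%:R -> is_derive s 1 u (du s)) ->
  (forall s, 0 <= s <= h * N%:R -> {for s, continuous du}) ->
  \sum_(j < N) u (h * j%:R) * (beta (h * j.+1%:R) - beta (h * j%:R)) =
  u (h * N%:R) * beta (h * N%:R) -
    \int[mu]_(s in `[0, h * N%:R]) (du s * beta (rup h s)).
Proof.
move=> h0 cb b0 dU cdu; have T0 : 0 <= h * N%:R by rewrite mulr_ge0 ?ler0n ?ltW.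
have cw : {within `[0, h * N%:R], continuous du}.
  by apply: cont_within => s; rewrite /= in_itv; exact: cdu.
pose F j := beta (h * j.+1%:R) * (u (h * j.+1%:R) - u (h * j%:R)).
rewrite (@Rintegral_grid _ F h N h0 (integrable_rup h0 T0 cb cw)).
  elim: N {T0 cw dU cdu} => [|n IH]; first by rewrite !big_ord0 mulr0 b0 mulr0 subr0.
  rewrite !big_ord_recr/= IH /F; ring.
move=> j jN; have j0 : 0 <= h * j%:R by rewrite mulr_ge0 ?ler0n ?ltW.
have jj : h * j%:R <= h * j.+1%:R by rewrite ler_pM2l// ler_nat.
have jT : h * j.+1%:R <= h * N%:R by rewrite ler_pM2l// ler_nat.
have sub s : h * j%:R <= s <= h * j.+1%:R -> 0 <= s <= h * N%:R.
  by move=> /andP[a b]; rewrite (le_trans j0 a) (le_trans b jT).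
have iw : mu.-integrable `[h * j%:R, h * j.+1%:R] (EFin \o du).
  by apply: cont_integrable; apply: cont_within => s; rewrite /= in_itv => /sub; exact: cdu.
rewrite /F -(FTC2 jj (fun s hs => dU s (sub s hs)) (fun s hs => cdu s (sub s hs))).
rewrite -RintegralZl//.
rewrite -[RHS]Rintegral_itv_obnd_cbnd; last first.
  have iz := @integrable_scaler _ _ _ mu _ _ (measurable_itv _) iw (beta (h * j.+1%:R)).
  apply: (@integrableS _ _ _ mu _ _ _ _ _ _ iz) => // s; rewrite /= !in_itv/= => /andP[/ltW -> ->] //.
apply: eq_Rintegral => s; rewrite inE/= in_itv/= => hs.
by rewrite (rup_grid h0 hs) mulrC.
Qed.

(** On each cell the left endpoint overestimates the integral by at most [h] times
    the decrease of [u ^ 2] over the cell, and these decreases telescope. *)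
Lemma le_sum_sqr u h N : 0 < h -> 
  (forall s t, 0 <= s -> s <= t -> t <= h * N%:R -> u t <= u s) ->
  (forall s, 0 <= s <= h * N%:R -> 0 <= u s) ->
  (forall s, 0 <= s <= h * N%:R -> {for s, continuous u}) ->
  \int[mu]_(s in `[0, h * N%:R]) (u s ^+ 2) <= \sum_(j < N) u (h * j%:R) ^+ 2 * h
    <= \int[mu]_(s in `[0, h * N%:R]) (u s ^+ 2) + h * u 0 ^+ 2.
Proof.
move=> h0 mono u0 cu; have T0 : 0 <= h * N%:R by rewrite mulr_ge0 ?ler0n ?ltW.
have cu2 s : 0 <= s <= h * N%:R -> {for s, continuous (fun s => u s ^+ 2)}.
  by move=> hs; apply: (@cvg_comp _ _ _ u (fun y => y ^+ 2)); [exact: cu|exact: exprn_continuous].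
have i2 : mu.-integrable `[0, h * N%:R] (EFin \o (fun s => u s ^+ 2)).
  by apply: cont_integrable; apply: cont_within => s; rewrite /= in_itv; exact: cu2.
pose F j := \int[mu]_(s in `]h * j%:R, h * j.+1%:R]) (u s ^+ 2).
rewrite (@Rintegral_grid _ F h N h0 i2)//.
have hj j : 0 <= h * j%:R by rewrite mulr_ge0 ?ler0n ?ltW.
have cell j : (j < N)%N -> h * u (h * j.+1%:R) ^+ 2 <= F j <= h * u (h * j%:R) ^+ 2.
  move=> jN.
  have jj : h * j%:R < h * j.+1%:R by rewrite ltr_pM2l// ltr_nat.
  have jT : h * j.+1%:R <= h * N%:R by rewrite ler_pM2l// ler_nat.
  have iF : mu.-integrable `]h * j%:R, h * j.+1%:R] (EFin \o (fun s => u s ^+ 2)).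
    apply: integrableS i2 => // s; rewrite /= !in_itv/= => /andP[a b].
    by rewrite (le_trans (hj j) (ltW a)) (le_trans b jT).
  have cst (c : R) : \int[mu]_(s in `]h * j%:R, h * j.+1%:R]) c = h * c.
    rewrite Rintegral_cst//= lebesgue_measure_itv/= lte_fin jj -EFinD/= mulrC.
    by rewrite -mulrBr -natrB// subSnn mulr1.
  have ic (c : R) : mu.-integrable `]h * j%:R, h * j.+1%:R] (EFin \o (fun=> c)).
    apply: (@integrableS _ _ _ mu `[h * j%:R, h * j.+1%:R]) => //.
      by move=> s; rewrite /= !in_itv/= => /andP[/ltW -> ->].
    by apply: cont_integrable; apply: cont_within => s _; exact: cvg_cst.
  rewrite -(cst (u (h * j.+1%:R) ^+ 2)) -(cst (u (h * j%:R) ^+ 2)); apply/andP; split.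
  - apply: le_Rintegral; first by [].
    + exact: ic.
    + exact: iF.
    + move=> s; rewrite /= in_itv/= => /andP[a b]; have s0 := le_trans (hj j) (ltW a).
      by rewrite ler_sqr ?nnegrE; [exact: mono|apply: u0; rewrite hj|apply: u0; rewrite s0 (le_trans b)].
  - apply: le_Rintegral; first by [].
    + exact: iF.
    + exact: ic.
    + move=> s; rewrite /= in_itv/= => /andP[a b]; have s0 := le_trans (hj j) (ltW a).
      rewrite ler_sqr ?nnegrE; [apply: mono => //; [exact: ltW|exact: le_trans b jT]|apply: u0; rewrite s0 (le_trans b)//|apply: u0].
      by rewrite hj (le_trans (ltW jj)).
apply/andP; split.
  by apply: ler_sum => j _; have /andP[_] := cell j (ltn_ord j); rewrite mulrC.
have H : forall n, (n <= N)%N ->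
    \sum_(j < n) u (h * j%:R) ^+ 2 * h + h * u (h * n%:R) ^+ 2 <= \sum_(j < n) F j + h * u 0 ^+ 2.
  elim=> [|n IH] nN; first by rewrite !big_ord0 !add0r mulr0.
  have := IH (ltnW nN); have /andP[c1 c2] := cell n nN.
  rewrite !big_ord_recr/=; move: (\sum_(_ < _) _) (\sum_(_ < _) _) c1 c2.
  by move: (F n) (u (h * n.+1%:R) ^+ 2) (u (h * n%:R) ^+ 2) (u 0 ^+ 2) => *; lra.
apply: le_trans (H N (leqnn N)).
by rewrite lerDl mulr_ge0 ?sqr_ge0// ltW.
Qed.

End riemann_sums.

Section riemann_limits.
Context {R : realType}.
Notation mu := (@lebesgue_measure R).
Implicit Types (u du beta f g : R -> R) (D : set R) (h s t : R) (n N j : nat).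

Lemma Rintegral_dominated_cvg D (f_ : nat -> R -> R) f g : measurable D ->
  (forall n, measurable_fun D (f_ n)) -> mu.-integrable D (EFin \o g) ->
  (forall s, D s -> f_ n s @[n --> \oo] --> f s) ->
  (forall n s, D s -> `|f_ n s| <= g s) ->
  \int[mu]_(s in D) f_ n s @[n --> \oo] --> \int[mu]_(s in D) f s.
Proof.
move=> mD mf_ ig fcv fg.
have mf : measurable_fun D f by exact: (measurable_fun_cvg mf_ fcv).
have m1 n : measurable_fun D (fun s => (f_ n s)%:E) by apply/measurable_EFinP.
have m2 : measurable_fun D (EFin \o f) by apply/measurable_EFinP.
have h1 : {ae mu, forall s, D s -> (f_ n s)%:E @[n --> \oo] --> (f s)%:E}.
  by apply/aeW => s Ds; apply: cvg_EFin; [exact: nearW|exact: fcv].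
have d1 : {ae mu, forall s n, D s -> (`|(f_ n s)%:E| <= (EFin \o g) s)%E}.
  by apply/aeW => s n Ds; rewrite lee_fin; exact: fg.
have [i1 _ h2] := @dominated_convergence _ _ _ mu D mD _ _ _ m1 m2 h1 ig d1.
by apply: fine_cvg; rewrite fineK//; exact: integrable_fin_num.
Qed.

Lemma cvg_rup (h_ : nat -> R) s : (forall n, 0 < h_ n) -> h_ n @[n --> \oo] --> (0 : R) ->
  rup (h_ n) s @[n --> \oo] --> s.
Proof.
move=> h0 hcv; have h : s + h_ n @[n --> \oo] --> s.
  by rewrite -[X in _ --> X]addr0; apply: cvgD => //; exact: cvg_cst.
apply: squeeze_cvgr (cvg_cst s) h.
by near=> n; rewrite le_rup//= ltW// rup_lt.
Unshelve. all: by end_near. Qed.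

Lemma cvg_divS (t : R) : t / n.+1%:R @[n --> \oo] --> (0 : R).
Proof.
rewrite -[X in _ --> X](mulr0 t); apply: cvgM; first exact: cvg_cst.
exact: cvg_harmonic.
Qed.

(** [abel_sum] and dominated convergence, as rounding to finer and finer grids
    converges to the identity. *)
Lemma cvg_riemann u du beta t : 0 < t -> continuous beta -> beta 0 = 0 ->
  (forall s, 0 <= s <= t -> is_derive s 1 u (du s)) ->
  (forall s, 0 <= s <= t -> {for s, continuous du}) ->
  \sum_(j < n.+1) u (t / n.+1%:R * j%:R) *
     (beta (t / n.+1%:R * j.+1%:R) - beta (t / n.+1%:R * j%:R)) @[n --> \oo] -->
  u t * beta t - \int[mu]_(s in `[0, t]) (du s * beta s).
Proof.
move=> t0 cb b0 dU cdu.
have hp n : 0 < t / n.+1%:R by rewrite divr_gt0// ltr0n.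
have hT n : t / n.+1%:R * n.+1%:R = t by rewrite divfK// pnatr_eq0.
rewrite (_ : (fun n => _) = (fun n => u t * beta t -
    \int[mu]_(s in `[0, t]) (du s * beta (rup (t / n.+1%:R) s)))); last first.
  by apply/funext => n; have := @abel_sum _ u du beta _ n.+1 (hp n) cb b0; rewrite hT; exact.
have cw : {within `[0, t], continuous du}.
  by apply: cont_within => s; rewrite /= in_itv; exact: cdu.
apply: cvgB; first exact: cvg_cst.
have [C C0 hC] := cont_bounded cb (addr_ge0 (ltW t0) (ltW t0)).
have i := @integrable_scaler _ _ _ mu _ _ (measurable_itv `[0, t]) (integrable_norm (cont_integrable cw)) C.
apply: (Rintegral_dominated_cvg _ _ i) => //.
- by move=> n; have /integrableP[/measurable_EFinP] := integrable_rup (hp n) (ltW t0) cb cw.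
- move=> s _; apply: cvgM; first exact: cvg_cst.
  by apply: continuous_cvg; [exact: cb|exact: cvg_rup (cvg_divS t)].
- move=> n s; rewrite /= in_itv/= => /andP[s0 st]; rewrite normrM mulrC ler_wpM2r//.
  apply: hC; rewrite (le_trans s0 (le_rup s (hp n)))/=.
  apply: (le_trans (ltW (rup_lt s (hp n)))); apply: lerD => //.
  by rewrite ler_pdivrMr ?ltr0n// ler_peMr ?(ltW t0)// ler1n.
Qed.

Lemma cvg_sum_sqr u t : 0 < t ->
  (forall s s', 0 <= s -> s <= s' -> s' <= t -> u s' <= u s) ->
  (forall s, 0 <= s <= t -> 0 <= u s) ->
  (forall s, 0 <= s <= t -> {for s, continuous u}) ->
  \sum_(j < n.+1) u (t / n.+1%:R * j%:R) ^+ 2 * (t / n.+1%:R) @[n --> \oo] -->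
  \int[mu]_(s in `[0, t]) (u s ^+ 2).
Proof.
move=> t0 mono u0 cu.
have hp n : 0 < t / n.+1%:R by rewrite divr_gt0// ltr0n.
have hT n : t / n.+1%:R * n.+1%:R = t by rewrite divfK// pnatr_eq0.
set V := \int[mu]_(s in _) _.
have h : V + t / n.+1%:R * u 0 ^+ 2 @[n --> \oo] --> V.
  rewrite -[X in _ --> X]addr0 -[X in _ + X](mul0r (u 0 ^+ 2)).
  by apply: cvgD; [exact: cvg_cst|apply: cvgM; [exact: cvg_divS|exact: cvg_cst]].
apply: squeeze_cvgr (cvg_cst V) h.
by near=> n; have := @le_sum_sqr _ u _ n.+1 (hp n); rewrite hT; exact.
Unshelve. all: by end_near. Qed.

End riemann_limits.

Section step_functions.
Context {R : realType}.
Notation mu := (@lebesgue_measure R).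
Implicit Types (u f : R -> R) (h s t : R) (n N i j : nat).

Definition grid_steps u h N : seq (R * (R * R)) :=
  [seq (u (h * j%:R), (h * j%:R, h * j.+1%:R)) | j <- iota 0 N].

Lemma grid_steps_sum (V : R * (R * R) -> R) u h N :
  \sum_(x <- grid_steps u h N) V x =
  \sum_(j < N) V (u (h * j%:R), (h * j%:R, h * j.+1%:R)).
Proof. by rewrite big_map -[N in iota 0 N]subn0 big_mkord. Qed.

Lemma step_integral_grid d (T : measurableType d) (B : R -> T -> R) u h N w :
  step_integral B (grid_steps u h N) w =
  \sum_(j < N) u (h * j%:R) * (B (h * j.+1%:R) w - B (h * j%:R) w).
Proof. by rewrite /step_integral grid_steps_sum. Qed.

Lemma grid_steps_itv u h N x : 0 < h -> x \in grid_steps u h N -> 0 <= x.2.1 <= x.2.2.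
Proof.
move=> h0 /mapP[j _ ->] /=.
by rewrite mulr_ge0 ?(ltW h0) ?ler0n//= ler_pM2l// ler_nat.
Qed.

Lemma cell_inj h i j s : 0 < h -> h * i%:R < s <= h * i.+1%:R ->
  h * j%:R < s <= h * j.+1%:R -> i = j.
Proof.
move=> h0 /andP[a b] /andP[c d].
have := lt_le_trans a d; have := lt_le_trans c b.
by rewrite !ltr_pM2l// !ltr_nat !ltnS => x y; apply/eqP; rewrite eqn_leq x y.
Qed.

Lemma cell_ex h s : 0 < h -> 0 < s -> exists j, h * j%:R < s <= h * j.+1%:R.
Proof.
move=> h0 s0; have c0 : 0 < Num.ceil (s / h) by rewrite ceil_gt0 divr_gt0.
have [k ek] : exists k, Num.ceil (s / h) = k.+1%:Z.
  by case: (Num.ceil _) c0 => [[|k]|//] // _; exists k.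
exists k; have := ceil_itv (s / h); rewrite ek ltr_pdivlMr// ler_pdivrMr//.
by rewrite ![_ * h]mulrC -addn1 PoszD addrK.
Qed.

Lemma step_fun_cell u h N j s : 0 < h -> h * j%:R < s <= h * j.+1%:R ->
  step_fun (grid_steps u h N) s = if (j < N)%N then u (h * j%:R) else 0.
Proof.
move=> h0 hs; rewrite /step_fun grid_steps_sum /=.
have E (i : 'I_N) : i != j :> nat ->
    u (h * i%:R) * \1_`]h * i%:R, h * i.+1%:R] s = 0.
  move=> ij; rewrite indicE memNset ?mulr0//= in_itv/= => hs'.
  by move: ij; rewrite (cell_inj h0 hs' hs) eqxx.
case: ifP => [jN|/negbT jN].
  rewrite (bigD1 (Ordinal jN))//= big1 ?addr0; last by move=> i ij; apply: E.
  by rewrite indicE mem_set ?mulr1//= in_itv.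
apply: big1 => i _; apply: E; apply: contraNneq jN => <-; exact: ltn_ord.
Qed.

Lemma step_fun_le0 u h N s : 0 < h -> s <= 0 -> step_fun (grid_steps u h N) s = 0.
Proof.
move=> h0 s0; rewrite /step_fun grid_steps_sum /=; apply: big1 => i _.
rewrite indicE memNset ?mulr0//= in_itv/= => /andP[a _].
have : 0 <= h * i%:R by rewrite mulr_ge0 ?ler0n ?ltW.
by rewrite leNgt (lt_le_trans a s0).
Qed.

Lemma integral_step_fun (l : seq (R * (R * R))) :
  (forall x, x \in l -> 0 <= x.2.1 <= x.2.2) ->
  mu.-integrable `[0, +oo[ (EFin \o step_fun l) /\
  \int[mu]_(s in `[0, +oo[) step_fun l s = \sum_(x <- l) x.1 * (x.2.2 - x.2.1).
Proof.
elim: l => [_|x l IH hl].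
  have -> : @step_fun R [::] = (fun=> 0) by apply/funext => s; rewrite /step_fun big_nil.
  by split; [exact: integrable0|rewrite big_nil /Rintegral integral0].
have [|i e] := IH; first by move=> y yl; apply: hl; rewrite inE yl orbT.
have /andP[x1 x2] := hl x (mem_head _ _).
have ix : mu.-integrable `[0, +oo[ (EFin \o \1_`]x.2.1, x.2.2]).
  apply/integrableP; split; first by apply/measurable_EFinP; exact: measurable_indic.
  under eq_integral => s _ do rewrite /= ger0_norm//.
  rewrite integral_indic//; apply: (@le_lt_trans _ _ (mu `]x.2.1, x.2.2])).
    by apply: le_measure; rewrite ?inE//; exact: measurableI.
  by rewrite lebesgue_measure_itv/= lte_fin; case: ifP => _; rewrite -?EFinD ltry.
have -> : step_fun (x :: l) = (fun s => x.1 * \1_`]x.2.1, x.2.2] s + step_fun l s).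
  by apply/funext => s; rewrite /step_fun big_cons.
have ix' := @integrable_scaler _ _ _ mu _ _ (measurable_itv `[0, +oo[) ix x.1.
split; first exact: (@integrable_addr _ _ _ mu _ _ _ (measurable_itv `[0, +oo[) ix' i).
rewrite (RintegralD _ ix' i)//= e big_cons; congr (_ + _).
rewrite RintegralZl//; congr (_ * _).
rewrite /Rintegral integral_indic// setIidl; last first.
  by move=> s; rewrite /= !in_itv/= => /andP[/ltW/(le_trans x1) ->].
suff: mu `]x.2.1, x.2.2]%classic = (x.2.2 - x.2.1)%:E by move=> /(congr1 fine).
rewrite lebesgue_measure_itv/= lte_fin; case: ltP => [_|h]; first by rewrite -EFinD.
by congr (_%:E); apply/esym/eqP; rewrite subr_eq0 eq_le h x2.
Qed.

(** Inside the grid the value [a] of the step function at a point and the value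
    [c] of [u] satisfy [a >= c >= 0], hence [(a - c) ^ 2 <= a ^ 2 - c ^ 2]; outside
    the error is [u ^ 2]. Both cases are covered by [a ^ 2 + c ^ 2 - 2 c ^ 2 p] with
    [p] the indicator of the grid. *)
Lemma step_error u h N : 0 < h ->
  (forall s t, 0 <= s -> s <= t -> u t <= u s) -> (forall s, 0 <= s -> 0 <= u s) ->
  (forall s, 0 <= s -> {for s, continuous u}) ->
  mu.-integrable `[0, +oo[ (EFin \o (fun s => u s ^+ 2)) ->
  (\int[mu]_(s in `[0%R, +oo[) ((step_fun (grid_steps u h N) s - u s) ^+ 2)%:E <=
   (\sum_(j < N) u (h * j%:R) ^+ 2 * h + \int[mu]_(s in `[0, +oo[) (u s ^+ 2)
     - 2 * \int[mu]_(s in `[0, h * N%:R]) (u s ^+ 2))%:E)%E.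
Proof.
move=> h0 mono u0 cu i2.
have hj j : 0 <= h * j%:R by rewrite mulr_ge0 ?ler0n ?ltW.
set l := grid_steps u h N.
pose q := step_fun (grid_steps (fun s => u s ^+ 2) h N).
pose p := \1_`]0, h * N%:R] : R -> R.
have [iq eq] : mu.-integrable `[0, +oo[ (EFin \o q) /\
    \int[mu]_(s in `[0, +oo[) q s = \sum_(j < N) u (h * j%:R) ^+ 2 * h.
  have [|i e] := @integral_step_fun (grid_steps (fun s => u s ^+ 2) h N).
    by move=> x; exact: grid_steps_itv.
  split=> //; rewrite e grid_steps_sum; apply: eq_bigr => j _ /=.
  by rewrite -mulrBr -natrB// subSnn mulr1.
have mp : measurable_fun (`[0, +oo[%classic : set R) (fun s => u s ^+ 2 * p s).
  apply: measurable_funM; last exact: measurable_indic.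
  by have /integrableP[/measurable_EFinP] := i2.
have ip : mu.-integrable `[0, +oo[ (EFin \o (fun s => u s ^+ 2 * p s)).
  apply: le_integrable i2 => //; first exact/measurable_EFinP.
  move=> s _; rewrite lee_fin normrM ler_piMr// /p indicE.
  by case: (_ \in _); rewrite ?normr1 ?normr0.
have ep : \int[mu]_(s in `[0, +oo[) (u s ^+ 2 * p s) = \int[mu]_(s in `[0, h * N%:R]) (u s ^+ 2).
  rewrite -[RHS]Rintegral_itv_obnd_cbnd; last first.
    by apply: (@integrableS _ _ _ mu _ _ _ _ _ _ i2) => // s; rewrite /= !in_itv/= => /andP[/ltW ->].
  rewrite /Rintegral [in RHS]integral_mkcond [in LHS]integral_mkcond.
  congr fine; apply: eq_integral => s _; rewrite !patchE /p indicE !mem_setE !in_itv/= andbT.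
  by case: ltP => [/ltW ->|_] /=; [case: (s <= _); rewrite ?mulr1 ?mulr0|case: (0 <= s); rewrite ?mulr0].
have ig := @integrable_subr _ _ _ mu _ _ _ (measurable_itv `[0, +oo[)
  (@integrable_addr _ _ _ mu _ _ _ (measurable_itv `[0, +oo[) iq i2)
  (@integrable_scaler _ _ _ mu _ _ (measurable_itv `[0, +oo[) ip 2).
have key s : 0 <= s -> (step_fun l s - u s) ^+ 2 <= q s + u s ^+ 2 - 2 * (u s ^+ 2 * p s).
  move=> s0; rewrite /p indicE mem_setE in_itv/=.
  have /predU1P[e0|sp] : (0 == s) || (0 < s) by rewrite -le_eqVlt.
    by rewrite -e0 /l /q !step_fun_le0// ltxx/= !mulr0 subr0 sub0r sqrrN add0r.
  have [j js] := cell_ex h0 sp; rewrite sp /l /q !(step_fun_cell _ _ h0 js) /=.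
  have /andP[j1 j2] := js.
  case: ifP => [jN|/negbT]; last first.
    rewrite -leqNgt => jN.
    have -> : (s <= h * N%:R) = false.
      by apply/negbTE; rewrite -ltNge (le_lt_trans _ j1)// ler_pM2l// ler_nat.
    by rewrite !mulr0 subr0 sub0r sqrrN add0r.
  have -> : s <= h * N%:R by rewrite (le_trans j2)// ler_pM2l// ler_nat.
  have := mono _ _ (hj j) (ltW j1); have := u0 _ s0.
  by move: (u s) (u (h * j%:R)) => a c; rewrite /= mulr1; nra.
have me : measurable_fun (`[0, +oo[%classic : set R) (fun s => (step_fun l s - u s) ^+ 2).
  have [il _] := @integral_step_fun l (fun x => grid_steps_itv h0).
  apply: measurable_funX; apply: measurable_funB.
    by have /integrableP[/measurable_EFinP] := il.
  apply: subspace_continuous_measurable_fun => //; apply: cont_within => s.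
  by rewrite /= in_itv/= andbT; exact: cu.
rewrite -eq -ep -RintegralZl// -RintegralD// -RintegralB//; last 2 first.
- exact: (@integrable_addr _ _ _ mu _ _ _ (measurable_itv `[0, +oo[) iq i2).
- exact: (@integrable_scaler _ _ _ mu _ _ (measurable_itv `[0, +oo[) ip 2).
rewrite /Rintegral fineK; last exact: integrable_fin_num ig.
apply: ge0_le_integral => //.
- by move=> s _; rewrite lee_fin sqr_ge0.
- exact/measurable_EFinP.
- by have /integrableP[] := ig.
- by move=> s; rewrite /= in_itv/= andbT => s0; rewrite lee_fin; exact: key.
Qed.

End step_functions.

Section noise_sums.
Context {R : realType}.
Notation mu := (@lebesgue_measure R).
Variable b : R.
Hypothesis b0 : 0 < b.
Implicit Types (beta : R -> R) (s t : R) (n : nat).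
Notation kap := (kap b).
Notation eta := (eta b).

(** Grids of mesh [1 / (n + 1)] with [(n + 1) ^ 2] cells become finer while they
    exhaust the half line, so that a single sequence of step functions serves both
    purposes. *)
Definition mesh n : R := n.+1%:R^-1.
Definition cells n : nat := (n.+1 * n.+1)%N.

Lemma mesh_gt0 n : 0 < mesh n. Proof. by rewrite invr_gt0 ltr0n. Qed.

Lemma mesh_cells n : mesh n * (cells n)%:R = n.+1%:R.
Proof. by rewrite /mesh /cells natrM mulKf// pnatr_eq0. Qed.

Lemma mesh_le1 n : mesh n <= 1.
Proof. by rewrite invf_le1 ?ltr0n// ler1n. Qed.

Lemma cvg_mesh : mesh n @[n --> \oo] --> (0 : R).
Proof. exact: cvg_harmonic. Qed.

Lemma kap_nonincr s t : 0 <= s -> s <= t -> kap t <= kap s.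
Proof. by move=> s0 st; apply: (kap_mono b0) => //; exact: ge0_gtN1. Qed.

Lemma cvg_natS_pinfty (f : R -> R) (l : R) : f t @[t --> +oo] --> l ->
  f n.+1%:R @[n --> \oo] --> l.
Proof.
move=> h; apply: (@cvg_comp _ _ _ (fun n => n.+1%:R) f _ +oo) => //.
apply/cvgryPge => A; near=> n.
apply: (@le_trans _ _ (Num.truncn A).+1%:R); first exact/ltW/truncnS_gt.
by rewrite ler_nat ltnS; near: n; exact: nbhs_infty_ge.
Unshelve. all: by end_near. Qed.

Lemma cvg_kap_sums :
  \sum_(j < cells n) kap (mesh n * j%:R) ^+ 2 * mesh n @[n --> \oo] -->
  \int[mu]_(s in `[0, +oo[) (kap s ^+ 2).
Proof.
have h := cvg_natS_pinfty (cvg_Rintegral_itv0y (integrable_kap_sqr b0)).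
have h2 : (\int[mu]_(s in `[0, n.+1%:R]) (kap s ^+ 2) + mesh n * kap 0 ^+ 2) @[n --> \oo] -->
    \int[mu]_(s in `[0, +oo[) (kap s ^+ 2).
  rewrite -[X in _ --> X]addr0 -[X in _ + X](mul0r (kap 0 ^+ 2)).
  by apply: cvgD => //; apply: cvgM; [exact: cvg_mesh|exact: cvg_cst].
apply: squeeze_cvgr h h2; near=> n.
have := @le_sum_sqr _ kap (mesh n) (cells n) (mesh_gt0 n).
rewrite mesh_cells; apply.
- by move=> s t s0 st _; exact: kap_nonincr.
- by move=> s /andP[s0 _]; exact/ltW/kap_pos.
- by move=> s /andP[s0 _]; exact: cont_kap.
Unshelve. all: by end_near. Qed.

Lemma cvg_kap_step_error :
  (\int[mu]_(s in `[0%R, +oo[) ((step_fun (grid_steps kap (mesh n) (cells n)) s - kap s) ^+ 2)%:E)%E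
    @[n --> \oo] --> 0%E.
Proof.
set V := \int[mu]_(s in `[0, +oo[) (kap s ^+ 2).
have h := cvg_natS_pinfty (cvg_Rintegral_itv0y (integrable_kap_sqr b0)).
have h2 : (\sum_(j < cells n) kap (mesh n * j%:R) ^+ 2 * mesh n + V
    - 2 * \int[mu]_(s in `[0, n.+1%:R]) (kap s ^+ 2))%:E @[n --> \oo] --> 0%E.
  apply: cvg_EFin; first exact: nearW.
  have e0 : V + V - 2 * V = 0 by ring.
  rewrite -[X in _ --> X]e0.
  apply: cvgB; last by apply: cvgM; [exact: cvg_cst|exact: h].
  by apply: cvgD; [exact: cvg_kap_sums|exact: cvg_cst].
apply: squeeze_cvge (cvg_cst 0%E) h2; near=> n; apply/andP; split.
  by apply: integral_ge0 => s _; rewrite lee_fin sqr_ge0.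
have := @step_error _ kap (mesh n) (cells n) (mesh_gt0 n) kap_nonincr.
rewrite mesh_cells; apply.
- by move=> s s0; exact/ltW/kap_pos.
- by move=> s s0; exact: cont_kap.
- exact: integrable_kap_sqr.
Unshelve. all: by end_near. Qed.

(** [abel_sum]: the boundary term vanishes by [cvg_kap_path], and rounding moves the
    time by at most 1, so the integrands stay below [4 c D / (1 + s) ^ 2]. *)
Lemma cvg_noise_sums beta c : continuous beta -> beta 0 = 0 ->
  (forall t, 0 <= t -> `|beta t| <= c * (1 + t) ^+ 2) ->
  \sum_(j < cells n) kap (mesh n * j%:R) *
     (beta (mesh n * j.+1%:R) - beta (mesh n * j%:R)) @[n --> \oo] -->
  \int[mu]_(s in `[0, +oo[) (eta s * beta s).
Proof.
move=> cb be0 hb; have [D D0 hD] := kernel_decay2 b0.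
have c0 : 0 <= c.
  by have := hb 0 (lexx _); rewrite addr0 expr1n mulr1; exact: le_trans.
pose f_ n s : R := eta s * beta (rup (mesh n) s) * \1_`[0, n.+1%:R] s.
rewrite (_ : (fun n => _) = (fun n => kap n.+1%:R * beta n.+1%:R +
    \int[mu]_(s in `[0, +oo[) f_ n s)); last first.
  apply/funext => n.
  have dU s : 0 <= s <= n.+1%:R -> is_derive s 1 kap (- eta s).
    by move=> /andP[s0 _]; exact: (deriv_kap b0 (ge0_gtN1 s0)).
  have cU s : 0 <= s <= n.+1%:R -> {for s, continuous (fun s => - eta s)}.
    by move=> /andP[s0 _]; apply: cvgN; exact: (cont_eta b0 s0).
  have := @abel_sum _ kap (fun s => - eta s) beta _ (cells n) (mesh_gt0 n) cb be0.
  rewrite mesh_cells => /(_ dU cU) ->; congr (_ + _).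
  have cw : {within `[0, n.+1%:R], continuous (fun s => - eta s)}.
    apply: cont_within => s; rewrite /= in_itv/= => /andP[s0 _].
    by apply: cvgN; exact: (cont_eta b0 s0).
  have ii := integrable_rup (mesh_gt0 n) (ler0n R n.+1) cb cw.
  rewrite -mulN1r -RintegralZl// /Rintegral [in LHS]integral_mkcond [in RHS]integral_mkcond.
  congr fine; apply: eq_integral => s _; rewrite !patchE /f_ indicE !mem_setE !in_itv/= andbT.
  case: (0 <= s) => //=; case: (s <= _); rewrite ?mulr0 ?mulr1//.
  by rewrite mulN1r mulNr opprK.
rewrite -[X in _ --> X]add0r; apply: cvgD; first exact: cvg_natS_pinfty (cvg_kap_path b0 hb).
have i := @integrable_scaler _ _ _ mu _ _ (measurable_itv `[0, +oo[) integrable_inv_sqr (4 * (c * D)).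
apply: (Rintegral_dominated_cvg _ _ i) => //.
- move=> n; apply: measurable_funM; last exact: measurable_indic.
  apply: measurable_funM.
    apply: subspace_continuous_measurable_fun => //; apply: cont_within => s.
    by rewrite /= in_itv/= andbT => s0; exact: (cont_eta b0 s0).
  apply: measurable_funTS; apply: measurableT_comp; last exact: measurable_rup (mesh_gt0 n).
  exact: continuous_measurable_fun.
- move=> s; rewrite /= in_itv/= andbT => s0.
  rewrite -[X in _ --> X]mulr1; apply: cvgM.
    apply: cvgM; first exact: cvg_cst.
    by apply: continuous_cvg; [exact: cb|exact: cvg_rup mesh_gt0 cvg_mesh].
  apply: cvg_near_cst; near=> n; rewrite indicE mem_set//= in_itv/= s0/=.
  apply: (@le_trans _ _ (Num.truncn s).+1%:R); first exact/ltW/truncnS_gt.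
  by rewrite ler_nat ltnS; near: n; exact: nbhs_infty_ge.
- move=> n s; rewrite /= in_itv/= andbT => s0.
  have [_ _ he _] := hD _ s0; have es := eta_pos b0 s0.
  have r0 := le_trans s0 (le_rup s (mesh_gt0 n)).
  have r1 : rup (mesh n) s <= s + 1.
    by apply: (le_trans (ltW (rup_lt s (mesh_gt0 n)))); rewrite lerD2l mesh_le1.
  rewrite normrM (@le_trans _ _ `|eta s * beta (rup (mesh n) s)|)//.
    by rewrite ler_piMr// indicE; case: (_ \in _); rewrite ?normr1 ?normr0.
  rewrite normrM (gtr0_norm es).
  apply: (@le_trans _ _ (eta s * (c * (1 + rup (mesh n) s) ^+ 2))).
    by rewrite ler_wpM2l ?(ltW es) ?hb.
  apply: (@le_trans _ _ (eta s * (c * (4 * (1 + s) ^+ 2)))).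
    rewrite ler_wpM2l ?(ltW es)// ler_wpM2l//.
    rewrite (_ : 4 * (1 + s) ^+ 2 = (2 * (1 + s)) ^+ 2); last by ring.
    by rewrite ler_sqr ?nnegrE; lra.
  rewrite (_ : eta s * _ = 4 * c * (eta s * (1 + s) ^+ 2)); last by ring.
  rewrite (_ : 4 * (c * D) / (1 + s) ^+ 2 = 4 * c * (D / (1 + s) ^+ 2)); last by rewrite !mulrA.
  by rewrite ler_wpM2l// mulr_ge0.
Unshelve. all: by end_near. Qed.

End noise_sums.

(** * Wiener integrals over a bounded interval *)

Section wrt.
Context d (T : measurableType d) (R : realType).
Implicit Types (H : set (set T)) (Y Z : T -> R).

(** Real functions measurable with respect to a generated sigma-algebra are the
    measurable functions on the space equipped with that sigma-algebra. *)
Lemma measurable_wrtP H Y :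
  measurable_wrt <<s H>> Y <-> measurable_fun setT (Y : g_sigma_algebraType H -> R).
Proof.
split=> [h _ U mU|h U mU]; first by rewrite setTI; exact: h.
by have := h measurableT U mU; rewrite setTI.
Qed.

Lemma measurable_wrt_cst H (c : R) : measurable_wrt <<s H>> (fun=> c).
Proof. by apply/measurable_wrtP; exact: measurable_cst. Qed.

Lemma measurable_wrtD H Y Z : measurable_wrt <<s H>> Y -> measurable_wrt <<s H>> Z ->
  measurable_wrt <<s H>> (fun w => Y w + Z w).
Proof.
move=> /measurable_wrtP mY /measurable_wrtP mZ; apply/measurable_wrtP.
exact: measurable_funD.
Qed.

Lemma measurable_wrtZ H Y (c : R) : measurable_wrt <<s H>> Y ->
  measurable_wrt <<s H>> (fun w => c * Y w).
Proof.
move=> /measurable_wrtP mY; apply/measurable_wrtP; exact: measurable_funM.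
Qed.

Lemma measurable_wrt_sum H n (Y_ : nat -> T -> R) :
  (forall i, (i < n)%N -> measurable_wrt <<s H>> (Y_ i)) ->
  measurable_wrt <<s H>> (fun w => \sum_(i < n) Y_ i w).
Proof.
move=> mY; apply/measurable_wrtP; apply: measurable_sum => i.
by apply/measurable_wrtP; exact: mY.
Qed.

End wrt.

Section brownian.
Context d (T : measurableType d) (R : realType) (P : probability T R).
Variable B : R -> T -> R.
Hypothesis bm : brownian_motion P B.
Notation mu := (@lebesgue_measure R).
Implicit Types (s t h : R) (u : R -> R) (n N j : nat).

Lemma brownian_wrt (I : set R) s : I s -> measurable_wrt <<s events_of I B>> (B s).
Proof. by move=> Is U mU; apply: sub_gen_smallest; exists s => //; exists U. Qed.

Lemma brownian_wrt_increment (I : set R) s t : I s -> I t ->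
  measurable_wrt <<s events_of I B>> (fun w => B t w - B s w).
Proof.
move=> Is It; have := measurable_wrtD (brownian_wrt It) (measurable_wrtZ (-1) (brownian_wrt Is)).
by under eq_fun => w do rewrite mulN1r.
Qed.

Lemma gaussian_increment s t : 0 <= s -> s < t ->
  gaussian P (fun w => B t w - B s w) (t - s).
Proof.
move=> s0 st; split; first by rewrite subr_gt0.
- by apply: measurable_funB; apply: (brownian_measurable bm) => //; rewrite (le_trans s0)// ltW.
- by move=> U mU; exact: (brownian_normal bm).
Qed.

Definition grid_sum u h N w : R :=
  \sum_(j < N) u (h * j%:R) * (B (h * j.+1%:R) w - B (h * j%:R) w).

Lemma grid_sum_wrt (I : set R) u h N : 0 < h ->
  (forall t, 0 <= t <= h * N%:R -> I t) ->
  measurable_wrt <<s events_of I B>> (grid_sum u h N).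
Proof.
move=> h0 hI; apply: (@measurable_wrt_sum _ _ _ _ N
  (fun j w => u (h * j%:R) * (B (h * j.+1%:R) w - B (h * j%:R) w))) => j jN.
apply: measurable_wrtZ; apply: brownian_wrt_increment; apply: hI.
- by rewrite mulr_ge0 ?ler0n ?(ltW h0)//= ler_pM2l// ler_nat ltnW.
- by rewrite mulr_ge0 ?ler0n ?(ltW h0)//= ler_pM2l// ler_nat.
Qed.

(** Each increment is independent of the preceding partial sum, which belongs to
    the past. *)
Lemma gaussian_grid_sum u h N : 0 < h -> (0 < N)%N ->
  (forall j, (j < N)%N -> 0 < u (h * j%:R)) ->
  gaussian P (grid_sum u h N) (\sum_(j < N) u (h * j%:R) ^+ 2 * h).
Proof.
move=> h0; have hj j : 0 <= h * j%:R by rewrite mulr_ge0 ?ler0n ?ltW.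
have hlt j : h * j%:R < h * j.+1%:R by rewrite ltr_pM2l// ltr_nat.
have hd j : h * j.+1%:R - h * j%:R = h by rewrite -mulrBr -natrB// subSnn mulr1.
have cell j : 0 < u (h * j%:R) -> gaussian P
    (fun w => u (h * j%:R) * (B (h * j.+1%:R) w - B (h * j%:R) w)) (u (h * j%:R) ^+ 2 * h).
  by move=> uj; have := gaussian_scale (gaussian_increment (hj j) (hlt j)) uj; rewrite hd.
case: N => // N _; elim: N => [|n IH] up.
  rewrite /grid_sum big_ord1 (_ : (fun w => _) = (fun w => u (h * 0%:R) * (B (h * 1%:R) w - B (h * 0%:R) w))).
    by apply: cell; exact: up.
  by apply/funext => w; rewrite big_ord1.
have e : grid_sum u h n.+2 = (fun w => grid_sum u h n.+1 w +
    u (h * n.+1%:R) * (B (h * n.+2%:R) w - B (h * n.+1%:R) w)).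
  by apply/funext => w; rewrite /grid_sum big_ord_recr.
rewrite e big_ord_recr/=; have un := up n.+1 (ltnSn _).
apply: gaussian_add.
- by apply: IH => j jn; apply: up; exact: ltnW.
- exact: cell.
move=> V U mV mU.
have mc : measurable_fun setT (fun y : R => u (h * n.+1%:R) * y) by exact: measurable_funM.
have mU' : measurable ((fun y : R => u (h * n.+1%:R) * y) @^-1` U).
  by rewrite -[_ @^-1` _]setTI; exact: mc.
apply: (brownian_indep bm (hj n.+1) (hlt n.+1) _ mU').
exact: (@grid_sum_wrt `[0, h * n.+1%:R]%classic u h n.+1 h0).
Qed.

(** The limit is measurable on the set of convergence, whose complement is null and
    therefore belongs to the completed sigma-algebra. *)
Lemma ae_wrt_limit H (Y_ : nat -> T -> R) (Y : T -> R) :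
  (forall n, measurable_wrt <<s H `|` [set N | P.-negligible N] >> (Y_ n)) ->
  {ae P, forall w, Y_ n w @[n --> \oo] --> Y w} ->
  measurable_wrt <<s H `|` [set N | P.-negligible N] >> Y.
Proof.
set G := _ `|` _ => mY_ ae U mU.
have negG (A : set T) : P.-negligible A -> <<s G >> A.
  by move=> nN; apply: sub_gen_smallest; right.
pose N : set T := ~` [set w | Y_ n w @[n --> \oo] --> Y w].
have nN : P.-negligible N by exact: ae.
have mD : measurable (~` N : set (g_sigma_algebraType G)).
  by apply: measurableC; exact: negG.
have mfD : measurable_fun (~` N : set (g_sigma_algebraType G)) (Y : g_sigma_algebraType G -> R).
  apply: (@measurable_fun_cvg _ (g_sigma_algebraType G) R (~` N) Y_ Y).
    by move=> n; apply: measurable_funTS; apply/measurable_wrtP; exact: mY_.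
  by move=> w /contrapT.
have -> : Y @^-1` U = (~` N `&` Y @^-1` U) `|` (N `&` Y @^-1` U).
  by rewrite -setIUl setUC setUv setTI.
apply: (@measurableU _ (g_sigma_algebraType G)); first exact: mfD.
by apply: negG; apply: negligibleS nN; exact: subIsetl.
Qed.

Lemma wrt_measurable_fun (Y : T -> R) : measure_is_complete P ->
  measurable_wrt (brownian_sigma_algebra P B) Y -> measurable_fun setT Y.
Proof.
move=> Pc mY _ U mU; rewrite setTI; have := mY U mU; apply: smallest_sub.
  exact: sigma_algebra_measurable.
move=> A [[s]|]; last exact: Pc.
rewrite /= in_itv/= andbT => s0 [V mV ->].
by rewrite -[_ @^-1` _]setTI; exact: (brownian_measurable bm s0).
Qed.

(** [Z] is the Wiener integral of [u] integrated by parts: the grid sums are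
    Gaussian and converge to it pathwise by [cvg_riemann], and their variances
    converge by [cvg_sum_sqr]. *)
Lemma gaussian_wiener u du t (Z : T -> R) : 0 < t -> measurable_fun setT Z ->
  (forall s s', 0 <= s -> s <= s' -> s' <= t -> u s' <= u s) ->
  (forall s, 0 <= s <= t -> 0 < u s) ->
  (forall s, 0 <= s <= t -> is_derive s 1 u (du s)) ->
  (forall s, 0 <= s <= t -> {for s, continuous du}) ->
  0 < \int[mu]_(s in `[0, t]) (u s ^+ 2) ->
  {ae P, forall w, Z w = u t * B t w - \int[mu]_(s in `[0, t]) (du s * B s w)} ->
  gaussian P Z (\int[mu]_(s in `[0, t]) (u s ^+ 2)).
Proof.
move=> t0 mZ mono u0 dU cdu V0 aeZ.
have hp n : 0 < t / n.+1%:R by rewrite divr_gt0// ltr0n.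
have cu s : 0 <= s <= t -> {for s, continuous u} by move=> hs; exact: deriv_cont (dU s hs).
apply: (proj1 (@gaussian_limit _ _ _ P (fun n => grid_sum u (t / n.+1%:R) n.+1)
  (fun n => \sum_(j < n.+1) u (t / n.+1%:R * j%:R) ^+ 2 * (t / n.+1%:R)) Z _ _ mZ _ V0 _)).
- move=> n; apply: gaussian_grid_sum => // j jn; apply: u0.
  rewrite mulr_ge0 ?ler0n ?(ltW (hp n))//= mulrAC ler_pdivrMr ?ltr0n//.
  by rewrite ler_pM2l// ler_nat ltnW.
- by apply: cvg_sum_sqr => // s hs; exact/ltW/u0.
- have := brownian_start bm; have := brownian_continuous bm; move: aeZ.
  apply: filterS3 => w eZ cB B0.
  pose beta s := B (Num.max 0 s) w.
  have cb : continuous beta := continuous_clamp cB.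
  have be s : 0 <= s -> beta s = B s w by move=> s0; rewrite /beta max_r.
  have b0 : beta 0 = 0 by rewrite be.
  have := cvg_riemann t0 cb b0 dU cdu.
  rewrite be ?(ltW t0)// (_ : \int[mu]_(s in _) _ = \int[mu]_(s in `[0, t]) (du s * B s w)); last first.
    by apply: eq_Rintegral => s; rewrite inE/= in_itv/= => /andP[s0 _]; rewrite be.
  rewrite -eZ; apply: cvg_trans; apply: near_eq_cvg; near=> n.
  apply: eq_bigr => j _; rewrite !be//; by rewrite mulr_ge0 ?ler0n ?(ltW (hp n)).
Unshelve. all: by end_near. Qed.

End brownian.

(** * Growth of Brownian paths *)

Lemma gaussian_chebyshev d (T : measurableType d) (R : realType) (P : probability T R)
    (Y : T -> R) (v a : R) : gaussian P Y v -> 0 < a ->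
  (P [set w | (a <= `|Y w|)%R] <= (v / a ^+ 2)%:E)%E.
Proof.
move=> g a0; have [_ mY _] := g.
have mn : measurable_fun setT (fun w => `|Y w|) by exact: measurableT_comp.
have mA : measurable [set w | a <= `|Y w|].
  rewrite (_ : [set w | _] = (fun w => `|Y w|) @^-1` `[a, +oo[).
    by rewrite -[_ @^-1` _]setTI; exact: mn.
  by apply/seteqP; split => w; rewrite /= in_itv/= andbT.
have mi : measurable_fun setT (fun w : T => (\1_[set w | a <= `|Y w|] w : R)%:E).
  by apply/measurable_EFinP; exact: measurable_indic.
have h : ((a ^+ 2)%:E * P [set w | (a <= `|Y w|)%R] <= v%:E)%E.
  rewrite -(gaussian_sqr g) -[X in P X]setIT -(integral_indic P measurableT mA).
  rewrite -ge0_integralZl//; last by rewrite lee_fin sqr_ge0.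
  apply: ge0_le_integral => //.
  - by move=> w _; rewrite -EFinM lee_fin mulr_ge0 ?sqr_ge0.
  - exact: measurable_funeM.
  - by apply/measurable_EFinP; exact: measurable_funX.
  move=> w _; rewrite -EFinM lee_fin indicE.
  case: (boolP (_ \in _)) => [|_]; last by rewrite mulr0 sqr_ge0.
  rewrite inE/= mulr1 -[Y w ^+ 2]real_normK ?num_real// => aY.
  by rewrite ler_sqr ?nnegrE// ltW.
have PA : P [set w | a <= `|Y w|] \is a fin_num by exact: fin_num_measure.
move: h; rewrite -(fineK PA) -EFinM !lee_fin => h.
by rewrite ler_pdivlMr ?exprn_gt0// mulrC.
Qed.

Section growth.
Context d (T : measurableType d) (R : realType) (P : probability T R).
Variable B : R -> T -> R.
Hypothesis bm : brownian_motion P B.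
Implicit Types (s t h a : R) (n N j k m : nat).

Let incr h j w : R := B (h * j%:R) w - B 0 w.

(** The strict bound makes [exceeds h a n.+1] the event for the times up to
    [h * n]. *)
Definition exceeds h a n : set T := [set w | exists2 j, (j < n)%N & 2 * a <= `|incr h j w|].

Lemma exceedsS h a n : exceeds h a n.+1 = exceeds h a n `|` [set w | 2 * a <= `|incr h n w|].
Proof.
apply/seteqP; split => [w [j]|w [[j jn hj]|hn]]; last 2 first.
- by exists j => //; exact: ltnW.
- by exists n.
by rewrite ltnS leq_eqVlt => /predU1P[->|jn] hj; [right|left; exists j].
Qed.

Lemma exceeds_past h a n N : 0 < h -> (N <= n.+1)%N ->
  <<s events_of `[0, h * n%:R]%classic B>> (exceeds h a N).
Proof.
move=> h0; set G := events_of _ _.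
have level j : (j <= n)%N -> <<s G>> [set w | 2 * a <= `|incr h j w|].
  move=> jn; have mI : measurable_wrt <<s G>> (incr h j).
    apply: brownian_wrt_increment; rewrite /= in_itv/=.
    - by rewrite lexx mulr_ge0 ?ler0n ?ltW.
    - by rewrite mulr_ge0 ?ler0n ?(ltW h0)//= ler_pM2l// ler_nat.
  have -> : [set w | 2 * a <= `|incr h j w|] = incr h j @^-1` (Num.norm @^-1` `[2 * a, +oo[).
    by apply/seteqP; split => w; rewrite /= in_itv/= andbT.
  apply: mI; have mN : measurable_fun setT (Num.norm : R -> R) by exact: normr_measurable.
  by rewrite -[Num.norm @^-1` _]setTI; exact: mN.
elim: N => [_|N IH Nn].
  have -> : exceeds h a 0 = set0 by apply/seteqP; split => w // -[].
  exact: (@measurable0 _ (g_sigma_algebraType G)).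
rewrite exceedsS; apply: (@measurableU _ (g_sigma_algebraType G)).
  exact: IH (ltnW Nn).
exact: level.
Qed.

Lemma measurable_level h a j : 0 < h -> measurable [set w | a <= `|incr h j w|].
Proof.
move=> h0.
have mI : measurable_fun setT (incr h j).
  by apply: measurable_funB; apply: (brownian_measurable bm) => //; rewrite mulr_ge0 ?ler0n ?ltW.
have mn : measurable_fun setT (fun w => `|incr h j w|) by exact: measurableT_comp.
rewrite (_ : [set w | _] = (fun w => `|incr h j w|) @^-1` `[a, +oo[).
  by rewrite -[_ @^-1` _]setTI; exact: mn.
by apply/seteqP; split => w; rewrite /= in_itv/= andbT.
Qed.

Lemma measurable_exceeds h a n : 0 < h -> measurable (exceeds h a n).
Proof.
move=> h0; elim: n => [|n IH].
  have -> : exceeds h a 0 = set0 by apply/seteqP; split => w // -[].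
  exact: measurable0.
by rewrite exceedsS; apply: measurableU => //; exact: measurable_level.
Qed.

(** Ottaviani's inequality: once a random walk has exceeded [2 a], it is still
    above [a] at time [N] with conditional probability at least 1/2, because the
    future is independent of the past and has small variance. *)
Lemma ottaviani h a N : 0 < h -> 0 < a -> 2 * (h * N%:R) <= a ^+ 2 ->
  (P (exceeds h a N.+1) <= (2 * (h * N%:R / a ^+ 2))%:E)%E.
Proof.
move=> h0 a0 ha; have a20 : 0 < a ^+ 2 by rewrite exprn_gt0.
case: N ha => [|N0] ha.
  have -> : exceeds h a 1 = set0.
    apply/seteqP; split => w // -[j]; rewrite ltnS leqn0 => /eqP ->.
    by rewrite /incr mulr0 subrr normr0 leNgt mulr_gt0.
  by rewrite measure0 mulr0 mul0r mulr0.
set N := N0.+1 in ha *.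
pose G := [set w | a <= `|incr h N w|].
have mG : measurable G by exact: measurable_level.
have mE n : measurable (exceeds h a n) by exact: measurable_exceeds.
have PG : (P G <= (h * N%:R / a ^+ 2)%:E)%E.
  have hN : 0 < h * N%:R by rewrite mulr_gt0// ltr0n.
  have := gaussian_chebyshev (gaussian_increment bm (lexx 0) hN) a0.
  by rewrite subr0.
have step n : (n <= N.+1)%N -> (P (exceeds h a n) <= 2%:E * P (exceeds h a n `&` G))%E.
  elim: n => [_|n IH nN].
    have -> : exceeds h a 0 = set0 by apply/seteqP; split => w // -[].
    by rewrite set0I !measure0 mule0.
  pose A := exceeds h a n.+1 `\` exceeds h a n.
  have mA : measurable A by exact: measurableD.
  have eU : exceeds h a n.+1 = exceeds h a n `|` A.
    by rewrite /A exceedsS setDUl setDv set0U setUDr setDv setD0 setUC setUC.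
  have dis : exceeds h a n `&` A = set0 by rewrite /A setDIK.
  have AI : (P A <= 2%:E * P (A `&` G))%E.
    have memA w : A w -> 2 * a <= `|incr h n w|.
      by rewrite /A exceedsS => -[[//|]].
    move: nN; rewrite ltnS leq_eqVlt => /predU1P[nN|nN].
      have -> : A `&` G = A.
        apply/setIidl => w /memA; rewrite nN => hw; apply: le_trans hw.
        by rewrite ler_peMl ?ler1n// ltW.
      by rewrite -[leLHS]mul1e; apply: lee_wpmul2r; rewrite ?lee_fin ?ler1n.
    have hn0 : 0 <= h * n%:R by rewrite mulr_ge0 ?ler0n ?ltW.
    have hnN : h * n%:R < h * N%:R by rewrite ltr_pM2l// ltr_nat.
    pose D := [set w | a <= `|B (h * N%:R) w - B (h * n%:R) w|].
    have gD := gaussian_increment bm hn0 hnN.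
    pose U := (Num.norm : R -> R) @^-1` `]-oo, a[.
    have mU : measurable U.
      have mN : measurable_fun setT (Num.norm : R -> R) by exact: normr_measurable.
      by rewrite -[U]setTI; exact: mN.
    have eD : ~` D = (fun w => B (h * N%:R) w - B (h * n%:R) w) @^-1` U.
      by apply/seteqP; split => w; rewrite /D /U /= in_itv/= => h1;
        [rewrite ltNge; exact/negP|apply/negP; rewrite -ltNge].
    have mD : measurable D.
      by rewrite -[D]setCK eD; apply: measurableC; have [_ mg _] := gD; rewrite -[_ @^-1` _]setTI; exact: mg.
    have PD : ((2^-1)%:E <= P (~` D))%E.
      have PDle : (P D <= (2^-1)%:E)%E.
        apply: (le_trans (gaussian_chebyshev gD a0)); rewrite lee_fin ler_pdivrMr//.
        by move: ha hn0; move: (h * N%:R) (h * n%:R) (a ^+ 2) => *; lra.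
      have PDf : P D \is a fin_num by exact: fin_num_measure.
      rewrite probability_setC//; move: PDle; rewrite -(fineK PDf) -EFinB !lee_fin.
      by move: (fine _) => x hx; lra.
    have indep : P (A `&` ~` D) = (P A * P (~` D))%E.
      rewrite eD; apply: (brownian_indep bm hn0 hnN _ mU).
      rewrite /A setDE; apply: (@measurableI _ (g_sigma_algebraType (events_of `[0, h * n%:R]%classic B))).
        exact: exceeds_past h0 (leqnn _).
      apply: (@measurableC _ (g_sigma_algebraType (events_of `[0, h * n%:R]%classic B))).
      exact: exceeds_past h0 (leqnSn _).
    apply: (@le_trans _ _ (2%:E * P (A `&` ~` D))%E).
      rewrite indep muleCA -[leLHS]mule1; apply: lee_wpmul2l => //.
      rewrite (_ : 1%E = (2%:E * (2^-1)%:E)%E); last by rewrite -EFinM divff.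
      by apply: lee_wpmul2l.
    apply: lee_wpmul2l => //; apply: le_measure; rewrite ?inE.
    - by apply: measurableI => //; exact: measurableC.
    - exact: measurableI.
    move=> w [Aw Dw]; split=> //; rewrite /G /=.
    have {}Dw : `|B (h * N%:R) w - B (h * n%:R) w| < a by rewrite ltNge; exact/negP.
    move: Dw; have := memA _ Aw.
    rewrite /incr (_ : B (h * n%:R) w - B 0 w =
      (B (h * N%:R) w - B 0 w) - (B (h * N%:R) w - B (h * n%:R) w)); last by ring.
    move: (_ - B 0 w) (_ - B (h * n%:R) w) => x y h1 h2.
    by have := ler_normB x y; lra.
  rewrite [in X in (X <= _)%E]eU [in X in (_ <= X)%E]eU setIUl !measureU//; first last.
  - by rewrite setIACA dis set0I.
  - exact: measurableI.
  - exact: measurableI.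
  rewrite muleDr ?ge0_adde_def ?inE ?measure_ge0//.
  by apply: leeD => //; apply: IH; exact: ltnW.
apply: (le_trans (step _ (leqnn _))); rewrite EFinM; apply: lee_wpmul2l => //.
by apply: le_trans PG; apply: le_measure; rewrite ?inE//; exact: measurableI.
Qed.

End growth.

Section path_growth.
Context d (T : measurableType d) (R : realType) (P : probability T R).
Variable B : R -> T -> R.
Hypothesis bm : brownian_motion P B.
Implicit Types (s t h a : R) (n N j k m : nat).

(** The mesh of the grid of [2 ^ m] cells of [[0, 2 ^ k]]; refinement doubles the
    indices, so the events [big k m] below increase with [m]. *)
Let dyad k m : R := 2 ^+ k / 2 ^+ m.

Let dyad_gt0 k m : 0 < dyad k m.
Proof. by rewrite divr_gt0// exprn_gt0. Qed.

Let dyad_cells k m : dyad k m * (2 ^ m)%:R = 2 ^+ k.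
Proof. by rewrite natrX divfK// expf_neq0. Qed.

Let big k m := exceeds B (dyad k m) (2 * 4 ^+ k) (2 ^ m).+1.

(** [ottaviani] at the level [2 * 4 ^ k], which is so far above the standard
    deviation [sqrt (2 ^ k)] that the bounds are summable in [k]. *)
Lemma brownian_dyadic_max k : (P (\bigcup_m big k m) <= ((2^-1) ^+ k)%:E)%E.
Proof.
have a0 : 0 < 2 * 4 ^+ k :> R by rewrite mulr_gt0// exprn_gt0.
have mb m : measurable (big k m) by exact: (measurable_exceeds bm).
have nd : nondecreasing_seq (big k).
  apply/nondecreasing_seqP => m; apply/subsetPset => w [j jm hj].
  exists (2 * j)%N; first by rewrite expnS ltnS leq_pmul2l// -ltnS.
  rewrite (_ : dyad k m.+1 * (2 * j)%:R = dyad k m * j%:R)//.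
  by rewrite /dyad natrM exprS; field; rewrite expf_neq0.
have cv := nondecreasing_cvg_mu mb (bigcupT_measurable _ mb) nd (mu := P).
rewrite -(cvg_lim _ cv)//; apply: lime_le; first by apply/cvg_ex; exists (P (\bigcup_m big k m)).
apply: nearW => m /=.
have two : (2 : R) ^+ k <= 16 ^+ k by apply: lerXn2r; rewrite ?nnegrE//; lra.
have p2 : 0 < (2 : R) ^+ k by rewrite exprn_gt0.
have e16 : (2 * 4 ^+ k) ^+ 2 = 4 * 16 ^+ k :> R.
  by rewrite exprMn -exprM mulnC exprM; congr (_ * _ ^+ _); lra.
have hle : 2 * (dyad k m * (2 ^ m)%:R) <= (2 * 4 ^+ k) ^+ 2.
  by rewrite dyad_cells e16; lra.
apply: (le_trans (ottaviani bm (dyad_gt0 k m) a0 hle)).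
rewrite lee_fin dyad_cells e16 mulrA ler_pdivrMr; last by rewrite mulr_gt0// exprn_gt0.
rewrite mulrCA -exprMn (_ : 2^-1 * 16 = 8 :> R); last by lra.
have : (2 : R) ^+ k <= 8 ^+ k by apply: lerXn2r; rewrite ?nnegrE//; lra.
lra.
Qed.

(** By the Borel-Cantelli lemma the dyadic bounds hold for all large [k], and
    continuity extends them to all times of [[0, 2 ^ k]], where the level is of the
    order of the squared length [4 ^ k]. *)
Lemma brownian_growth : {ae P, forall w, exists c : R, forall t, 0 <= t ->
  `|B t w| <= c * (1 + t) ^+ 2}.
Proof.
pose F k := \bigcup_m big k m.
have mF k : measurable (F k).
  by apply: bigcupT_measurable => m; exact: (measurable_exceeds bm).
have sF : (\sum_(k <oo) P (F k) < +oo)%E.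
  apply: (@le_lt_trans _ _ (\sum_(k <oo) ((2^-1) ^+ k)%:E)%E).
    by apply: lee_nneseries => // k _; exact: brownian_dyadic_max.
  have c : (\sum_(0 <= k < n) ((2^-1 : R) ^+ k)%:E)%E @[n --> \oo] --> (1 * (1 - 2^-1)^-1 : R)%:E.
    apply: cvg_EFin; first by apply: nearW => n; rewrite sumEFin.
    rewrite (_ : _ \o _ = series (geometric 1 (2^-1 : R))); last first.
      by apply/funext => n; rewrite /series/= sumEFin /=; apply: eq_bigr => i _; rewrite mul1r.
    by apply: cvg_geometric_series; rewrite ger0_norm//; lra.
  by rewrite (cvg_lim _ c)// ltry.
have L := lim_sup_set_cvg0 mF sF.
have nL : P.-negligible (lim_sup_set F).
  exists (lim_sup_set F); split=> //.
  by apply: bigcapT_measurable => n; apply: bigcup_measurable.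
have := brownian_start bm; have := brownian_continuous bm.
have : {ae P, forall w, ~ lim_sup_set F w} by apply: negligibleS nL => w /= /contrapT.
apply: filterS3 => w nF cB B0.
have [K hK] : exists K, forall k, (K <= k)%N -> ~ F k w.
  move: nF => /existsNP[K hK]; exists K => k Kk Fk; apply: hK => _; by exists k.
pose beta s := B (Num.max 0 s) w.
have cb : continuous beta := continuous_clamp cB.
have be s : 0 <= s -> beta s = B s w by move=> s0; rewrite /beta max_r.
have bound k t : (K <= k)%N -> 0 <= t -> t <= 2 ^+ k -> `|B t w| <= 4 * 4 ^+ k.
  move=> Kk t0 tk.
  have cvd : dyad k m @[m --> \oo] --> (0 : R).
    rewrite -[X in _ --> X](mulr0 (2 ^+ k)); apply: cvgM; first exact: cvg_cst.
    rewrite (_ : (fun m => _) = geometric 1 2^-1); last first.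
      by apply/funext => m; rewrite /= mul1r exprVn.
    by apply: cvg_geometric; rewrite ger0_norm//; lra.
  have cv : `|beta (rup (dyad k m) t)| @[m --> \oo] --> `|beta t|.
    apply: cvg_norm; apply: continuous_cvg; first exact: cb.
    exact: cvg_rup (dyad_gt0 k) cvd.
  rewrite -be// -(cvg_lim _ cv)//; apply: limr_le; first by apply/cvg_ex; exists (`|beta t|).
  apply: nearW => m; have dm := dyad_gt0 k m.
  move: (t0); rewrite le_eqVlt => /predU1P[<-|tp].
    by rewrite /rup mul0r ceil0 mulr0 be// B0 normr0 mulr_ge0// exprn_ge0.
  have [j jt] := cell_ex dm tp; rewrite (rup_grid dm jt).
  have jm : (j.+1 < (2 ^ m).+1)%N.
    have /andP[j1 _] := jt; have := lt_le_trans j1 tk.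
    by rewrite -(dyad_cells k m) ltr_pM2l// ltr_nat ltnS.
  have j0 : 0 <= dyad k m * j.+1%:R by rewrite mulr_ge0 ?ler0n ?ltW.
  rewrite be// leNgt; apply/negP => h1; apply: (hK k Kk).
  exists m => //; exists j.+1 => //.
  by rewrite B0 subr0 mulrA (_ : 2 * 2 = 4 :> R) ?(ltW h1)//; lra.
exists (16 + 4 * 4 ^+ K); clear sF L nL.
have c0 : 0 <= 4 * 4 ^+ K :> R by rewrite mulr_ge0// exprn_ge0.
have main n t : 0 <= t -> t <= 2 ^+ (K + n) -> `|B t w| <= (16 + 4 * 4 ^+ K) * (1 + t) ^+ 2.
  elim: n t => [|n IH] t t0 tn.
    rewrite addn0 in tn; apply: (le_trans (bound K t (leqnn _) t0 tn)).
    have : 1 <= (1 + t) ^+ 2 by rewrite expr2; nra.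
    by move: c0; move: (4 * 4 ^+ K) ((1 + t) ^+ 2) => x y; nra.
  have [tn'|tn'] := leP t (2 ^+ (K + n)); first exact: IH.
  apply: (le_trans (bound _ t (leq_addr _ _) t0 tn)).
  have e : 4 * 4 ^+ (K + n.+1) = 16 * (2 ^+ (K + n)) ^+ 2 :> R.
    by rewrite addnS exprS -exprM mulnC exprM mulrA; congr (_ * _ ^+ _); lra.
  have h : (2 ^+ (K + n)) ^+ 2 <= t ^+ 2 :> R.
    by rewrite ler_sqr ?nnegrE ?exprn_ge0// ltW.
  rewrite e; move: h c0; move: ((2 ^+ (K + n)) ^+ 2) (4 * 4 ^+ K) => x y h y0.
  by have : 0 <= y * (1 + t) ^+ 2 by [rewrite mulr_ge0// sqr_ge0]; nra.
move=> t t0; apply: (main (Num.truncn t).+1) => //.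
apply: (le_trans (ltW (truncnS_gt t))).
rewrite -natrX ler_nat; apply: (leq_trans (ltnW (ltn_expl _ (ltnSn 1)))).
by rewrite leq_exp2l// leq_addl.
Qed.

End path_growth.

(** * The noise in the limit *)

Lemma measurable_wrtS d (T : measurableType d) (R : realType) (H H' : set (set T)) (Y : T -> R) :
  H `<=` H' -> measurable_wrt <<s H>> Y -> measurable_wrt <<s H'>> Y.
Proof.
move=> HH' mY U mU; apply: (sub_smallest2r _ HH'); last exact: mY.
exact: smallest_sigma_algebra.
Qed.

Section moments.
Context d (T : measurableType d) (R : realType) (P : probability T R).
Variables (Y : T -> R) (v m c : R).
Hypotheses (g : gaussian P Y v).

Lemma expectation_affine : ('E_P[(fun w => m + c * Y w)%R] = m%:E)%E.
Proof.
rewrite unlock; have iY := gaussian_integrable g.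
have im : P.-integrable setT (EFin \o (fun w : T => m)).
  exact: finite_measure_integrable_cst.
have ic := integrable_scaler measurableT iY c.
transitivity (\int[P]_w (m%:E + (c * Y w)%:E))%E; first by [].
rewrite integralD//.
rewrite integral_cst//= probability_setT mule1.
under [X in (_ + X)%E]eq_integral => w _ do rewrite EFinM.
by rewrite integralZl// (gaussian_mean g) mule0 adde0.
Qed.

Lemma variance_affine : ('V_P[(fun w => m + c * Y w)%R] = (c ^+ 2 * v)%:E)%E.
Proof.
rewrite /variance unlock expectation_affine /= unlock.
transitivity (\int[P]_w ((c ^+ 2)%:E * (Y w ^+ 2)%:E))%E.
  apply: eq_integral => w _; rewrite -EFinM; congr (_%:E).
  change ((m + c * Y w - m) * (m + c * Y w - m) = c ^+ 2 * Y w ^+ 2); ring.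
rewrite ge0_integralZl//.
- by rewrite (gaussian_sqr g) -EFinM.
- by have [_ mY _] := g; apply/measurable_EFinP; exact: measurable_funX.
- by move=> w _; rewrite lee_fin sqr_ge0.
- by rewrite lee_fin sqr_ge0.
Qed.

End moments.

Section noise.
Context d (T : measurableType d) (R : realType) (P : probability T R).
Variables (B : R -> T -> R) (b : R).
Hypotheses (Pc : measure_is_complete P) (bm : brownian_motion P B) (b0 : 0 < b).
Notation mu := (@lebesgue_measure R).
Notation kap := (kap b).
Notation eta := (eta b).

(** The Wiener integral of [kap] over the half line, integrated by parts: the
    boundary terms vanish and [- kap' = eta]. *)
Definition noise w : R := \int[mu]_(s in `[0, +oo[) (eta s * B s w).

Let S n := grid_sum B kap (mesh n) (cells n).

Lemma cvg_grid_noise : {ae P, forall w, S n w @[n --> \oo] --> noise w}.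
Proof.
have := brownian_start bm; have := brownian_continuous bm.
have := brownian_growth bm; apply: filterS3 => w [c hc] cB B0.
pose beta s := B (Num.max 0 s) w.
have cb : continuous beta := continuous_clamp cB.
have be s : 0 <= s -> beta s = B s w by move=> s0; rewrite /beta max_r.
have be0 : beta 0 = 0 by rewrite be.
have hb t : 0 <= t -> `|beta t| <= c * (1 + t) ^+ 2 by move=> t0; rewrite be// hc.
have := cvg_noise_sums b0 cb be0 hb.
rewrite (_ : \int[mu]_(s in _) _ = noise w); last first.
  by apply: eq_Rintegral => s; rewrite inE/= in_itv/= andbT => s0; rewrite be.
apply: cvg_trans; apply: near_eq_cvg; apply: nearW => n.
by apply: eq_bigr => j _; rewrite !be// mulr_ge0 ?ler0n// ltW// mesh_gt0.
Qed.

Lemma noise_wrt : measurable_wrt (brownian_sigma_algebra P B) noise.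
Proof.
apply: (ae_wrt_limit (Y_ := S)); last exact: cvg_grid_noise.
move=> n; apply: (measurable_wrtS (@subsetUl _ _ _)).
apply: grid_sum_wrt; first exact: mesh_gt0.
by move=> t /andP[t0 _]; rewrite /= in_itv/= t0.
Qed.

(** The grid sums are Gaussian and are the integrals of step functions converging
    to [kap], and they tend to [noise] almost surely, so [gaussian_limit] applies. *)
Lemma noise_law : gaussian P noise (\int[mu]_(s in `[0, +oo[) (kap s ^+ 2)) /\
  stochastic_integral P B kap noise.
Proof.
have mN : measurable_fun setT noise.
  by apply: (wrt_measurable_fun bm Pc); exact: noise_wrt.
have gS n : gaussian P (S n) (\sum_(j < cells n) kap (mesh n * j%:R) ^+ 2 * mesh n).
  apply: (gaussian_grid_sum bm (mesh_gt0 n)) => // j _; apply: (kap_pos b0).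
  by rewrite mulr_ge0 ?ler0n// ltW// mesh_gt0.
have [gN cvN] := gaussian_limit gS mN (cvg_kap_sums b0) (Rintegral_kap_sqr_gt0 b0) cvg_grid_noise.
split=> //; split=> //; exists (fun n => grid_steps kap (mesh n) (cells n)); split.
- by move=> n x; apply: grid_steps_itv; exact: mesh_gt0.
- exact: cvg_kap_step_error.
- apply: cvg_trans cvN; apply: near_eq_cvg; apply: nearW => n.
  by apply: eq_integral => w _; rewrite step_integral_grid.
Qed.

End noise.

(** * Solutions of the equation *)

Section solutions.
Context (R : realType) (d : measure_display) (T : measurableType d)
  (P : probability T R) (F : R -> set (set T)) (B X : R -> T -> R)
  (b sigma : R) (psi : R -> R).
Hypotheses (Pc : measure_is_complete P) (Fu : usual_filtration P F)
  (bm : brownian_motion P B) (sigma0 : 0 < sigma) (b0 : 0 < b)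
  (sol : solution P F B b sigma psi X).
Notation mu := (@lebesgue_measure R).
Notation kap := (kap b).
Notation eta := (eta b).
Notation bsol := (bsol b).
Notation dbsol := (dbsol b).
Implicit Types (s t u : R).

Let I0 := \int[mu]_(s in `[-1, 0]) psi s.

Lemma solution_path : {ae P, forall w,
  [/\ {within `[-1, +oo[, continuous (X ^~ w)},
      {within `[0, +oo[, continuous (B ^~ w)},
      B 0 w = 0, X 0 w = psi 0 /\ \int[mu]_(s in `[-1, 0]) X s w = I0 &
      forall t, 0 <= t -> X t w = X 0 w
        + \int[mu]_(s in `[0, t]) (b / (1 + s) * \int[mu]_(u in `[-1, s]) X u w)
        + sigma * B t w]}.
Proof.
have := solution_eq sol; have := solution_init sol.
have : {ae P, forall w, [/\ B 0 w = 0, {within `[0, +oo[, continuous (B ^~ w)} &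
    {within `[-1, +oo[, continuous (X ^~ w)}]}.
  have := brownian_start bm; have := brownian_continuous bm.
  by have := solution_continuous sol; apply: filterS3 => w cX cB B0.
apply: filterS3 => w [B0 cB cX] iX eX; split=> //.
- split; first by apply: iX; rewrite lexx lerN10.
  by apply: eq_Rintegral => s; rewrite inE/= in_itv/= => /iX.
- by move=> t t0; rewrite (eX t t0) B0 subr0.
Qed.

(** [wronskian] for [kap] gives the hypothesis of [kernel_limit], the noise term
    converging by [cvg_noise]. *)
Lemma cvg_kap_solution : {ae P, forall w, kap t * X t w @[t --> +oo] -->
  (psi 0 * kap 0 + I0 * eta 0 + sigma * noise B b w) / 2}.
Proof.
have := brownian_growth bm; have := solution_path; apply: filterS2 => w.
move=> [cX cB B0 [X0 eI] eX] [c hc].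
pose I t : R := \int[mu]_(u in `[-1, t]) X u w.
have dI t : 0 <= t -> is_derive t 1 I (X t w).
  by move=> t0; apply: (deriv_path_integral cX); exact: lt_le_trans t0.
have dk t : 0 <= t -> is_derive t 1 kap (- eta t).
  by move=> t0; exact: (deriv_kap b0 (ge0_gtN1 t0)).
have de t : 0 <= t -> is_derive t 1 (fun t => - eta t) (b / (1 + t) * kap t).
  by move=> t0; apply: (deriv_eq (derivN (deriv_eta b0 (ge0_gtN1 t0)))); rewrite opprK.
have W := wronskian cX cB B0 eX dk de.
have L := cvg_noise b0 cB hc.
apply: (kernel_limit b0 dI (W := fun t => X 0 w * kap 0 - I 0 * (- eta 0)
  + sigma * (kap t * B t w - \int[mu]_(s in `[0, t]) (- eta s * B s w)))).
- by move=> t t0; rewrite -W// mulrN opprK.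
- rewrite X0 /I eI mulrN opprK; apply: cvgD; first exact: cvg_cst.
  by apply: cvgM; [exact: cvg_cst|exact: L].
Qed.

(** [bsol t] is convex on [[0, t]], with slope 0 at [t]. *)
Lemma dbsol_le0 t s : 0 <= s -> s <= t -> dbsol t s <= 0.
Proof.
move=> s0 st; have t0 := le_trans s0 st; rewrite -(dbsol_end b t).
apply: (@deriv_mono _ (fun u => b / (1 + u) * bsol t u) (dbsol t) s t st).
- by move=> u /andP[su _]; apply: (deriv_dbsol b0) => //; exact: le_trans su.
- move=> u /andP[su ut]; have u0 := le_trans s0 su.
  by rewrite mulr_ge0 ?divr_ge0 ?(ltW b0) ?addr_ge0// ltW// (bsol_gt0 b0).
Qed.

Lemma bsol_nonincr t s s' : 0 <= s -> s <= s' -> s' <= t -> bsol t s' <= bsol t s.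
Proof.
move=> s0 ss' s't; have t0 := le_trans s0 (le_trans ss' s't); rewrite -lerN2.
apply: (@deriv_mono _ (fun u => - dbsol t u) (fun u => - bsol t u) s s' ss').
- by move=> u /andP[su _]; apply: derivN; apply: (deriv_bsol b0) => //; exact: le_trans su.
- by move=> u /andP[su us]; rewrite oppr_ge0 dbsol_le0 ?(le_trans s0 su) ?(le_trans us).
Qed.

Definition solution_mean t := psi 0 * bsol t 0 - I0 * dbsol t 0.
Definition solution_var t := \int[mu]_(s in `[0, t]) (bsol t s ^+ 2).

Lemma solution_var_gt0 t : 0 < t -> 0 < solution_var t.
Proof.
move=> t0; have c u : 0 <= u <= t -> {for u, continuous (fun s => bsol t s ^+ 2)}.
  move=> /andP[u0 _]; apply: (@cvg_comp _ _ _ (bsol t) (fun y => y ^+ 2)); last exact: exprn_continuous.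
  exact: deriv_cont (deriv_bsol b0 (ltW t0) u0).
apply: (@lt_le_trans _ _ (\int[mu]_(s in `[0, t]) (1 : R))).
  by rewrite Rintegral_cst//= lebesgue_measure_itv/= lte_fin t0 -EFinD/= subr0 mul1r.
have key (u : R) : 0 <= u -> u <= t -> 1 <= bsol t u ^+ 2.
  move=> u0 ut; have := bsol_nonincr u0 ut (lexx t); rewrite (bsol_end b0 (ltW t0)).
  by move: (bsol t u) => y y1; rewrite -[leLHS](expr1n _ 2) ler_sqr ?nnegrE// (le_trans ler01).
apply: le_Rintegral; first by [].
- by apply: cont_integrable; apply: cont_within => u _; exact: cvg_cst.
- by apply: cont_integrable; apply: cont_within => u; rewrite /= in_itv; exact: c.
- by move=> u; rewrite /= in_itv/= => /andP[u0 ut]; exact: key.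
Qed.

(** By [path_solution] the fluctuation of [X t] is [sigma] times the Wiener
    integral of [bsol t], which is positive and nonincreasing. *)
Lemma gaussian_solution t : 0 < t ->
  exists2 Z, gaussian P Z (solution_var t) & X t = (fun w => solution_mean t + sigma * Z w).
Proof.
move=> t0; have t0' := ltW t0.
have mX : measurable_fun setT (X t).
  move=> _ U mU; rewrite setTI; apply: (filtration_sub Fu t0').
  exact: (solution_adapted sol t0').
exists (fun w => sigma^-1 * (X t w - solution_mean t)); last first.
  by apply/funext => w; rewrite mulVKf ?gt_eqF// addrC subrK.
apply: (gaussian_wiener bm (u := bsol t) (du := dbsol t) t0).
- by apply: measurable_funM => //; exact: measurable_funB.
- exact: bsol_nonincr.
- by move=> s /andP[s0 st]; exact: (bsol_gt0 b0).
- by move=> s /andP[s0 st]; exact: (deriv_bsol b0).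
- by move=> s /andP[s0 st]; exact: deriv_cont (deriv_dbsol b0 t0' s0).
- exact: solution_var_gt0.
have := solution_path; apply: filterS => w [cX cB B0 [X0 eI] eX].
have := path_solution b0 cX cB B0 eX t0'; rewrite X0 eI => ->.
by rewrite -/(solution_mean t) [solution_mean t + _]addrC addrK mulKf// gt_eqF.
Qed.

End solutions.

(** * The growth rate *)

Section growth_rate.
Context (R : realType) (b : R) (b0 : 0 < b).
Implicit Types (t L : R) (f : R -> R).
Notation kap := (kap b).
Notation eta := (eta b).

Definition rate t : R := t `^ (- 4^-1) * expR (2 * Num.sqrt (b * t)).

Let q : R := b `^ 4^-1.

Lemma root4_facts : [/\ 0 < b `^ 4^-1, Num.sqrt b = b `^ 4^-1 ^+ 2,
  b `^ (3 / 4) = b `^ 4^-1 ^+ 3 & b = b `^ 4^-1 ^+ 4].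
Proof.
have q0 : 0 < q by rewrite powR_gt0.
have e2 : Num.sqrt b = q ^+ 2 by rewrite /q powR4_sqrt ?(ltW b0)// sqr_sqrtr// sqrtr_ge0.
split=> //.
- by rewrite [3 / 4]mulrC powRrM (powR_mulrn 3)// ltW.
- by rewrite -[LHS]sqr_sqrtr ?(ltW b0)// e2 -exprM.
Qed.

(** By [kap_asymptotic] dividing by [rate] amounts to multiplying by [kap] and a
    constant. *)
Lemma cvg_rate f L : kap t * f t @[t --> +oo] --> L / 2 ->
  f t / rate t @[t --> +oo] --> b `^ 4^-1 / Num.sqrt pi * L.
Proof.
move=> h; have [q0 _ _ _] := root4_facts.
have sp0 : 0 < Num.sqrt pi :> R by rewrite sqrtr_gt0 pi_gt0.
have A0 : Num.sqrt pi / (2 * b `^ 4^-1) != 0 by rewrite gt_eqF// divr_gt0// mulr_gt0.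
have h2 : (kap t * f t) / (kap t * rate t) @[t --> +oo] -->
    L / 2 / (Num.sqrt pi / (2 * b `^ 4^-1)).
  by apply: cvgM => //; apply: cvgV => //; exact: kap_asymptotic.
rewrite (_ : b `^ 4^-1 / Num.sqrt pi * L = L / 2 / (Num.sqrt pi / (2 * b `^ 4^-1))); last first.
  by field; rewrite !gt_eqF.
apply: cvg_trans h2; apply: near_eq_cvg; near=> t.
have t0 : 0 <= t by [].
have kt := kap_pos b0 t0.
by rewrite /= invfM mulrACA divff ?gt_eqF// mul1r.
Unshelve. all: by end_near. Qed.

Lemma cvg_rate_sqr f L sigma : kap t ^+ 2 * f t @[t --> +oo] --> L / 4 ->
  sigma ^+ 2 * f t / rate t ^+ 2 @[t --> +oo] -->
    (sigma * b `^ 4^-1 / Num.sqrt pi) ^+ 2 * L.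
Proof.
move=> h; have [q0 _ _ _] := root4_facts.
have sp0 : 0 < Num.sqrt pi :> R by rewrite sqrtr_gt0 pi_gt0.
have A0 : 0 < Num.sqrt pi / (2 * b `^ 4^-1) by rewrite divr_gt0// mulr_gt0.
have A2 : (Num.sqrt pi / (2 * b `^ 4^-1)) ^+ 2 != 0 by rewrite expf_neq0// gt_eqF.
have h2 : (kap t * rate t) ^+ 2 @[t --> +oo] --> (Num.sqrt pi / (2 * b `^ 4^-1)) ^+ 2.
  exact: continuous_cvg (@exprn_continuous _ 2 _) (kap_asymptotic b0).
have h3 : sigma ^+ 2 * (kap t ^+ 2 * f t) / (kap t * rate t) ^+ 2 @[t --> +oo] -->
    sigma ^+ 2 * (L / 4) / (Num.sqrt pi / (2 * b `^ 4^-1)) ^+ 2.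
  by apply: cvgM; [apply: cvgM => //; exact: cvg_cst|exact: cvgV].
rewrite (_ : (sigma * _ / _) ^+ 2 * L = sigma ^+ 2 * (L / 4) / (Num.sqrt pi / (2 * b `^ 4^-1)) ^+ 2); last first.
  by field; rewrite !gt_eqF.
apply: cvg_trans h3; apply: near_eq_cvg; near=> t.
have t0 : 0 <= t by [].
have k2 : kap t ^+ 2 != 0 by rewrite expf_neq0// gt_eqF// (kap_pos b0 t0).
rewrite exprMn invfM; move: k2; move: (kap t ^+ 2) (rate t ^+ 2)^-1 => x y x0.
by field.
Unshelve. all: by end_near. Qed.

Lemma rate_sqr t : 0 < t ->
  t `^ (- 2^-1) * expR (4 * Num.sqrt (b * t)) = rate t ^+ 2.
Proof.
move=> t0; rewrite /rate exprMn; congr (_ * _).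
  rewrite expr2 -powRD; last by rewrite (gt_eqF t0) implybT.
  by congr (_ `^ _); lra.
by rewrite -expRM_natl; congr expR; ring.
Qed.

Lemma kap_besselK (s : R) : kap s = Num.sqrt (s + 1) * besselK 1 (2 * Num.sqrt (b * (s + 1))).
Proof. by rewrite kap.unlock. Qed.

Lemma kap0E : kap 0 = besselK 1 (2 * Num.sqrt b).
Proof. by rewrite kap_besselK add0r mulr1 sqrtr1 mul1r. Qed.

Lemma eta0E : eta 0 = Num.sqrt b * besselK 0 (2 * Num.sqrt b).
Proof. by rewrite eta.unlock add0r mulr1. Qed.

End growth_rate.

Theorem theorem4p3 (R : realType) (d : measure_display) (T : measurableType d)
    (P : probability T R) (F : R -> set (set T)) (B X : R -> T -> R)
    (b sigma : R) (psi : R -> R)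
    (P_complete : measure_is_complete P)
    (F_usual : usual_filtration P F)
    (B_brownian : brownian_motion P B)
    (B_adapted : adapted F B)
    (sigma_gt0 : 0 < sigma) (b_gt0 : 0 < b)
    (psi_cont : {within `[-1, 0], continuous psi})
    (X_sol : solution P F B b sigma psi X) :
  exists C : {RV P >-> R},
    (* (a) *)
    [/\ measurable_wrt (brownian_sigma_algebra P B) C,
        normal_rv P C &
        {ae P, forall w,
          X t w / (t `^ (- 4^-1) * expR (2 * Num.sqrt (b * t)))
            @[t --> +oo_R] --> C w}] /\
    (* (b) *)
    (exists2 J : T -> R,
       stochastic_integral P B
         (fun s => Num.sqrt (s + 1) * besselK 1 (2 * Num.sqrt (b * (s + 1)))) J &
       {ae P, forall w,
         C w = (b `^ 4^-1 * Num.sqrt pi)^-1 *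
                 (psi 0 * Num.sqrt b * besselK 1 (2 * Num.sqrt b) +
                  b * (\int[lebesgue_measure]_(s in `[-1, 0]) psi s) *
                    besselK 0 (2 * Num.sqrt b)) +
               sigma * b `^ 4^-1 / Num.sqrt pi * J w}) /\
    (* (c) *)
    [/\ 'E_P[C]%E =
          ((Num.sqrt pi)^-1 *
             (psi 0 * b `^ 4^-1 * besselK 1 (2 * Num.sqrt b) +
              b `^ (3 / 4) * (\int[lebesgue_measure]_(s in `[-1, 0]) psi s) *
                besselK 0 (2 * Num.sqrt b)))%:E,
        'V_P[C]%E =
          ((sigma ^+ 2 * b `^ 2^-1 / pi)%:E *
            \int[lebesgue_measure]_(s in `[0%R, +oo[)
              ((s + 1) * besselK 1 (2 * Num.sqrt (b * (s + 1))) ^+ 2)%:E)%E &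
        (0 < 'V_P[C])%E] /\
    (* (d) *)
    ('E_P[X t] * ((t `^ (- 4^-1) * expR (2 * Num.sqrt (b * t)))^-1)%:E)%E
      @[t --> +oo_R] --> 'E_P[C]%E /\
    ('V_P[X t] * ((t `^ (- 2^-1) * expR (4 * Num.sqrt (b * t)))^-1)%:E)%E
      @[t --> +oo_R] --> 'V_P[C]%E.
Proof.
have [q0 e2 e3 e4] := root4_facts b_gt0.
have s0 : 0 < Num.sqrt pi :> R by rewrite sqrtr_gt0 pi_gt0.
have es : (pi : R) = Num.sqrt pi ^+ 2 by rewrite sqr_sqrtr ?pi_ge0.
set I0 := \int[lebesgue_measure]_(s in `[-1, 0]) psi s.
set V := \int[lebesgue_measure]_(s in `[0, +oo[) (kap b s ^+ 2).
pose W0 := psi 0 * kap b 0 + I0 * eta b 0.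
pose m := b `^ 4^-1 / Num.sqrt pi * W0.
pose c := sigma * b `^ 4^-1 / Num.sqrt pi.
pose J := noise B b.
have c0 : 0 < c by rewrite divr_gt0// mulr_gt0.
have V0 : 0 < V := Rintegral_kap_sqr_gt0 b_gt0.
have [gJ sJ] := noise_law P_complete B_brownian b_gt0.
have mC : measurable_fun setT (fun w => m + c * J w).
  have [_ mJ _] := gJ; apply: measurable_funD => //; exact: measurable_funM.
have [C eC] : exists C : {RV P >-> R}, (C : T -> R) = (fun w => m + c * J w).
  by exists (mfun_Sub (mem_set mC)).
have eK : (fun s : R => Num.sqrt (s + 1) * besselK 1 (2 * Num.sqrt (b * (s + 1)))) = kap b.
  by apply/funext => s; rewrite kap_besselK.
have EC : ('E_P[C] = m%:E)%E by rewrite eC (expectation_affine _ _ gJ).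
have VC : ('V_P[C] = (c ^+ 2 * V)%:E)%E by rewrite eC (variance_affine _ _ gJ).
have intV : (\int[lebesgue_measure]_(s in `[0%R, +oo[)
    ((s + 1) * besselK 1 (2 * Num.sqrt (b * (s + 1))) ^+ 2)%:E = V%:E)%E.
  rewrite /V /Rintegral fineK; last exact: integrable_fin_num (integrable_kap_sqr b_gt0).
  have key (s : R) : 0 <= s ->
      (s + 1) * besselK 1 (2 * Num.sqrt (b * (s + 1))) ^+ 2 = kap b s ^+ 2.
    by move=> s1; rewrite kap_besselK exprMn sqr_sqrtr// addr_ge0.
  by apply: eq_integral => s; rewrite inE/= in_itv/= andbT => s1; rewrite key.
exists C; split; [split|split; [|split; [split|split]]].
- rewrite eC; apply: measurable_wrtD; first exact: measurable_wrt_cst.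
  by apply: measurable_wrtZ; exact: noise_wrt.
- exists m, (c * Num.sqrt V); split; first by rewrite mulr_gt0// sqrtr_gt0.
  by move=> U mU; rewrite eC; exact: (gaussian_affine m gJ c0 mU).
- have := cvg_kap_solution B_brownian b_gt0 X_sol; apply: filterS => w h.
  rewrite eC (_ : m + c * J w = b `^ 4^-1 / Num.sqrt pi * (W0 + sigma * J w)).
    exact: (cvg_rate b_gt0 h).
  by rewrite /m /c; field; rewrite gt_eqF.
- exists J; first by rewrite eK.
  apply: aeW => w; rewrite eC; congr (_ + _).
  (* The constants agree once [b] and [sqrt b] are powers of the fourth root of
     [b]; the arguments of the Bessel functions stay as they are. *)
  have eb : b * I0 = b `^ 4^-1 ^+ 4 * I0 by rewrite -e4.
  rewrite /m /W0 kap0E eta0E eb; move: (besselK 1 _) (besselK 0 _) => K1 K0.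
  by rewrite e2; field; rewrite !gt_eqF.
- rewrite EC; congr (_%:E); rewrite /m /W0 kap0E eta0E.
  move: (besselK 1 _) (besselK 0 _) => K1 K0.
  by rewrite e3 e2; field; rewrite gt_eqF.
- rewrite VC intV -EFinM; congr (_%:E); rewrite powR12_sqrt ?(ltW b_gt0)// e2 es /c.
  by field; rewrite gt_eqF.
- by rewrite VC lte_fin mulr_gt0// exprn_gt0.
- rewrite EC; have h := cvg_rate b_gt0 (@cvg_mean _ b b_gt0 (psi 0) I0).
  have h2 : (solution_mean b psi t / rate b t)%:E @[t --> +oo] --> m%:E.
    by apply: cvg_EFin; [exact: nearW|exact: h].
  apply: cvg_trans h2; apply: near_eq_cvg; near=> t.
  have t0 : 0 < t by [].
  have [Z gZ ->] := gaussian_solution F_usual B_brownian sigma_gt0 b_gt0 X_sol t0.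
  by rewrite (expectation_affine _ _ gZ).
- rewrite VC.
  have h2 : (sigma ^+ 2 * solution_var b t / rate b t ^+ 2)%:E @[t --> +oo] --> (c ^+ 2 * V)%:E.
    apply: cvg_EFin; first exact: nearW.
    exact: cvg_rate_sqr (cvg_variance b_gt0).
  apply: cvg_trans h2; apply: near_eq_cvg; near=> t.
  have t0 : 0 < t by [].
  have [Z gZ ->] := gaussian_solution F_usual B_brownian sigma_gt0 b_gt0 X_sol t0.
  by rewrite (variance_affine _ _ gZ) rate_sqr.
Unshelve. all: by end_near. Qed.
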